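(* Let $0<\alpha<1$, $0<p<1$, $q=1-p$, $c=(p/q)^{1/\alpha}$. For $0<\theta<1$, with $G_\theta$ and $G_{1-\theta}$ independent, define $$\xi^*_\theta\overset{d}{=}\frac{pB_{\theta,1-\theta}}{q+pB_{\theta,1-\theta}}\overset{d}{=}\frac{pG_\theta}{G_\theta+qG_{1-\theta}},\qquad A_{\alpha,\xi^*_\theta}\overset{d}{=}\frac{cB_{\theta,1-\theta}^{1/\alpha}X_\alpha}{cB_{\theta,1-\theta}^{1/\alpha}X_\alpha+1}\overset{d}{=}\frac{cM_1(\varrho_\alpha^{(\alpha\theta)})}{cM_1(\varrho_\alpha^{(\alpha\theta)})+1}.$$ The density of $A_{\alpha,\xi^*_\theta}$ is, for $0<y<1$, $$f_{\alpha,\theta}(y)=\frac{q^\theta}{\pi}\,\frac{y^{\alpha\theta-1}(1-y)^{-1}\sin\!\Big(\theta C_\alpha\big(\tfrac{q^{1/\alpha}y}{p^{1/\alpha}(1-y)}\big)\Big)}{[y^{2\alpha}q^2+2qpy^\alpha(1-y)^\alpha\cos(\alpha\pi)+(1-y)^{2\alpha}p^2]^{\theta/2}},$$ where $C_\alpha(x)=\cot^{-1}\!\big(\cot(\pi\alpha)+\frac{x^\alpha}{\sin(\pi\alpha)}\big)$. The density of $$B_{\alpha\theta,1-\alpha\theta}P_{\alpha,\alpha\theta}(C)\overset{d}{=}B_{\alpha\theta,1-\alpha\theta}A^{(\alpha,\alpha\theta)}_{\alpha,p}\overset{d}{=}B_{\alpha\theta,1-\alpha\theta}M_{\alpha\theta}(\Lambda_{\alpha,p})\overset{d}{=}M_1(\Lambda_{\alpha,p}^{(\alpha\theta)})$$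 is $$\frac{1-y}{(1-p)^\theta}f_{\alpha,\theta}(y)=\frac1\pi\,\frac{y^{\alpha\theta-1}\sin\!\Big(\theta C_\alpha\big(\tfrac{q^{1/\alpha}y}{p^{1/\alpha}(1-y)}\big)\Big)}{[y^{2\alpha}q^2+2qpy^\alpha(1-y)^\alpha\cos(\alpha\pi)+(1-y)^{2\alpha}p^2]^{\theta/2}}.$$ More generally, for all $\theta>0$ with $0<\theta\alpha<1$, $f_{\alpha,\theta}$ is the density of $cM_1(\varrho_\alpha^{(\alpha\theta)})/(cM_1(\varrho_\alpha^{(\alpha\theta)})+1)$ and $\frac{1-y}{(1-p)^\theta}f_{\alpha,\theta}(y)$ is the density of $M_1(\Lambda_{\alpha,p}^{(\alpha\theta)})$.
   Context: Factors in products are independent; $G_a$: Gamma(shape $a$, scale 1); $B_{a,b}$: Beta$(a,b)$; $\cot^{-1}$ takes values in $(0,\pi)$. $X_\alpha\overset{d}{=}S_\alpha/S'_\alpha$ with $S_\alpha,S_\alpha'$ independent positive $\alpha$-stable, $\mathbb{E}[e^{-\lambda S_\alpha}]=e^{-\lambda^\alpha}$; it has density $\varrho_\alpha(y)=\frac{\sin(\pi\alpha)}{\pi}\frac{y^{\alpha-1}}{y^{2\alpha}+2y^\alpha\cos(\pi\alpha)+1}$, $y>0$. $\Lambda_{\alpha,p}$ is the law of $A_{\alpha,p}\overset{d}{=}cX_\alpha/(1+cX_\alpha)$, $c=(p/q)^{1/\alpha}$. For a $[0,1]$-valued $\xi$ independent of $X_\alpha$, $A_{\alpha,\xi}\overset{d}{=}\xi^{1/\alpha}X_\alpha/(\xi^{1/\alpha}X_\alpha+(1-\xi)^{1/\alpha})$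 (occupation time of the positive half-line, up to time 1, of a $\xi$-randomly skewed Bessel process). For a probability $H$ on $[0,\infty)$ with $\int\log(1+x)H(dx)<\infty$ and $\tau>0$, $M_\tau(H)$ is the mean of a Dirichlet process with shape $\tau H$, characterized by $\mathbb{E}[(1+\lambda M_\tau(H))^{-\tau}]=\exp(-\tau\int\log(1+\lambda x)H(dx))$; $H^{(r)}:=rH+(1-r)\delta_0$ for $0<r\le1$. $P_{\alpha,\alpha\theta}(C)$, for a set $C$ with $\mathbb{E}[P_{\alpha,\alpha\theta}(C)]=p$, is the mass given to $C$ by a two-parameter PD$(\alpha,\alpha\theta)$ random probability measure, and $A^{(\alpha,\alpha\theta)}_{\alpha,p}$ (time spent positive up to time 1 by a $p$-skewed generalized Bessel bridge) has the same law; this law on $[0,1]$ is characterized by $\mathbb{E}[(1+\lambda P_{\alpha,\alpha\theta}(C))^{-\alpha\theta}]=(q+p(1+\lambda)^\alpha)^{-\theta}$, $\lambda>0$. *)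

(* Defs.v *)
From HB Require Import structures.
From mathcomp Require Import all_boot all_order all_algebra.
From mathcomp Require Import all_classical all_reals all_analysis.

Set Implicit Arguments.
Unset Strict Implicit.
Unset Printing Implicit Defensive.

Import Order.TTheory GRing.Theory Num.Theory.
Import numFieldNormedType.Exports.

Local Open Scope classical_set_scope.
Local Open Scope ring_scope.

Section RandomVariables.
Context d (T : measurableType d) (R : realType) (P : probability T R).

(* Y and Z are plain functions, so that expressions in random variables can be
   written directly; they are measurable wherever this is used. *)
Definition eq_law (Y Z : T -> R) : Prop :=
  forall U : set R, measurable U -> P (Y @^-1` U) = P (Z @^-1` U).

Definition indep (Y Z : T -> R) : Prop :=
  forall U V : set R, measurable U -> measurable V ->
    P ((Y @^-1` U) `&` (Z @^-1` V)) = (P (Y @^-1` U) * P (Z @^-1` V))%E.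

(* The law of Y is f(x) dx on D; in particular it does not charge ~` D. *)
Definition has_density (Y : T -> R) (D : set R) (f : R -> R) : Prop :=
  [/\ measurable_fun D f,
      forall x, D x -> 0 <= f x &
      forall U : set R, measurable U ->
        P (Y @^-1` U) =
        (\int[lebesgue_measure]_(x in D `&` U) (f x)%:E)%E].

End RandomVariables.

Section NamedLaws.
Context d (T : measurableType d) (R : realType) (P : probability T R).

Definition gamma_fun (a : R) : R :=
  \int[lebesgue_measure]_(x in `]0, +oo[) (x `^ (a - 1) * expR (- x)).

Definition Beta_fun (a b : R) : R :=
  \int[lebesgue_measure]_(x in `]0, 1[) (x `^ (a - 1) * (1 - x) `^ (b - 1)).

Definition is_gamma (a : R) (G : T -> R) : Prop :=
  has_density P G `]0, +oo[
    (fun x => x `^ (a - 1) * expR (- x) / gamma_fun a).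

(* Real parameters: the library's beta_prob only has natural-number ones. *)
Definition is_beta (a b : R) (B : T -> R) : Prop :=
  has_density P B `]0, 1[
    (fun x => x `^ (a - 1) * (1 - x) `^ (b - 1) / Beta_fun a b).

Definition is_pos_stable (alpha : R) (S : T -> R) : Prop :=
  P (S @^-1` `]0, +oo[) = 1%E /\
  forall lam : R, 0 < lam ->
    ('E_P[fun w => expR (- (lam * S w))%R] = (expR (- (lam `^ alpha)))%:E)%E.

(* M has the law M_tau(H) of the mean of a Dirichlet process with shape tau H,
   given by its generalized Cauchy-Stieltjes transform of order tau. Meant for
   0 < tau and H a probability on [0, +oo[ that integrates ln (1 + x). *)
Definition is_dirichlet_mean (tau : R) (H : set R -> \bar R) (M : T -> R)
    : Prop :=
  P (M @^-1` `[0, +oo[) = 1%E /\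
  forall lam : R, 0 < lam ->
    ('E_P[fun w => ((1 + lam * M w) `^ (- tau))%R] =
     expeR (- (tau%:E * \int[H]_(x in `[0%R, +oo[) (ln (1 + lam * x))%:E)))%E.

(* V has the law on [0, 1] of P_{alpha, alpha theta}(C), E[P(C)] = p, for a
   PD(alpha, alpha theta) random probability measure; it is also the law of the
   time spent positive up to time 1 by a p-skewed generalized Bessel bridge. *)
Definition is_PD_mass (alpha theta p : R) (V : T -> R) : Prop :=
  P (V @^-1` `[0, 1]) = 1%E /\
  forall lam : R, 0 < lam ->
    ('E_P[fun w => ((1 + lam * V w) `^ (- (alpha * theta)))%R] =
     ((1 - p + p * (1 + lam) `^ alpha) `^ (- theta))%:E)%E.

End NamedLaws.

Section Formulas.
Context (R : realType).

(* H^(r) = r H + (1 - r) delta_0 *)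
Definition mix0 (r : R) (H : set R -> \bar R) : set R -> \bar R :=
  fun U => (r%:E * H U + (1 - r)%:E * \d_(0%R : R) U)%E.

Definition varrho (alpha y : R) : R :=
  sin (pi * alpha) / pi *
  (y `^ (alpha - 1) /
   (y `^ (2 * alpha) + 2 * y `^ alpha * cos (pi * alpha) + 1)).

Definition varrho_law (alpha : R) : set R -> \bar R :=
  fun U => (\int[lebesgue_measure]_(y in `]0%R, +oo[ `&` U)
              (varrho alpha y)%:E)%E.

Definition cot (x : R) : R := cos x / sin x.

(* The inverse of cot with values in ]0, pi[, see acot_itv and acotK. *)
Definition acot (x : R) : R := pi / 2 - atan x.

Lemma acot_itv x : 0 < acot x < pi.
Proof.
rewrite /acot subr_gt0 atan_ltpi2 /=.
by rewrite {2}(splitr pi) ltrD2l ltrNl atan_gtNpi2.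
Qed.

Lemma acotK : cancel acot cot.
Proof.
move=> x; rewrite /cot /acot -opprB cosN sinN cosBpihalf sinBpihalf opprK.
exact: atanK.
Qed.

Definition Calpha (alpha x : R) : R :=
  acot (cot (pi * alpha) + x `^ alpha / sin (pi * alpha)).

(* q is written 1 - p from here on. *)
Definition sinC (alpha p theta y : R) : R :=
  sin (theta * Calpha alpha
    ((1 - p) `^ alpha^-1 * y / (p `^ alpha^-1 * (1 - y)))).

Definition denom (alpha p theta y : R) : R :=
  (y `^ (2 * alpha) * (1 - p) ^+ 2
   + 2 * (1 - p) * p * y `^ alpha * (1 - y) `^ alpha * cos (alpha * pi)
   + (1 - y) `^ (2 * alpha) * p ^+ 2) `^ (theta / 2).

Definition f_density (alpha p theta y : R) : R :=
  (1 - p) `^ theta / pi *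
  (y `^ (alpha * theta - 1) * (1 - y)^-1 * sinC alpha p theta y /
   denom alpha p theta y).

Definition g_density (alpha p theta y : R) : R :=
  (1 - y) / (1 - p) `^ theta * f_density alpha p theta y.

End Formulas.

(* Main.v *)
(* All laws in the statement are identified through the order-one transform
   s |-> E[(1 + s Y)^-1], which determines a law on [0, +oo[: its derivatives
   in s give the moments of (1 + s Y)^-1, and polynomials in it approximate
   indicators of intervals. Independence and beta integrals reduce every
   variable to one of two transforms: (1 + s^alpha)^-theta for M_1(varrho) and
   B^(1/alpha) X, and (q + p (1 + s)^alpha)^-theta for the variables that carry
   Lambda. The densities are recovered by exhibiting
   h with int_0^oo h(x) / (1 + s x) dx = (1 + s^alpha)^-theta. For this, take
   G(w) = w (1 + m w^(2 alpha))^-theta on the half-plane Re w > 0, with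
   m = s^alpha, pull it back to the disc by w = (1 + z) / (1 - z), and compare
   the value pi (1 + m)^-theta at z = 0 with the mean over circles |z| = r as
   r -> 1, where w = i cot(t / 2) and t = 2 atan sqrt(s x). *)
From HB Require Import structures.
Require Import Defs.
From mathcomp Require Import all_boot all_order all_algebra.
From mathcomp Require Import all_classical all_reals all_analysis.
From mathcomp Require Import measurable_realfun ring lra.

Set Implicit Arguments.
Unset Strict Implicit.
Unset Printing Implicit Defensive.

Import Order.TTheory GRing.Theory Num.Theory.
Import numFieldNormedType.Exports.

Local Open Scope classical_set_scope.
Local Open Scope ring_scope.

(** The inversion is carried out with real functions only. G is kept in polar form, as an
    exponential of [logmodG] times the cosine or sine of [argG], and holomorphy survives as one
    identity: the radial derivative of [reG] and the angular derivative of [imG] are the same [dG]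
    up to the factor r. G is real on the real axis, so [imG] vanishes at t = 0 and t = pi and the
    half-circle mean does not depend on r. A half-plane for w replaces the slit plane of w^2 because
    |arg w| < pi / 2 there, so that [atan] supplies every branch. On the boundary w^2 = - 1 / (s x),
    hence m w^(2 alpha) = x^(- alpha) e^(i pi alpha), and s survives only in the kernel. The factor
    w of G adds to the Jacobian the half power of s x that it lacks, and its quarter turn changes
    the cosine into a sine. The pole of w at z = 1 is the danger in the limit; there |G| is at most
    a constant times t^(- delta) for some delta < 1. No normalising constant is evaluated: those of
    beta and gamma are eliminated by comparing with total mass one, and the new densities have
    integral one by uniqueness of the transform. *)

(** * Substitution on the half-line and rules of differentiation *)

Lemma bigcup_itv_0y (R : realType) :
  \bigcup_n `[n.+1%:R^-1, n.+2%:R]%classic = `]0, +oo[%classic :> set R.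
Proof.
apply/seteqP; split => [x [n _]|x]; rewrite /= !in_itv/=.
  by move=> /andP[nx _]; rewrite andbT (lt_le_trans _ nx).
rewrite andbT => x0.
have [n nx] : exists n, n.+1%:R^-1 < x by have [n] := ltr_add_invr x0; rewrite add0r => ?; exists n.
exists (maxn n (Num.truncn x)) => //=; rewrite in_itv/=; apply/andP; split.
  rewrite (le_trans _ (ltW nx))// lef_pV2 ?posrE// ler_nat ltnS leq_maxl//.
rewrite (le_trans (ltW (truncnS_gt x)))// ler_nat.
by rewrite ltnS (leq_trans (leq_maxr n _)).
Qed.

(** Exhaustion by compact segments: the substitution holds on each of them, and both sides pass to
    the limit by monotone convergence. The image [J] is a parameter because ]0, pi[, ]0, pi /
    2[, ]0, 1[ and ]0, +oo[ all occur as targets. *)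
Lemma ge0_substitution_0y (R : realType) (F f G : R -> R) (J : set R) :
  (forall x : R, 0 < x -> is_derive x 1 F (f x)) ->
  (forall x : R, 0 < x -> 0 < f x) ->
  (forall x : R, 0 < x -> {for x, continuous f}) ->
  F @` `]0, +oo[ = J ->
  (forall y, J y -> {for y, continuous G}) -> (forall y, J y -> 0 <= G y) ->
  (\int[lebesgue_measure]_(y in J) (G y)%:E =
   \int[lebesgue_measure]_(x in `]0%R, +oo[) (G (F x) * f x)%:E)%E.
Proof.
move=> dF f0 cf FJ cG G0.
have JF (x : R) : 0 < x -> J (F x) by move=> x0; rewrite -FJ; exists x => //=; rewrite in_itv/= x0.
have cF (x : R) : 0 < x -> {for x, continuous F}.
  by move=> x0; apply: differentiable_continuous; apply/derivable1_diffP; have [] := dF x x0.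
have F'E (x : R) : 0 < x -> derive1 F x = f x by move=> x0; rewrite derive1E (@derive_val _ _ _ _ _ _ _ (dF x x0)).
have incF (x y : R) : 0 < x -> x < y -> F x < F y.
  move=> x0 xy; apply: (@gtr0_derive1_incr _ F x y) => //.
  - by move=> z; rewrite in_itv/= => /andP[xz _]; have [] := dF z (lt_trans x0 xz).
  - by move=> z; rewrite in_itv/= => /andP[xz _]; have z0 := lt_trans x0 xz; rewrite F'E// f0.
  - apply: continuous_in_subspaceT => z; rewrite inE/= in_itv/= => /andP[xz _].
    exact/cF/(lt_le_trans x0 xz).
have leF (x y : R) : 0 < x -> x <= y -> F x <= F y.
  by move=> x0; rewrite le_eqVlt => /predU1P[->//|/(incF _ _ x0)/ltW].
(* The shift by 2 gives u n <= 1 < v n for every n, so no segment is degenerate, not even for n =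
   0. *)
pose u n : R := n.+1%:R^-1; pose v n : R := n.+2%:R.
have u0 n : 0 < u n by rewrite /u.
have u1 n : u n <= 1 by rewrite /u invf_le1// ler1n.
have v1 n : 1 < v n by rewrite /v ltr1n.
have uv n : u n < v n by exact: le_lt_trans (u1 n) (v1 n).
(* By the intermediate value theorem segments have segments as images, so [J] is an increasing union
   of compact intervals as well. *)
have Jcup : J = \bigcup_n `[F (u n), F (v n)]%classic.
  apply/seteqP; split => y.
    rewrite -FJ => -[x]; rewrite -bigcup_itv_0y => -[n _ /=].
    rewrite in_itv/= => /andP[ux xv] <-; exists n => //=.
    by rewrite in_itv/= !leF// (lt_le_trans _ ux).
  move=> [n _ /=]; rewrite in_itv/= => /andP[uy yv].
  have cFn : {within `[u n, v n], continuous F}.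
    apply: continuous_in_subspaceT => z; rewrite inE/= in_itv/= => /andP[xz _].
    exact/cF/(lt_le_trans (u0 n) xz).
  have [|x xuv <-] := IVT (ltW (uv n)) cFn (v := y).
    by rewrite min_l ?max_r ?uy// leF ?u0 ?ltW.
  by apply: JF; move: xuv; rewrite in_itv/= => /andP[ux _]; exact: lt_le_trans ux.
have sub1 n x : `[F (u n), F (v n)]%classic x -> J x by rewrite Jcup; exists n.
have pos n x : `[u n, v n]%classic x -> 0 < x.
  by rewrite /= in_itv/= => /andP[+ _]; exact: lt_le_trans.
have ndu n m : (n <= m)%N -> u m <= u n by move=> nm; rewrite /u lef_pV2 ?posrE// ler_nat ltnS.
have ndv n m : (n <= m)%N -> v n <= v m by move=> nm; rewrite /v ler_nat !ltnS.
have cGn n : {within `[F (u n), F (v n)], continuous G}.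
  by apply: continuous_in_subspaceT => z; rewrite inE => /sub1/cG.
have cHn n : {within `[u n, v n], continuous (fun x => G (F x) * f x)}.
  apply: continuous_in_subspaceT => z; rewrite inE => /pos z0.
  apply: cvgM; last exact: cf.
  apply: (@continuous_comp _ _ _ F G); first exact: cF.
  exact/cG/JF.
rewrite Jcup -bigcup_itv_0y.
have H1 : (\int[lebesgue_measure]_(x in `[F (u n), F (v n)]) (G x)%:E)%E @[n --> \oo] -->
   (\int[lebesgue_measure]_(x in \bigcup_n `[F (u n), F (v n)]%classic) (G x)%:E)%E.
  apply: ge0_nondecreasing_set_cvg_integral => //.
  - move=> n m nm; apply/subsetPset => x /=; rewrite !in_itv/= => /andP[ux xv].
    by rewrite (le_trans _ ux) ?leF ?ndu//= (le_trans xv)// leF ?ndv// (lt_trans _ (v1 n)).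
  - by move=> n; apply/measurable_EFinP; exact: subspace_continuous_measurable_fun.
  - by move=> n x /sub1 ?; rewrite lee_fin G0.
have H2 : (\int[lebesgue_measure]_(x in `[u n, v n]) (G (F x) * f x)%:E)%E @[n --> \oo] -->
   (\int[lebesgue_measure]_(x in \bigcup_n `[u n, v n]%classic) (G (F x) * f x)%:E)%E.
  apply: ge0_nondecreasing_set_cvg_integral => //.
  - move=> n m nm; apply/subsetPset => x /=; rewrite !in_itv/= => /andP[ux xv].
    by rewrite (le_trans _ ux) ?ndu//= (le_trans xv)// ndv.
  - by move=> n; apply/measurable_EFinP; exact: subspace_continuous_measurable_fun.
  - by move=> n x /pos x0; rewrite lee_fin mulr_ge0 ?G0 ?ltW ?f0//; exact: JF.
rewrite -(cvg_lim (@ereal_hausdorff R) H1).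
apply: etrans (cvg_lim (@ereal_hausdorff R) H2).
congr (lim (_ @ \oo)).
apply/funext => n; rewrite integration_by_substitution_increasing ?ltW//.
- by apply: eq_integral => x; rewrite inE => /pos x0; congr EFin; rewrite -[LHS]/(G (F x) * derive1 F x) F'E.
- by move=> x y; rewrite !in_itv/= => /andP[ux _] _; apply: incF; exact: lt_le_trans ux.
(* [derive1 F] is known to be [f] at positive points only, so continuity and the endpoint limits are
   transferred from [f] along neighbourhoods that stay positive. *)
- move=> x; rewrite in_itv/= => /andP[ux _]; have x0 := lt_trans (u0 n) ux.
  rewrite /continuous_at F'E//.
  apply: (@cvg_trans _ (f z @[z --> x])); last exact: cf.
  apply: near_eq_cvg; near=> z; rewrite F'E//.
  by near: z; apply: (@cvgr_gt _ _ _ _ id x cvg_id).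
- apply/cvg_ex; exists (f (u n)).
  apply: (@cvg_trans _ (f z @[z --> (u n)^'+])).
    apply: near_eq_cvg; near=> z; rewrite F'E//.
    by rewrite (lt_trans (u0 n))//; near: z; exact: nbhs_right_gt.
  exact/cvg_at_right_filter/cf.
- apply/cvg_ex; exists (f (v n)).
  have v0 : 0 < v n by exact: lt_trans (v1 n).
  apply: (@cvg_trans _ (f z @[z --> (v n)^'-])).
    apply: near_eq_cvg; near=> z; rewrite F'E//.
  exact/cvg_at_left_filter/cf.
- split.
  + by move=> x; rewrite in_itv/= => /andP[ux _]; have [] := dF x (lt_trans (u0 n) ux).
  + exact/cvg_at_right_filter/cF.
  + by apply/cvg_at_left_filter/cF; exact: lt_trans (v1 n).
Unshelve. all: by end_near. Qed.

Section is_derive_rules.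
Context (R : realType).
Implicit Types (f g : R -> R) (x a b c : R).

Lemma is_derive1_id x : is_derive x 1 (fun y : R => y) 1.
Proof. exact: is_derive_id. Qed.

Lemma is_derive1_cst c x : is_derive x 1 (fun _ : R => c) 0.
Proof. exact: is_derive_cst. Qed.

Lemma is_derive1_add f g x a b : is_derive x 1 f a -> is_derive x 1 g b ->
  is_derive x 1 (fun y => f y + g y) (a + b).
Proof. by move=> df dg; exact: is_deriveD. Qed.

Lemma is_derive1_sub f g x a b : is_derive x 1 f a -> is_derive x 1 g b ->
  is_derive x 1 (fun y => f y - g y) (a - b).
Proof. by move=> df dg; exact: is_deriveB. Qed.

Lemma is_derive1_opp f x a : is_derive x 1 f a ->
  is_derive x 1 (fun y => - f y) (- a).
Proof. by move=> df; exact: is_deriveN. Qed.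

Lemma is_derive1_mul f g x a b : is_derive x 1 f a -> is_derive x 1 g b ->
  is_derive x 1 (fun y => f y * g y) (a * g x + f x * b).
Proof.
move=> df dg; apply: (is_derive_eq (is_deriveM df dg)).
by rewrite /GRing.scale/= addrC mulrC; congr (_ + _); rewrite mulrC.
Qed.

Lemma is_derive1_inv f x a : f x != 0 -> is_derive x 1 f a ->
  is_derive x 1 (fun y => (f y)^-1) (- a / f x ^+ 2).
Proof.
move=> f0 df; apply: (is_derive_eq (is_deriveV f0 df)).
by rewrite /GRing.scale/= mulNr mulrC mulNr.
Qed.

Lemma is_derive1_exp f x a : is_derive x 1 f a ->
  is_derive x 1 (fun y => expR (f y)) (expR (f x) * a).
Proof. by move=> df; exact: is_derive1_comp. Qed.

Lemma is_derive1_lnf f x a : 0 < f x -> is_derive x 1 f a ->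
  is_derive x 1 (fun y => ln (f y)) (a / f x).
Proof.
move=> f0 df; rewrite mulrC; apply: (@is_derive1_comp _ (@ln R) f) => //.
exact: is_derive1_ln.
Qed.

Lemma is_derive1_cos f x a : is_derive x 1 f a ->
  is_derive x 1 (fun y => cos (f y)) (- sin (f x) * a).
Proof. by move=> df; exact: is_derive1_comp. Qed.

Lemma is_derive1_sin f x a : is_derive x 1 f a ->
  is_derive x 1 (fun y => sin (f y)) (cos (f x) * a).
Proof. by move=> df; exact: is_derive1_comp. Qed.

Lemma is_derive1_atanf f x a : is_derive x 1 f a ->
  is_derive x 1 (fun y => atan (f y)) (a / (1 + f x ^+ 2)).
Proof. by move=> df; rewrite mulrC; exact: (@is_derive1_comp _ atan f). Qed.

Lemma is_derive1_tanf f x a : cos (f x) != 0 -> is_derive x 1 f a ->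
  is_derive x 1 (fun y => tan (f y)) (a / cos (f x) ^+ 2).
Proof.
move=> c0 df; rewrite mulrC; exact: (@is_derive1_comp _ tan f).
Qed.

Lemma is_derive1_natX f x a n : is_derive x 1 f a ->
  is_derive x 1 (fun y => f y ^+ n) (n%:R * f x ^+ n.-1 * a).
Proof.
move=> df; elim: n => [|n ih].
  by apply: (is_derive_eq (is_derive1_cst 1 x)); rewrite !mul0r.
rewrite (_ : (fun y => f y ^+ n.+1) = fun y => f y * f y ^+ n); last first.
  by apply/funext => y; rewrite exprS.
apply: (is_derive_eq (is_derive1_mul df ih)).
by case: n {ih} => [|n] /=; rewrite ?expr0 ?exprS -?natr1; ring.
Qed.

Lemma is_derive1_powRf f x a r : 0 < f x -> is_derive x 1 f a ->
  is_derive x 1 (fun y => f y `^ r) (r * f x `^ (r - 1) * a).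
Proof.
move=> f0 df; apply: (@is_derive1_comp _ (fun z => z `^ r) f) => //.
exact: is_derive1_powR.
Qed.

Lemma is_derive1_continuous f x a : is_derive x 1 f a -> {for x, continuous f}.
Proof. by case=> df _; apply/differentiable_continuous/derivable1_diffP. Qed.

Lemma is_derive1E f x a : is_derive x 1 f a -> derive1 f x = a.
Proof. by move=> df; rewrite derive1E (@derive_val _ _ _ _ _ _ _ df). Qed.
End is_derive_rules.

(** A difference is a sum with an opposite, hence [is_derive1_sub] comes before [is_derive1_add].
    The derivative remains an existential variable, so the loop has two uses: with [is_derive_eq] it
    leaves an algebraic identity, and under [eexists] it proves mere differentiability, from which
    continuity and then measurability are drawn below. *)
Ltac is_derive_step := first
  [ eassumption | apply is_derive1_id | apply is_derive1_cst
  | eapply is_derive1_sub | eapply is_derive1_add | eapply is_derive1_opp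
  | eapply is_derive1_atanf | eapply is_derive1_tanf | eapply is_derive1_powRf
  | eapply is_derive1_natX | eapply is_derive1_inv
  | eapply is_derive1_mul | eapply is_derive1_exp
  | eapply is_derive1_lnf | eapply is_derive1_cos | eapply is_derive1_sin].
Ltac is_derive_auto := eapply is_derive_eq; [repeat is_derive_step|].

Lemma measurable_invr (R : realType) : measurable_fun [set: R] (@GRing.inv R).
Proof.
have -> : [set: R] = ~` [set 0] `|` [set 0] by rewrite setUC setUv.
apply/measurable_funU => //; first exact: measurableC.
split; last exact: measurable_fun_set1.
apply: open_continuous_measurable_fun; first by apply: closed_openC; exact: accessible_closed_set1 (hausdorff_accessible (@Rhausdorff R)) _.
by move=> x; rewrite inE/= => /eqP x0; exact: inv_continuous.
Qed.

Lemma measurable_fun_invr d (T : measurableType d) (R : realType) (D : set T) (f : T -> R) :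
  measurable_fun D f -> measurable_fun D (fun x => (f x)^-1).
Proof. by move=> mf; apply: measurableT_comp => //; exact: measurable_invr. Qed.

(** * Uniqueness for the order-one Stieltjes transform *)

Section stieltjes_uniqueness.
Context (R : realType).
Implicit Types m : {measure set (measurableTypeR R) -> \bar R}.

Definition stieltjes m (s : R) : \bar R :=
  (\int[m]_(x in `[0%R, +oo[) ((1 + s * x)^-1)%:E)%E.

Let mI : measurable (`[0, +oo[%classic : set (measurableTypeR R)).
Proof. exact: measurable_itv. Qed.

Lemma itv0y_ge0 (x : R) : `[0, +oo[%classic x -> 0 <= x.
Proof. by rewrite /= in_itv/= andbT. Qed.

Lemma measurable_stieltjes (D : set R) (s : R) :
  measurable_fun D (fun x : R => (1 + s * x)^-1).
Proof.
apply: measurable_fun_invr; exact: measurable_funD.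
Qed.

Lemma stieltjes_kernel01 (s x : R) : 0 <= s -> 0 <= x -> 0 <= (1 + s * x)^-1 <= 1.
Proof.
move=> s0 x0; have sx0 : 0 <= s * x by rewrite mulr_ge0.
by rewrite invr_ge0 addr_ge0//= invf_le1 ?lerDl// ltr_wpDr.
Qed.

Lemma integrable_stieltjesX m (s : R) k : (m setT < +oo)%E -> 0 < s ->
  m.-integrable `[0, +oo[ (EFin \o (fun x : R => (1 + s * x)^-1 ^+ k)).
Proof.
move=> moo s0; apply: measurable_bounded_integrable => //.
- by rewrite (le_lt_trans _ moo)// le_measure ?inE.
- by apply: measurable_funX; exact: measurable_stieltjes.
- exists 1; split => // M M1 x /itv0y_ge0 x0.
  have /andP[v0 v1] := stieltjes_kernel01 (ltW s0) x0.
  by rewrite /= ger0_norm ?exprn_ge0// (le_trans (exprn_ile1 k v0 v1))// ltW.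
Qed.

(** With v = (1 + s x)^-1 one has x v = (1 - v) / s, so differentiating v^(k+1) in s gives a
    combination of v^(k+1) and v^(k+2) again. Moments of v of every order are thus reachable from
    order one. *)
Lemma stieltjesX_derive m (s : R) k : (m setT < +oo)%E -> 0 < s ->
  derive1 (fun s => \int[m]_(x in `[0, +oo[) ((1 + s * x)^-1 ^+ k.+1)) s =
  - k.+1%:R / s * (\int[m]_(x in `[0, +oo[) ((1 + s * x)^-1 ^+ k.+1)
            - \int[m]_(x in `[0, +oo[) ((1 + s * x)^-1 ^+ k.+2)).
Proof.
move=> moo s0.
have dE (t x : R) : 0 < t -> 0 <= x ->
    is_derive t 1 (fun t : R => (1 + t * x)^-1 ^+ k.+1)
      (- k.+1%:R / t * ((1 + t * x)^-1 ^+ k.+1 - (1 + t * x)^-1 ^+ k.+2)).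
  move=> t0 x0.
  have n0 : 1 + t * x != 0 by rewrite gt_eqF// ltr_wpDr// mulr_ge0// ltW.
  is_derive_auto => //; rewrite /= !exprS; field.
  by rewrite n0 gt_eqF.
(* On ]s / 2, 2 s[ the powers of v lie in [0, 1], so the derivative is dominated by the constant
   (k+1) / (s / 2). *)
have Ia : `]s / 2, s * 2[%classic s by rewrite /= in_itv/=; apply/andP; split; lra.
have Ip t : `]s / 2, s * 2[%classic t -> 0 < t by rewrite /= in_itv/= => /andP[+ _]; lra.
rewrite (@differentiation_under_integral _ _ _ m
  (fun (t x : R) => (1 + t * x)^-1 ^+ k.+1) _ _ s (s / 2) (s * 2) _ _ _ (cst (k.+1%:R / (s / 2))))//.
- rewrite -RintegralB//; [|exact: integrable_stieltjesX..].
  rewrite -RintegralZl//.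
    apply: eq_Rintegral => x; rewrite inE => /itv0y_ge0 x0.
    by rewrite partial1of2E (@derive_val _ _ _ _ _ _ _ (dE s x s0 x0)).
  exact: (integrableB mI (integrable_stieltjesX k.+1 moo s0) (integrable_stieltjesX k.+2 moo s0)).
- by move=> t /Ip t0; exact: integrable_stieltjesX.
- by move=> t x /Ip t0 /itv0y_ge0 x0; have [] := dE t x t0 x0.
- by move=> x /=; rewrite divr_ge0//; lra.
- apply: measurable_bounded_integrable => //.
  + by rewrite (le_lt_trans _ moo)// le_measure ?inE.
  + exists (k.+1%:R / (s / 2)); split; first exact: num_real.
    move=> M M1 x _ /=.
    by rewrite ger0_norm ?divr_ge0 ?ler0n ?(ltW M1)//; lra.
- move=> t x It /itv0y_ge0 x0; have t0 := Ip _ It.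
  rewrite partial1of2E (@derive_val _ _ _ _ _ _ _ (dE t x t0 x0)).
  have /andP[v0 v1] := stieltjes_kernel01 (ltW t0) x0.
  rewrite normrM normf_div normrN normr_nat (gtr0_norm t0) /=.
  rewrite -[leRHS]mulr1 ler_pM//.
  + by rewrite divr_ge0// ltW.
  + rewrite ler_pM2l// lef_pV2 ?posrE//; last lra.
    by move: It; rewrite /= in_itv/= => /andP[/ltW].
  + rewrite [X in _ - X]exprSr -[X in X - _]mulr1 -mulrBr normrM ger0_norm ?exprn_ge0//.
    rewrite ger0_norm ?subr_ge0// mulr_ile1 ?exprn_ge0 ?subr_ge0 ?exprn_ile1//.
    by rewrite gerBl.
Qed.
End stieltjes_uniqueness.

Section stieltjes_uniqueness2.
Context (R : realType).
Implicit Types m : {measure set (measurableTypeR R) -> \bar R}.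

Let mI : measurable (`[0, +oo[%classic : set (measurableTypeR R)).
Proof. exact: measurable_itv. Qed.

Lemma stieltjes_fineE m s : (m setT < +oo)%E -> 0 < s ->
  stieltjes m s = (\int[m]_(x in `[0, +oo[) ((1 + s * x)^-1 ^+ 1))%:E.
Proof.
move=> moo s0; rewrite /stieltjes /Rintegral fineK; last first.
  by apply: integrable_fin_num => //; exact: integrable_stieltjesX.
by apply: eq_integral => x _; rewrite expr1.
Qed.

Section two_measures.
Variables m1 m2 : {measure set (measurableTypeR R) -> \bar R}.
Hypotheses (m1oo : (m1 setT < +oo)%E) (m2oo : (m2 setT < +oo)%E).
Hypothesis m10 : m1 `]-oo, 0[%classic = 0%E.
Hypothesis m20 : m2 `]-oo, 0[%classic = 0%E.
Hypothesis m12 : forall s : R, 0 < s -> stieltjes m1 s = stieltjes m2 s.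

(** Equality at order k+1 for all parameters near s gives equal derivatives at s;
    [stieltjesX_derive] then isolates the term of order k+2, whose coefficient (k+1) / s is
    nonzero. *)
Let eq_stieltjesX k (s : R) : 0 < s ->
  \int[m1]_(x in `[0, +oo[) ((1 + s * x)^-1 ^+ k.+1) =
  \int[m2]_(x in `[0, +oo[) ((1 + s * x)^-1 ^+ k.+1).
Proof.
elim: k s => [|k ih] s s0.
  by have := m12 s0; rewrite !stieltjes_fineE// => -[].
have H : derive1 (fun s => \int[m1]_(x in `[0, +oo[) ((1 + s * x)^-1 ^+ k.+1)) s =
         derive1 (fun s => \int[m2]_(x in `[0, +oo[) ((1 + s * x)^-1 ^+ k.+1)) s.
  rewrite !derive1E; apply: near_eq_derive.
  near=> t; apply: ih; near: t; exact: (@cvgr_gt _ _ _ _ id s cvg_id).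
move: H; rewrite !stieltjesX_derive// ih//.
move=> /mulfI H; apply: oppr_inj; apply: addrI; apply: H.
by rewrite mulf_neq0// ?oppr_eq0 ?pnatr_eq0// invr_neq0// gt_eqF.
Unshelve. all: by end_near. Qed.

(** One factor v is always kept: only polynomials without constant term are reached, since integrals
    of constants are not among the moments obtained so far. *)
Let eq_stieltjes_poly (p : {poly R}) k (s : R) : 0 < s ->
  [/\ m1.-integrable `[0, +oo[ (EFin \o (fun x => p.[(1 + s * x)^-1] * (1 + s * x)^-1 ^+ k.+1)),
      m2.-integrable `[0, +oo[ (EFin \o (fun x => p.[(1 + s * x)^-1] * (1 + s * x)^-1 ^+ k.+1)) &
  \int[m1]_(x in `[0, +oo[) (p.[(1 + s * x)^-1] * (1 + s * x)^-1 ^+ k.+1) =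
  \int[m2]_(x in `[0, +oo[) (p.[(1 + s * x)^-1] * (1 + s * x)^-1 ^+ k.+1)].
Proof.
move=> s0; elim/poly_ind: p k => [|p c ih] k.
  have E : (fun x : R => (0 : {poly R}).[(1 + s * x)^-1] * (1 + s * x)^-1 ^+ k.+1) = cst 0.
    by apply/funext => x; rewrite horner0 mul0r.
  rewrite E; split; [exact: integrable0|exact: integrable0|].
  by rewrite /Rintegral !integral0.
have E : (fun x : R => (p * 'X + c%:P).[(1 + s * x)^-1] * (1 + s * x)^-1 ^+ k.+1) =
    (fun x : R => p.[(1 + s * x)^-1] * (1 + s * x)^-1 ^+ k.+2 + c * (1 + s * x)^-1 ^+ k.+1).
  by apply/funext => x; rewrite hornerMXaddC mulrDl -mulrA -exprS.
have [i1 i2 i12] := ih k.+1.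
have j1 := integrableZl mI c (integrable_stieltjesX k.+1 m1oo s0).
have j2 := integrableZl mI c (integrable_stieltjesX k.+1 m2oo s0).
rewrite E; split.
- exact: (integrableD mI i1 j1).
- exact: (integrableD mI i2 j2).
- rewrite !RintegralD// i12; congr (_ + _).
  by rewrite !RintegralZl// ?eq_stieltjesX//; exact: integrable_stieltjesX.
Qed.

(* The polynomial [1 - (1 - (1 - v)^n)^(n 2^n)] in v = 1 / (1 + s x) vanishes at
   v = 0 and tends to the indicator function of 1 - v < 1/2, that is s x < 1. *)
Let cutoff (s : R) n (x : R) : R :=
  (1 - (1 - (1 + s * x)^-1) ^+ n.+1) ^+ (n.+1 * 2 ^ n.+1).

(** At v = 0 the base of the outer power is 1 - 1 and its exponent is positive, so 0 is a root and
    one factor v splits off, as [eq_stieltjes_poly] requires. *)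
Let cutoffE (s : R) n : exists p : {poly R}, forall x : R, 0 <= x -> cutoff s n x =
  p.[(1 + s * x)^-1] * (1 + s * x)^-1 ^+ 1.
Proof.
pose q : {poly R} := (1 - (1 - 'X) ^+ n.+1) ^+ (n.+1 * 2 ^ n.+1).
have q0 : root q 0.
  rewrite /root /q !hornerE /= subr0 expr1n subrr.
  by rewrite expr0n muln_eq0 expn_eq0.
have /factor_theorem[p pq] := q0; exists p => y y0.
rewrite expr1 /cutoff; transitivity q.[(1 + s * y)^-1].
  by rewrite /q !hornerE.
by rewrite pq hornerM hornerXsubC subr0.
Qed.

Let bernoulli (y : R) n : - 1 <= y -> 1 + n%:R * y <= (1 + y) ^+ n.
Proof.
move=> y1; elim: n => [|n ih]; first by rewrite mul0r addr0 expr0.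
rewrite exprS -natr1; apply: (@le_trans _ _ ((1 + y) * (1 + n%:R * y))).
  rewrite (_ : (1 + y) * _ = 1 + (n%:R + 1) * y + n%:R * y ^+ 2); last by ring.
  by rewrite lerDl mulr_ge0// sqr_ge0.
by rewrite ler_wpM2l//; lra.
Qed.

(** Take r < 1 with q <= r^2. Then n q^n <= (n r^n) r^n, and Bernoulli's inequality for 1 / r = 1 +
    h bounds n r^n by 1 / h. *)
Let natr_geometric_cvg0 (q : R) : 0 <= q < 1 -> (n.+1%:R * q ^+ n.+1 : R) @[n --> \oo] --> 0.
Proof.
move=> /andP[q0 q1]; have [r [r0 r1 qr]] : exists r : R, [/\ 0 < r, r < 1 & q <= r * r].
  exists ((1 + q) / 2); split; [lra|lra|].
  have : 0 <= (1 - q) ^+ 2 by exact: sqr_ge0.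
  by rewrite expr2; nra.
have h0 : 0 < r^-1 - 1 by rewrite subr_gt0 invf_gt1.
have hE : r^-1 = 1 + (r^-1 - 1) by ring.
move: (r^-1 - 1) h0 hE => h h0 hE.
apply: (@squeeze_cvgr _ _ _ _ (cst 0) (fun n => r ^+ n.+1 / h)).
- apply: nearW => n /=; rewrite mulr_ge0 ?exprn_ge0//=.
  apply: (@le_trans _ _ (n.+1%:R * r ^+ n.+1 * r ^+ n.+1)).
    by rewrite -mulrA -exprMn ler_wpM2l// lerXn2r ?nnegrE ?mulr_ge0 ?(ltW r0).
  have rn : 0 < r ^+ n.+1 by rewrite exprn_gt0.
  rewrite mulrC ler_wpM2l ?(ltW rn)// -[leRHS]mul1r ler_pdivlMr//.
  rewrite mulrAC -ler_pdivlMr// mul1r -exprVn hE.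
  by apply: le_trans (bernoulli n.+1 _); [rewrite lerDr|lra].
- exact: cvg_cst.
- rewrite -[X in _ --> X](mul0r h^-1); apply: cvgM; last exact: cvg_cst.
  rewrite (cvg_shiftS (fun n => r ^+ n)); apply: cvg_expr.
  by rewrite gtr0_norm.
Qed.

(** Put w = 1 - v = s x / (1 + s x) and N = n.+1. The cutoff is (1 - w^N)^(N 2^N), close to exp(- N
    (2 w)^N). For 2 w < 1 Bernoulli bounds it below by 1 - N (2 w)^N; for 2 w >= 1 the inequality 1
    - u <= exp(- u) bounds it by exp(- N). The factor N in the exponent forces the limit 0 also at 2
    w = 1, whence the half-open interval. *)
Let cutoff_cvg (s x : R) : 0 < s -> 0 <= x ->
  cutoff s n x @[n --> \oo] --> (\1_(`[0, s^-1[) x : R).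
Proof.
move=> s0 x0; have sx0 : 0 <= s * x by rewrite mulr_ge0// ltW.
have d0 : 0 < 1 + s * x by lra.
pose w : R := 1 - (1 + s * x)^-1.
have wE : w = s * x / (1 + s * x) by rewrite /w; field; rewrite gt_eqF.
have w0 : 0 <= w by rewrite wE divr_ge0// ltW.
have w1 : w <= 1 by rewrite /w gerBl invr_ge0 ltW.
have cE n : cutoff s n x = (1 - w ^+ n.+1) ^+ (n.+1 * 2 ^ n.+1) by [].
have wn n : 0 <= w ^+ n.+1 <= 1 by rewrite exprn_ge0//= exprn_ile1.
have NE n : (n.+1 * 2 ^ n.+1)%:R * w ^+ n.+1 = n.+1%:R * (2 * w) ^+ n.+1.
  by rewrite natrM natrX exprMn mulrA.
have [xs|xs] := ltP x s^-1.
  have -> : \1_(`[0, s^-1[) x = 1 :> R by rewrite indicE mem_set//= in_itv/= x0.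
  have w2 : 2 * w < 1.
    have : s * x < 1 by rewrite -ltr_pdivlMl// mulr1.
    by rewrite wE mulrA ltr_pdivrMr//; lra.
  apply: (@squeeze_cvgr _ _ _ _ (fun n => 1 - n.+1%:R * (2 * w) ^+ n.+1) (cst 1)).
  - apply: nearW => n; have /andP[wn0 wn1] := wn n; rewrite cE -NE; apply/andP; split.
      by rewrite -mulrN; apply: bernoulli; lra.
    by rewrite exprn_ile1//; lra.
  - rewrite -[X in _ --> X]subr0; apply: cvgB; first exact: cvg_cst.
    by apply: natr_geometric_cvg0; rewrite mulr_ge0//=.
  - exact: cvg_cst.
have -> : \1_(`[0, s^-1[) x = 0 :> R.
  by rewrite indicE memNset//= in_itv/= => /andP[_]; rewrite ltNge xs.
have w2 : 1 <= 2 * w.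
  have : 1 <= s * x by rewrite -ler_pdivrMl// mulr1.
  by rewrite wE mulrA ler_pdivlMr//; lra.
apply: (@squeeze_cvgr _ _ _ _ (cst 0) (fun n => expR (- n%:R))).
- apply: nearW => n; rewrite cE /= exprn_ge0 ?subr_ge0 ?(andP (wn n)).2//=.
  apply: (@le_trans _ _ (expR (- w ^+ n.+1) ^+ (n.+1 * 2 ^ n.+1))).
    rewrite lerXn2r ?nnegrE ?expR_ge0 ?subr_ge0 ?(andP (wn n)).2//.
    by rewrite (le_trans _ (expR_ge1Dx _)).
  rewrite -expRM_natl ler_expR mulrN NE lerN2.
  rewrite (@le_trans _ _ n.+1%:R) ?ler_nat// ler_peMr// exprn_ege1//.
- exact: cvg_cst.
- exact: cvgn_expR.
Qed.

(** The cutoffs have equal integrals for both measures, and by dominated convergence with the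
    constant 1 these integrals tend to the two sides. *)
Let measure_co (s : R) : 0 < s -> m1 `[0, s^-1[%classic = m2 `[0, s^-1[%classic.
Proof.
move=> s0.
have bound n x : 0 <= x -> 0 <= cutoff s n x <= 1.
  move=> x0; have /andP[v0 v1] := stieltjes_kernel01 (ltW s0) x0.
  have w0 : 0 <= 1 - (1 + s * x)^-1 <= 1 by lra.
  have /andP[u0 u1] : 0 <= (1 - (1 + s * x)^-1) ^+ n.+1 <= 1.
    by rewrite exprn_ge0 ?exprn_ile1//; case/andP: w0.
  by rewrite exprn_ge0 ?exprn_ile1// ?subr_ge0// gerBl.
have lim (m : {measure set (measurableTypeR R) -> \bar R}) : (m setT < +oo)%E ->
    (\int[m]_(x in `[0%R, +oo[) (cutoff s n x)%:E)%E @[n --> \oo] --> m `[0, s^-1[%classic.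
  move=> moo.
  have -> : m `[0, s^-1[%classic = (\int[m]_(x in `[0%R, +oo[) (\1_(`[0, s^-1[) x)%:E)%E.
    rewrite integral_indic//; congr (m _); rewrite setIidl// => x /=.
    by rewrite !in_itv/= => /andP[->].
  have [] := @dominated_convergence _ _ _ m `[0, +oo[%classic mI
    (fun n x => (cutoff s n x)%:E) (fun x => (\1_(`[0, s^-1[) x)%:E) (cst 1%E) => //.
  - move=> n; apply/measurable_EFinP; apply: measurable_funX; apply: measurable_funB => //.
    by apply: measurable_funX; apply: measurable_funB => //; exact: measurable_stieltjes.
  - by apply/measurable_EFinP; exact: measurable_indic.
  - by apply: aeW => x /itv0y_ge0 x0; apply/fine_cvgP; split; [exact: nearW|exact: cutoff_cvg].
  - apply: measurable_bounded_integrable => //.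
      by rewrite (le_lt_trans _ moo)// le_measure ?inE.
    by exists 1; split => // M M1 x _ /=; rewrite normr1 ltW.
  - apply: aeW => x n /itv0y_ge0 x0; rewrite abse_EFin lee_fin.
    by have /andP[c0 c1] := bound n x x0; rewrite ger0_norm.
have E n : (\int[m1]_(x in `[0%R, +oo[) (cutoff s n x)%:E)%E = (\int[m2]_(x in `[0%R, +oo[) (cutoff s n x)%:E)%E.
  have [p pE] := cutoffE s n.
  have [i1 i2 i12] := eq_stieltjes_poly p 0 s0.
  have F (m : {measure set (measurableTypeR R) -> \bar R}) :
    m.-integrable `[0, +oo[ (EFin \o (fun x => p.[(1 + s * x)^-1] * (1 + s * x)^-1 ^+ 1)) ->
    (\int[m]_(x in `[0%R, +oo[) (cutoff s n x)%:E)%E =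
    (\int[m]_(x in `[0, +oo[) (p.[(1 + s * x)^-1] * (1 + s * x)^-1 ^+ 1))%:E.
    move=> im; rewrite /Rintegral fineK ?integrable_fin_num//.
    by apply: eq_integral => x; rewrite inE => /itv0y_ge0 x0; rewrite pE.
  by rewrite !F// i12.
have L1 := lim _ m1oo; have L2 := lim _ m2oo.
have {}L1 : (\int[m2]_(x in `[0%R, +oo[) (cutoff s n x)%:E)%E @[n --> \oo] --> m1 `[0, s^-1[%classic.
  by move: L1; under eq_fun do rewrite E.
by rewrite -(cvg_lim (@ereal_hausdorff R) L1) -(cvg_lim (@ereal_hausdorff R) L2).
Qed.

(** Left rays generate the Borel sets and are stable under intersection; as the negatives carry no
    mass, a ray reduces to an interval of [measure_co] or to a null set. *)
Lemma stieltjes_unique_finite U : measurable U -> m1 U = m2 U.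
Proof.
move=> mU.
have H (m : {measure set (measurableTypeR R) -> \bar R}) (y : R) : m `]-oo, 0[%classic = 0%E ->
    m `]-oo, y[%classic = if 0 < y then m `[0, y[%classic else 0%E.
  move=> m0; case: ltP => y0.
    have -> : `]-oo, y[%classic = `]-oo, 0[%classic `|` `[0, y[%classic :> set R.
      apply/seteqP; split => x /=; rewrite !in_itv/=.
        by move=> xy; case: (ltP x 0) => x0; [left|right].
      by case=> [x0|/andP[]//]; exact: lt_trans y0.
    have dis : `]-oo, 0[%classic `&` `[0, y[%classic = set0 :> set R.
      by apply/seteqP; split => x //=; rewrite !in_itv/= => -[x0 /andP[]]; rewrite leNgt x0.
    apply: (etrans (measureU m _ _ dis)) => //.
    by rewrite -[RHS]add0e; congr (_ + _)%E.
  apply/eqP; rewrite eq_le measure_ge0 andbT -m0 le_measure ?inE//.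
  by move=> x /=; rewrite !in_itv/= => /lt_le_trans; exact.
apply: (@measure_unique _ R (measurableTypeR R) [set A | exists x : R, A = `]-oo, x[%classic] (fun n => `]-oo, n%:R[%classic)) => //.
- exact: RGenInftyO.measurableE.
- move=> _ _ [x ->] [y ->]; exists (Num.min x y); apply/seteqP; split => z /=;
    rewrite !in_itv/= lt_min; first by move=> [-> ->].
  by move=> /andP[-> ->].
- by move=> n; exists n%:R.
- apply/seteqP; split => // x _; exists (Num.truncn x).+1 => //=.
  by rewrite in_itv/= truncnS_gt.
- move=> _ [x ->]; rewrite (H m1 x m10) (H m2 x m20); case: ltP => [x0|_]; last exact: erefl.
  by rewrite -[x]invrK; apply: measure_co; rewrite invr_gt0.
- by move=> n; rewrite (le_lt_trans _ m1oo)// le_measure ?inE.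
Qed.
End two_measures.

(* Letting s tend to 0 shows that the transform determines the total mass. *)
Lemma stieltjes_cvg_mass m : m `]-oo, 0[%classic = 0%E ->
  stieltjes m n.+1%:R^-1 @[n --> \oo] --> m setT.
Proof.
move=> m0; have -> : m setT = (\int[m]_(x in `[0%R, +oo[) (cst 1 x))%E.
  rewrite integral_cst// mul1e.
  have dis : `]-oo, 0[%classic `&` `[0, +oo[%classic = set0 :> set R.
    by apply/seteqP; split => x //=; rewrite !in_itv/= andbT => -[x0]; rewrite leNgt x0.
  have -> : [set: R] = `]-oo, 0[%classic `|` `[0, +oo[%classic.
    by apply/seteqP; split => x //= _; rewrite !in_itv/= andbT; case: (ltP x 0) => ?; [left|right].
  apply: (etrans (measureU m _ _ dis)) => //.
  by rewrite -[RHS]add0e; congr (_ + _)%E.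
have -> : (\int[m]_(x in `[0%R, +oo[) (cst 1 x))%E =
    (\int[m]_(x in `[0%R, +oo[) limn (fun n => ((1 + n.+1%:R^-1 * x)^-1)%:E))%E.
  apply: eq_integral => x _; apply/esym/cvg_lim => //.
  apply/fine_cvgP; split; first exact: nearW.
  rewrite [X in _ --> X](_ : _ = (1 + 0 * x)^-1); last by rewrite mul0r addr0 invr1.
  apply: cvgV; first by rewrite mul0r addr0 oner_neq0.
  apply: cvgD; first exact: cvg_cst.
  by apply: cvgMl; exact: cvg_harmonic.
apply: cvg_monotone_convergence => //.
- by move=> n; apply/measurable_EFinP; exact: measurable_stieltjes.
- move=> n x /itv0y_ge0 x0; rewrite lee_fin.
  have n0 : 0 <= n.+1%:R^-1 :> R by rewrite invr_ge0.
  by have /andP[] := stieltjes_kernel01 n0 x0.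
- move=> x /itv0y_ge0 x0 i j ij; rewrite lee_fin.
  rewrite lef_pV2 ?posrE ?ltr_wpDr ?mulr_ge0//.
  by rewrite lerD2l ler_wpM2r// lef_pV2 ?posrE// ler_nat ltnS.
Qed.

(** Finiteness of [m2] is derived: its mass is the limit of a transform shared with [m1]. Hence [m2]
    may be built from a candidate density whose integral is still unknown. *)
Lemma stieltjes_unique m1 m2 : (m1 setT < +oo)%E ->
  m1 `]-oo, 0[%classic = 0%E -> m2 `]-oo, 0[%classic = 0%E ->
  (forall s : R, 0 < s -> stieltjes m1 s = stieltjes m2 s) ->
  forall U, measurable U -> m1 U = m2 U.
Proof.
move=> m1oo m10 m20 m12; apply: stieltjes_unique_finite => //.
have H1 := stieltjes_cvg_mass m10; have H2 := stieltjes_cvg_mass m20.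
rewrite -(cvg_lim (@ereal_hausdorff R) H2) (_ : (fun n => _) = (fun n => stieltjes m1 n.+1%:R^-1)).
  by rewrite (cvg_lim (@ereal_hausdorff R) H1).
by apply/funext => n; rewrite m12// invr_gt0.
Qed.
End stieltjes_uniqueness2.

(** * Laws, densities and independence as integrals *)

Section density_integral.
Context d (T : measurableType d) (R : realType).
Variables (mu m : {measure set T -> \bar R}) (D : set T) (f : T -> R).
Hypotheses (mD : measurable D) (mf : measurable_fun D f).
Hypothesis f0 : forall x, D x -> 0 <= f x.
Hypothesis mE : forall U, measurable U ->
  m U = (\int[mu]_(x in D `&` U) (f x)%:E)%E.
Import HBNNSimple.

Let nnsfun_density (h : {nnsfun T >-> R}) :
  (\int[m]_x (h x)%:E)%E = (\int[mu]_(x in D) ((h x)%:E * (f x)%:E))%E.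
Proof.
rewrite integralT_nnsfun sintegralE.
under [RHS]eq_integral => x xD.
  rewrite fimfunE -fsumEFin// ge0_mule_fsuml; last first.
    by move=> r; rewrite EFinM nnfun_muleindic_ge0.
  over.
rewrite ge0_integral_fsum//; last 2 first.
- by move=> r; apply: emeasurable_funM; apply/measurable_EFinP => //; apply: measurable_funM => //; exact: measurable_funTS.
- by move=> r x Dx; apply: mule_ge0; rewrite ?EFinM ?nnfun_muleindic_ge0 ?lee_fin ?f0.
apply: eq_fsbigr => r rh.
have r0 : 0 <= r by move: rh; rewrite inE => -[x _ <-]; exact: fun_ge0.
have mh : measurable (h @^-1` [set r]) by [].
rewrite mE// integral_mkcondr -ge0_integralZl//.
- apply: eq_integral => x _; rewrite patchE indicE.
  by case: ifPn => _; rewrite ?mulr1 ?mulr0 ?mule0 ?mul0e.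
- apply/(measurable_restrict _ mh mD); apply/measurable_EFinP.
  exact: measurable_funS mf.
- by move=> x Dx; rewrite patchE; case: ifPn => _ //; rewrite lee_fin f0.
Qed.

Lemma ge0_integral_density (g : T -> \bar R) :
  measurable_fun setT g -> (forall x, (0 <= g x)%E) ->
  (\int[m]_x g x)%E = (\int[mu]_(x in D) (g x * (f x)%:E))%E.
Proof.
move=> mg g0; pose g_ := nnsfun_approx measurableT mg.
have g_cvg x : (g_ n x)%:E @[n --> \oo] --> g x by exact: cvg_nnsfun_approx.
have g_nd x : {homo (fun n => g_ n x) : a b / (a <= b)%N >-> a <= b}.
  by move=> a b ab; apply/lefP; exact: nd_nnsfun_approx.
have H1 : (\int[m]_x (g_ n x)%:E)%E @[n --> \oo] --> (\int[m]_x g x)%E.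
  under [X in _ --> X]eq_integral => x _ do rewrite -(cvg_lim (@ereal_hausdorff R) (g_cvg x)).
  apply: cvg_monotone_convergence => //.
  - by move=> n; apply/measurable_EFinP.
  - by move=> n x _; rewrite lee_fin.
  - by move=> x _ a b ab; rewrite lee_fin g_nd.
have H2 : (\int[mu]_(x in D) ((g_ n x)%:E * (f x)%:E))%E @[n --> \oo] --> (\int[mu]_(x in D) (g x * (f x)%:E))%E.
  have c x : D x -> ((g_ n x)%:E * (f x)%:E)%E @[n --> \oo] --> (g x * (f x)%:E)%E.
    by move=> Dx; apply: cvgeZr.
  under [X in _ --> X]eq_integral => x /set_mem Dx do rewrite -(cvg_lim (@ereal_hausdorff R) (c x Dx)).
  apply: cvg_monotone_convergence => //.
  - by move=> n; apply: emeasurable_funM; apply/measurable_EFinP => //; exact: measurable_funTS.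
  - by move=> n x Dx; rewrite mule_ge0 ?lee_fin ?f0.
  - by move=> x Dx a b ab; rewrite lee_wpmul2r ?lee_fin ?f0// g_nd.
rewrite -(cvg_lim (@ereal_hausdorff R) H1) -(cvg_lim (@ereal_hausdorff R) H2).
by congr (lim (_ @ \oo)); apply/funext => n; exact: nnsfun_density.
Qed.
End density_integral.

Section density_measure.
Context d (T : measurableType d) (R : realType).
Variables (mu : {measure set T -> \bar R}) (g : T -> \bar R).
Hypotheses (mg : measurable_fun setT g) (g0 : forall x, (0 <= g x)%E).

(** The two proofs are arguments so that the measure structure can be inferred from the term
    itself. *)
Definition density_measure (_ : measurable_fun setT g) (_ : forall x, (0 <= g x)%E)
  (U : set T) : \bar R := (\int[mu]_(x in U) g x)%E.

Let density_measure0 : density_measure mg g0 set0 = 0%E.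
Proof. exact: integral_set0. Qed.

Let density_measure_ge0 U : (0 <= density_measure mg g0 U)%E.
Proof. exact: integral_ge0. Qed.

Let density_measure_additive : semi_sigma_additive (density_measure mg g0).
Proof. exact: semi_sigma_additive_nng_induced. Qed.

HB.instance Definition _ := isMeasure.Build _ _ _ (density_measure mg g0)
  density_measure0 density_measure_ge0 density_measure_additive.
End density_measure.

Section random_variables.
Context d (T : measurableType d) (R : realType) (P : probability T R).

(* Lebesgue measure lives on the type [measurableTypeR R], so laws are put there. *)
Definition real_RV (Y : T -> R) (mY : measurable_fun setT Y) :
    {mfun T >-> measurableTypeR R} :=
  HB.pack (Y : T -> measurableTypeR R)
    (isMeasurableFun.Build _ _ T (measurableTypeR R) Y mY).

Lemma measurable_preimage (Y : T -> R) (mY : measurable_fun setT Y) (U : set R) :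
  measurable U -> measurable (Y @^-1` U).
Proof. by move=> mU; rewrite -[_ @^-1` _]setTI; exact: mY. Qed.

Definition law (Y : T -> R) (mY : measurable_fun setT Y) :
    probability (measurableTypeR R) R := distribution P (real_RV mY).

Lemma ge0_integral_law (Y : T -> R) (mY : measurable_fun setT Y) (g : R -> \bar R) :
  measurable_fun setT g -> (forall x, (0 <= g x)%E) ->
  (\int[law mY]_x g x = \int[P]_w g (Y w))%E.
Proof. by move=> mg g0; exact: (ge0_integral_distribution (real_RV mY)). Qed.

Lemma expectation_ae (A : set T) (F G : T -> R) : measurable A -> P A = 1%E ->
  measurable_fun setT F -> measurable_fun setT G ->
  (forall w, A w -> F w = G w) -> ('E_P[F] = 'E_P[G])%E.
Proof.
move=> mA PA mF mG FG; rewrite unlock; apply: ae_eq_integral => //.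
- exact/measurable_EFinP.
- exact/measurable_EFinP.
- exists (~` A); split; first exact: measurableC.
    by apply: etrans (probability_setC P mA) _; rewrite PA subee.
  by move=> w /= H Aw; apply: H => _; rewrite FG.
Qed.

(** The sign of [g] is known on [0, +oo[ only, so [g] is first cut to zero elsewhere; this affects
    no expectation, because Y is nonnegative almost surely. *)
Lemma integral_law_itv0y (Y : T -> R) (mY : measurable_fun setT Y) (g : R -> R) :
  P (Y @^-1` `[0, +oo[) = 1%E -> measurable_fun setT g ->
  (forall x, 0 <= x -> 0 <= g x) ->
  (\int[law mY]_(x in `[0%R, +oo[) (g x)%:E = 'E_P[fun w => g (Y w)])%E.
Proof.
move=> Y0 mg g0; pose h := (g \_ `[0, +oo[ : R -> R).
have mh : measurable_fun setT h by apply/(measurable_restrictT _ (measurable_itv _)); exact: measurable_funTS.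
have h0 x : (0 <= (h x)%:E)%E.
  rewrite lee_fin /h patchE; case: ifPn => //; rewrite inE/= in_itv/= andbT; exact: g0.
transitivity (\int[law mY]_x (h x)%:E)%E.
  rewrite integral_mkcond; apply: eq_integral => x _.
  by rewrite /h !patchE; case: ifPn.
rewrite (@ge0_integral_law _ mY (fun x => (h x)%:E))//; last exact/measurable_EFinP.
transitivity ('E_P[fun w => h (Y w)])%E; first by rewrite unlock.
apply: (expectation_ae (A := Y @^-1` `[0, +oo[)) => //.
- exact: measurable_preimage.
- exact: measurableT_comp.
- exact: measurableT_comp.
- by move=> w Yw; rewrite /h patchE mem_set.
Qed.

Lemma law_lt0 (Y : T -> R) (mY : measurable_fun setT Y) :
  P (Y @^-1` `[0, +oo[) = 1%E -> law mY `]-oo, 0[%classic = 0%E.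
Proof.
move=> Y0; have -> : `]-oo, 0[%classic = ~` `[0, +oo[%classic :> set R.
  by apply/seteqP; split => x /=; rewrite !in_itv/= andbT ltNge => /negP.
have mA : measurable (Y @^-1` `[0, +oo[) by exact: measurable_preimage.
by apply: etrans (probability_setC P mA) _; rewrite Y0 subee.
Qed.

Lemma stieltjes_law (Y : T -> R) (mY : measurable_fun setT Y) (s : R) :
  P (Y @^-1` `[0, +oo[) = 1%E -> 0 <= s ->
  stieltjes (law mY) s = ('E_P[fun w => ((1 + s * Y w)^-1)%R])%E.
Proof.
move=> Y0 s0; rewrite -(integral_law_itv0y (g := fun x => (1 + s * x)^-1) mY)//.
- exact: measurable_stieltjes.
- by move=> x x0; have /andP[] := stieltjes_kernel01 s0 x0.
Qed.

Lemma stieltjes_eq_law (Y Z : T -> R) (mY : measurable_fun setT Y) (mZ : measurable_fun setT Z) :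
  P (Y @^-1` `[0, +oo[) = 1%E -> P (Z @^-1` `[0, +oo[) = 1%E ->
  (forall s : R, 0 < s ->
    ('E_P[fun w => ((1 + s * Y w)^-1)%R] = 'E_P[fun w => ((1 + s * Z w)^-1)%R])%E) ->
  eq_law P Y Z.
Proof.
move=> Y0 Z0 YZ U mU.
apply: (@stieltjes_unique _ (law mY) (law mZ)) => //.
- exact: (le_lt_trans (probability_le1 (law mY) measurableT) (ltry 1)).
- exact: law_lt0.
- exact: law_lt0.
- by move=> s s0; rewrite !stieltjes_law ?ltW// YZ.
Qed.

(** The last hypothesis equates the transform of the law with that of the measure of density [f] on
    [D], so uniqueness identifies the two; that [f] has integral one comes out as a by-product. *)
Lemma stieltjes_has_density (Y : T -> R) (mY : measurable_fun setT Y) (D : set R) (f : R -> R) :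
  P (Y @^-1` `[0, +oo[) = 1%E ->
  measurable D -> D `<=` `[0, +oo[ -> measurable_fun D f ->
  (forall x, D x -> 0 <= f x) ->
  (forall s : R, 0 < s -> ('E_P[fun w => ((1 + s * Y w)^-1)%R] =
     \int[lebesgue_measure]_(x in D) ((1 + s * x)^-1 * f x)%:E)%E) ->
  has_density P Y D f.
Proof.
move=> Y0 mD D0 mf f0 YE; split=> // U mU.
pose g := (fun x => (f x)%:E) \_ D.
have mg : measurable_fun setT g by apply/(measurable_restrictT _ mD)/measurable_EFinP.
have g0 x : (0 <= g x)%E.
  by rewrite /g patchE; case: ifPn => //; rewrite inE lee_fin => /f0.
pose m : {measure set (measurableTypeR R) -> \bar R} := @density_measure _ (measurableTypeR R) R lebesgue_measure g mg g0.
have mE V : m V = (\int[lebesgue_measure]_(x in D `&` V) (f x)%:E)%E.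
  by rewrite /m /= /density_measure setIC integral_mkcondr.
rewrite -mE; apply: (@stieltjes_unique _ (law mY) m) => //.
- exact: (le_lt_trans (probability_le1 (law mY) measurableT) (ltry 1)).
- exact: law_lt0.
- rewrite mE (_ : D `&` _ = set0) ?integral_set0//.
  apply/seteqP; split => // x [/D0]; rewrite /= !in_itv/= andbT leNgt => /negP.
  by [].
- move=> s s0; rewrite stieltjes_law ?(ltW s0)// YE//.
  rewrite /stieltjes [RHS]integral_mkcond.
  rewrite (@ge0_integral_density _ _ _ lebesgue_measure m D f mD mf f0 (fun V _ => mE V)); last 2 first.
  + apply/(measurable_restrictT _ (measurable_itv _)); apply/measurable_EFinP.
    exact: measurable_stieltjes.
  + move=> x; rewrite patchE; case: ifPn => //; rewrite inE/= in_itv/= andbT => x0.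
    by rewrite lee_fin; have /andP[] := stieltjes_kernel01 (ltW s0) x0.
  by apply: eq_integral => x; rewrite inE => /D0 Dx; rewrite patchE mem_set// EFinM.
Qed.

Lemma has_density_integral (Y : T -> R) (mY : measurable_fun setT Y) (D : set R) (f : R -> R) (g : R -> \bar R) :
  has_density P Y D f -> measurable D -> measurable_fun setT g ->
  (forall x, (0 <= g x)%E) ->
  (\int[P]_w g (Y w) = \int[lebesgue_measure]_(x in D) (g x * (f x)%:E))%E.
Proof.
move=> [mf f0 YE] mD mg g0.
rewrite -(@ge0_integral_density _ _ _ lebesgue_measure (law mY) D f mD mf f0 YE g mg g0).
by rewrite ge0_integral_law.
Qed.

Lemma has_density_preimage (Y : T -> R) (mY : measurable_fun setT Y) (D : set R) (f : R -> R) :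
  has_density P Y D f -> measurable D -> P (Y @^-1` D) = 1%E.
Proof.
move=> [mf f0 YE] mD; rewrite YE// setIid -[D in LHS]setIT -YE//.
by rewrite preimage_setT probability_setT.
Qed.

Lemma eq_law_integral (Y Z : T -> R) (mY : measurable_fun setT Y) (mZ : measurable_fun setT Z) (g : R -> \bar R) :
  eq_law P Y Z -> measurable_fun setT g -> (forall x, (0 <= g x)%E) ->
  (\int[P]_w g (Y w) = \int[P]_w g (Z w))%E.
Proof.
move=> YZ mg g0; rewrite -(ge0_integral_law mY)// -(ge0_integral_law mZ)//.
by apply: eq_measure_integral => U mU _; exact: YZ.
Qed.

(** [indep] speaks of rectangles; uniqueness of the product measure extends it to the joint law, and
    Tonelli then gives the iterated integral. *)
Lemma indep_integral (Y Z : T -> R) (mY : measurable_fun setT Y) (mZ : measurable_fun setT Z) (g : measurableTypeR R * measurableTypeR R -> \bar R) :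
  indep P Y Z -> measurable_fun setT g -> (forall x, (0 <= g x)%E) ->
  (\int[P]_w g (Y w, Z w) =
   \int[law mY]_y \int[law mZ]_z g (y, z))%E.
Proof.
move=> YZ mg g0.
have mYZ : measurable_fun setT (fun w => (Y w, Z w)) by exact: measurable_fun_pair.
pose W : {mfun T >-> (measurableTypeR R * measurableTypeR R)%type} :=
  HB.pack (fun w => (Y w, Z w)) (isMeasurableFun.Build _ _ T (measurableTypeR R * measurableTypeR R)%type _ mYZ).
rewrite -[LHS](ge0_integral_distribution (P := P) W)//.
rewrite -(fubini_tonelli1 (m1 := law mY) (m2 := law mZ))//.
apply: eq_measure_integral => U mU _; apply/esym.
apply: (product_measure_unique (m1 := law mY) (m2 := law mZ)) => //.
Qed.
End random_variables.

Section conditioning.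
Context d (T : measurableType d) (R : realType) (P : probability T R).

Lemma integral_ae_full (A : set T) (F G : T -> \bar R) : measurable A -> P A = 1%E ->
  measurable_fun setT F -> measurable_fun setT G ->
  (forall w, A w -> F w = G w) -> (\int[P]_w F w = \int[P]_w G w)%E.
Proof.
move=> mA PA mF mG FG; apply: ae_eq_integral => //.
exists (~` A); split; first exact: measurableC.
  by apply: etrans (probability_setC P mA) _; rewrite PA subee.
by move=> w /= H Aw; apply: H => _; rewrite FG.
Qed.

Lemma indepC (Y Z : T -> R) : indep P Y Z -> indep P Z Y.
Proof. by move=> YZ U V mU mV; rewrite setIC YZ// muleC. Qed.

(** Conditioning on Y: the inner expectation is computed only at the values in [D], where Y lies
    almost surely, and [k] may be anything measurable outside. *)
Lemma indep_integral_cond (Y Z : T -> R) (mY : measurable_fun setT Y)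
    (mZ : measurable_fun setT Z) (D : set R)
    (g : measurableTypeR R * measurableTypeR R -> \bar R) (k : R -> \bar R) :
  indep P Y Z -> measurable D -> P (Y @^-1` D) = 1%E ->
  measurable_fun setT g -> (forall x, (0 <= g x)%E) ->
  measurable_fun setT k ->
  (forall y, D y -> (\int[P]_w g (y, Z w) = k y)%E) ->
  (\int[P]_w g (Y w, Z w) = \int[P]_w k (Y w))%E.
Proof.
move=> YZ mD YD mg g0 mk gk; rewrite (indep_integral mY mZ)//.
have mF : measurable_fun setT (fun y => \int[law P mZ]_z g (y, z))%E.
  exact: (@measurable_fun_fubini_tonelli_F _ _ _ _ R (law P mZ) g mg g0).
rewrite (ge0_integral_law P mY (g := fun y => (\int[law P mZ]_z g (y, z))%E))//; last first.
  by move=> y; exact: integral_ge0.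
apply: (integral_ae_full (A := Y @^-1` D)) => //.
- exact: measurable_preimage.
- exact: (measurableT_comp mF mY).
- exact: (measurableT_comp mk mY).
- move=> w Dw; rewrite -gk//.
  apply: (ge0_integral_law P mZ (g := fun z => g (Y w, z))) => //.
  exact: measurableT_comp mg (measurable_pair1 _).
Qed.

Lemma has_density_expectation (Y : T -> R) (mY : measurable_fun setT Y) (D : set R)
    (f g : R -> R) : has_density P Y D f -> measurable D -> measurable_fun setT g ->
  (forall x, D x -> 0 <= g x) ->
  (\int[P]_w (g (Y w))%:E = \int[lebesgue_measure]_(x in D) (g x * f x)%:E)%E.
Proof.
move=> Yf mD mg g0; pose h := ((fun x => (g x)%:E) \_ D : R -> \bar R).
have mh : measurable_fun setT h.
  by apply/(measurable_restrictT _ mD); apply: measurable_funTS; exact/measurable_EFinP.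
have h0 x : (0 <= h x)%E.
  by rewrite /h patchE; case: ifPn => //; rewrite inE lee_fin; exact: g0.
transitivity (\int[P]_w h (Y w))%E.
  apply: (integral_ae_full (A := Y @^-1` D)) => //.
  - exact: measurable_preimage.
  - exact: has_density_preimage Yf mD.
  - by apply/measurable_EFinP; exact: measurableT_comp.
  - exact: measurableT_comp.
  - by move=> w Dw; rewrite /h patchE mem_set.
rewrite (has_density_integral mY Yf mD mh h0).
by apply: eq_integral => x xD; rewrite /h patchE xD EFinM.
Qed.

Lemma eq_law_ae (A : set T) (Y Z : T -> R) : measurable A -> P A = 1%E ->
  measurable_fun setT Y -> measurable_fun setT Z ->
  (forall w, A w -> Y w = Z w) -> eq_law P Y Z.
Proof.
move=> mA PA mY mZ YZ U mU.
have E (W : T -> R) : measurable_fun setT W ->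
    P (W @^-1` U) = (\int[P]_w (\1_U (W w))%:E)%E.
  move=> mW; rewrite -(setIT (W @^-1` U)) -integral_indic//; exact: measurable_preimage.
have mi (W : T -> R) : measurable_fun setT W -> measurable_fun setT (fun w => (\1_U (W w))%:E).
  by move=> mW; apply/measurable_EFinP; apply: measurableT_comp mW; exact: measurable_indic.
rewrite !E//; apply: (integral_ae_full mA PA); [exact: mi|exact: mi|].
by move=> w Aw; rewrite YZ.
Qed.

Lemma eq_law_comp (Y Z : T -> R) (h : R -> R) : measurable_fun setT h ->
  eq_law P Y Z -> eq_law P (fun w => h (Y w)) (fun w => h (Z w)).
Proof. by move=> mh YZ U mU; apply: (YZ (h @^-1` U)); exact: measurable_preimage. Qed.

Lemma eq_law_trans (Y Z W : T -> R) : eq_law P Y Z -> eq_law P Z W -> eq_law P Y W.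
Proof. by move=> YZ ZW U mU; rewrite YZ// ZW. Qed.

End conditioning.

(** * The function G in polar form and its mean over circles *)

Section radial_function.
Context (R : realType) (al th m : R).
Hypothesis m0 : 0 < m.

(** Let w = exp(a + i e) and u = m w^(2 al). Then [powmod] is |u|, [shiftmod2] is |1 + u|^2,
    [shiftarg] is arg(1 + u), and [logmodG], [argG] are the real and imaginary parts of log G. The
    shape of [shiftarg] comes from 1 + u = e^(i al e) ((1 + |u|) cos(al e) + i (|u| - 1) sin(al e)):
    for al |e| < pi / 2 the second factor has positive real part, so [atan] is the right branch even
    where 1 + u itself has negative real part. *)
Definition powmod (a : R) : R := m * expR (2 * al * a).
Definition shiftmod2 (a e : R) : R :=
  1 + 2 * powmod a * cos (2 * al * e) + powmod a ^+ 2.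
Definition shiftarg (a e : R) : R :=
  al * e + atan ((powmod a - 1) / (powmod a + 1) * tan (al * e)).
Definition logmodG (a e : R) : R := a - th / 2 * ln (shiftmod2 a e).
Definition argG (a e : R) : R := e - th * shiftarg a e.
(** The derivative of log G with respect to log w is 1 - 2 al th u / (1 + u); [dlogG1] is its real
    part and [dlogG2] the opposite of its imaginary part. *)
Definition dlogG1 (a e : R) : R :=
  1 - 2 * al * th * (powmod a * cos (2 * al * e) + powmod a ^+ 2) / shiftmod2 a e.
Definition dlogG2 (a e : R) : R :=
  2 * al * th * (powmod a * sin (2 * al * e)) / shiftmod2 a e.

Lemma powmod_gt0 a : 0 < powmod a.
Proof. by rewrite mulr_gt0// expR_gt0. Qed.

(** The squared modulus of the half-angle factorisation behind [shiftarg], which makes positivity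
    visible. *)
Lemma shiftmod2E a e : shiftmod2 a e =
  (1 + powmod a) ^+ 2 * cos (al * e) ^+ 2 + (1 - powmod a) ^+ 2 * sin (al * e) ^+ 2.
Proof.
rewrite /shiftmod2 (_ : 2 * al * e = al * e + al * e); last by ring.
rewrite cosD; have := cos2Dsin2 (al * e).
move: (cos _) (sin _) (powmod a) => c s p H.
rewrite [X in X + _ + _](_ : 1 = c ^+ 2 + s ^+ 2)// [X in _ + X](_ : _ = (c ^+ 2 + s ^+ 2) * p ^+ 2); last by rewrite H mul1r.
ring.
Qed.

Lemma shiftmod2_gt0 a e : cos (al * e) != 0 -> 0 < shiftmod2 a e.
Proof.
move=> c0; rewrite shiftmod2E ltr_pwDl//.
  by rewrite mulr_gt0 ?exprn_even_gt0//= gt_eqF// ltr_wpDl// powmod_gt0.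
by rewrite mulr_ge0 ?sqr_ge0.
Qed.

Section along_curve.
Variables (a e : R -> R) (x a' e' : R).
Hypotheses (da : is_derive x 1 a a') (de : is_derive x 1 e e').
Hypothesis ce : cos (al * e x) != 0.

Let dpowmod : is_derive x 1 (fun y => powmod (a y)) (2 * al * powmod (a x) * a').
Proof. rewrite /powmod; is_derive_auto; rewrite /=; ring. Qed.

Let dshiftmod2 : is_derive x 1 (fun y => shiftmod2 (a y) (e y))
  (4 * al * powmod (a x) * ((cos (2 * al * e x) + powmod (a x)) * a' - sin (2 * al * e x) * e')).
Proof. rewrite /shiftmod2; is_derive_auto; rewrite /=; ring. Qed.

(** Together with [is_derive_argG] this is the real part of (D1 - i D2) (a' + i e'), where D1, D2
    stand for [dlogG1], [dlogG2]: the Cauchy-Riemann equations for log G in the variable log w,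
    along an arbitrary curve. *)
Lemma is_derive_logmodG : is_derive x 1 (fun y => logmodG (a y) (e y))
  (dlogG1 (a x) (e x) * a' + dlogG2 (a x) (e x) * e').
Proof.
have p0 := shiftmod2_gt0 (a x) ce.
rewrite /logmodG; is_derive_auto => //.
rewrite /= /dlogG1 /dlogG2; field; by rewrite gt_eqF.
Qed.

Lemma is_derive_argG : is_derive x 1 (fun y => argG (a y) (e y))
  (dlogG1 (a x) (e x) * e' - dlogG2 (a x) (e x) * a').
Proof.
have p0 := powmod_gt0 (a x); have P0 := shiftmod2_gt0 (a x) ce.
have p1 : powmod (a x) + 1 != 0 by rewrite gt_eqF// ltr_wpDr.
rewrite /argG /shiftarg; is_derive_auto => //.
rewrite /= /dlogG1 /dlogG2.
rewrite (_ : 2 * al * e x = al * e x + al * e x); last by ring.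
rewrite cosD sinD /tan; move: P0; rewrite shiftmod2E.
have := cos2Dsin2 (al * e x); move: (cos _) (sin _) (powmod _) ce p0 p1 => c s p c0 p0 p1 cs P0.
have sE : s ^+ 2 = 1 - c ^+ 2 by rewrite -cs addrC addKr.
(* The denominator produced by [atan] becomes [shiftmod2], the denominator of [dlogG1] and
   [dlogG2]. *)
have D0 : 1 + ((p - 1) / (p + 1) * (s / c)) ^+ 2 =
   ((1 + p) ^+ 2 * c ^+ 2 + (1 - p) ^+ 2 * s ^+ 2) / ((p + 1) ^+ 2 * c ^+ 2).
  field; by rewrite c0 p1.
rewrite D0; field: sE; rewrite ?c0 ?p1 ?gt_eqF//; by rewrite !exprMn.
Qed.
End along_curve.

Hypothesis al01 : 0 < al < 1.

(** For z = r e^(i t), [circP] and [circM] are |1 + z|^2 and |1 - z|^2. The real and imaginary parts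
    of w = (1 + z) / (1 - z) are proportional to 1 - r^2 and 2 r sin t, whence [argw]. [dlogw] and
    [dargw] are the radial derivatives of ln |w| and arg w, and [dG] is that of the real part of
    G. *)
Definition circP (r t : R) : R := 1 + 2 * r * cos t + r ^+ 2.
Definition circM (r t : R) : R := 1 - 2 * r * cos t + r ^+ 2.
Definition logw (r t : R) : R := (ln (circP r t) - ln (circM r t)) / 2.
Definition argw (r t : R) : R := atan (2 * r * sin t / (1 - r ^+ 2)).
Definition reG (r t : R) : R :=
  expR (logmodG (logw r t) (argw r t)) * cos (argG (logw r t) (argw r t)).
Definition imG (r t : R) : R :=
  expR (logmodG (logw r t) (argw r t)) * sin (argG (logw r t) (argw r t)).
Definition dlogw (r t : R) : R := (cos t + r) / circP r t + (cos t - r) / circM r t.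
Definition dargw (r t : R) : R := sin t / circP r t + sin t / circM r t.
Definition dG (r t : R) : R :=
  expR (logmodG (logw r t) (argw r t)) *
  (cos (argG (logw r t) (argw r t)) *
     (dlogG1 (logw r t) (argw r t) * dlogw r t + dlogG2 (logw r t) (argw r t) * dargw r t)
   - sin (argG (logw r t) (argw r t)) *
     (dlogG1 (logw r t) (argw r t) * dargw r t - dlogG2 (logw r t) (argw r t) * dlogw r t)).

Lemma circ_ge (r t : R) : `|r| < 1 -> (1 - `|r|) ^+ 2 <= circP r t /\ (1 - `|r|) ^+ 2 <= circM r t.
Proof.
move=> r1; have r0 := normr_ge0 r; rewrite /circP /circM.
have H : `|r * cos t| <= `|r| by rewrite normrM ler_piMr// cos_max.
have r2 : `|r| ^+ 2 = r ^+ 2 by rewrite real_normK// num_real.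
move: H; rewrite ler_norml => /andP[H1 H2].
by split; rewrite sqrrB r2 expr1n mul1r -mulr_natl; lra.
Qed.

Lemma circP_gt0 r t : `|r| < 1 -> 0 < circP r t.
Proof.
move=> r1; apply: lt_le_trans (circ_ge t r1).1; rewrite exprn_gt0//; lra.
Qed.

Lemma circM_gt0 r t : `|r| < 1 -> 0 < circM r t.
Proof.
move=> r1; apply: lt_le_trans (circ_ge t r1).2; rewrite exprn_gt0//; lra.
Qed.

Lemma cos_al_neq0 x : cos (al * atan x) != 0.
Proof.
rewrite gt_eqF// cos_gt0_pihalf//.
have := atan_gtNpi2 x; have := atan_ltpi2 x; have := pi_gt0 R.
move: (atan x) al01 => y /andP[a0 a1] p0 y1 y2.
by apply/andP; split; nra.
Qed.

Lemma is_derive_logw (r t : R) : `|r| < 1 ->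
  is_derive r 1 (logw^~ t) (dlogw r t) /\ is_derive t 1 (logw r) (- (r * dargw r t)).
Proof.
move=> r1; have P0 := circP_gt0 t r1; have M0 := circM_gt0 t r1.
move: (P0) (M0); rewrite /circP /circM => P1 M1.
split; rewrite /logw /circP /circM.
- is_derive_auto => //; rewrite /= /dlogw -/(circP r t) -/(circM r t); field.
  by rewrite (gt_eqF P0) (gt_eqF M0).
- is_derive_auto => //; rewrite /= /dargw -/(circP r t) -/(circM r t); field.
  by rewrite (gt_eqF P0) (gt_eqF M0).
Qed.

Lemma is_derive_argw (r t : R) : `|r| < 1 ->
  is_derive r 1 (argw^~ t) (dargw r t) /\ is_derive t 1 (argw r) (r * dlogw r t).
Proof.
move=> r1; have P0 := circP_gt0 t r1; have M0 := circM_gt0 t r1.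
have r2 : 1 - r ^+ 2 != 0.
  by rewrite gt_eqF// subr_gt0 -real_normK ?num_real// exprn_ilt1.
have sE : sin t ^+ 2 = 1 - cos t ^+ 2 by rewrite -(cos2Dsin2 t) addrC addKr.
(* (1 - r^2)^2 + 4 r^2 sin^2 t is |1 - z^2|^2, the product of [circP] and [circM]. *)
have D : 1 + (2 * r * sin t / (1 - r ^+ 2)) ^+ 2 = circP r t * circM r t / (1 - r ^+ 2) ^+ 2.
  by rewrite /circP /circM; field: sE.
have PM : circP r t * circM r t = (1 + r ^+ 2) ^+ 2 - 4 * r ^+ 2 * cos t ^+ 2.
  by rewrite /circP /circM; ring.
split; rewrite /argw.
- is_derive_auto => //; rewrite /= D /dargw.
  transitivity (2 * sin t * (1 + r ^+ 2) / (circP r t * circM r t)).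
    by field; rewrite r2 (gt_eqF P0) (gt_eqF M0).
  rewrite (_ : 2 * sin t * (1 + r ^+ 2) = sin t * (circP r t + circM r t)); last first.
    by rewrite /circP /circM; ring.
  by field; rewrite (gt_eqF P0) (gt_eqF M0).
- is_derive_auto => //; rewrite /= D /dlogw.
  transitivity (2 * r * cos t * (1 - r ^+ 2) / (circP r t * circM r t)).
    by field; rewrite r2 (gt_eqF P0) (gt_eqF M0).
  rewrite (_ : 2 * r * cos t * (1 - r ^+ 2) =
     r * ((cos t + r) * circM r t + (cos t - r) * circP r t)); last by rewrite /circP /circM; ring.
  by field; rewrite (gt_eqF P0) (gt_eqF M0).
Qed.

Lemma is_derive_reG (r t : R) : `|r| < 1 -> is_derive r 1 (reG^~ t) (dG r t).
Proof.
move=> r1; have [d1 _] := is_derive_logw t r1; have [d2 _] := is_derive_argw t r1.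
have c0 := cos_al_neq0 (2 * r * sin t / (1 - r ^+ 2)).
have d3 := is_derive_logmodG d1 d2 c0; have d4 := is_derive_argG d1 d2 c0.
rewrite /reG; is_derive_auto; rewrite /= /dG; ring.
Qed.

(** The same [dG] as in the radial derivative of [reG], times r: this pair of formulas is the polar
    Cauchy-Riemann equation for G that makes the circle mean constant. *)
Lemma is_derive_imG (r t : R) : `|r| < 1 -> is_derive t 1 (imG r) (r * dG r t).
Proof.
move=> r1; have [_ d1] := is_derive_logw t r1; have [_ d2] := is_derive_argw t r1.
have c0 := cos_al_neq0 (2 * r * sin t / (1 - r ^+ 2)).
have d3 := is_derive_logmodG d1 d2 c0; have d4 := is_derive_argG d1 d2 c0.
rewrite /imG; is_derive_auto; rewrite /= /dG; ring.
Qed.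

Lemma continuous_reG (r : R) : `|r| < 1 -> continuous (reG r).
Proof.
move=> r1 t; have [_ d1] := is_derive_logw t r1; have [_ d2] := is_derive_argw t r1.
have c0 := cos_al_neq0 (2 * r * sin t / (1 - r ^+ 2)).
have d3 := is_derive_logmodG d1 d2 c0; have d4 := is_derive_argG d1 d2 c0.
rewrite /reG; apply: is_derive1_continuous; repeat is_derive_step.
Qed.
End radial_function.

Section circle_mean.
Context (R : realType) (al th m : R).
Hypotheses (m0 : 0 < m) (al01 : 0 < al < 1) (th0 : 0 < th).

(** This is cos(pi al / 2)^2, the best constant in |1 + u|^2 >= kap (1 + |u|)^2 for |arg u| <= pi
    al; equality occurs at |u| = 1, |arg u| = pi al. *)
Definition kap : R := (1 + cos (pi * al)) / 2.

Let pial : 0 <= (pi : R) * al <= pi.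
Proof.
have /andP[a0 a1] := al01; have p0 := pi_gt0 R.
by apply/andP; split; [rewrite mulr_ge0 ?ltW|rewrite ltW// gtr_pMr].
Qed.

Lemma kap_gt0 : 0 < kap.
Proof.
have /andP[a0 a1] := al01; have p0 := pi_gt0 R.
have : cos (pi : R) < cos (pi * al).
  rewrite ltr_cos ?in_itv/= ?pi_ge0 ?lexx ?pial//.
    by rewrite gtr_pMr.
by rewrite cospi /kap => ?; lra.
Qed.


Lemma shiftmod2_ge a x : kap * (1 + powmod al m a) ^+ 2 <= shiftmod2 al m a (atan x).
Proof.
have /andP[a0 a1] := al01; have p0 := pi_gt0 R.
have s0 := powmod_gt0 al m0 a.
have H : cos (pi * al) <= cos (2 * al * atan x).
  rewrite -(cos_norm (2 * al * _)).
  have -> : `|2 * al * atan x| = 2 * al * `|atan x| by rewrite normrM gtr0_norm// mulr_gt0.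
  have [|h|h] := ltgtP (pi * al) (2 * al * `|atan x|).
  - have : `|atan x| < pi / 2.
      by rewrite ltr_norml atan_ltpi2 andbT -mulNr mulNr atan_gtNpi2.
    by move: `|_| => z; nra.
  - rewrite ltW// ltr_cos// in_itv/= ?pial//.
    apply/andP; split; first by rewrite !mulr_ge0 ?normr_ge0 ?(ltW a0).
    by rewrite (le_trans (ltW h))//; case/andP: pial.
  - by rewrite h.
move: H; rewrite /kap /shiftmod2; move: (cos _) (cos _) (cos_le1 (pi * al)) => d c.
move: (powmod _ _ _) s0 => s s0 c1 cd; apply: (@le_trans _ _ (1 + 2 * s * c + s ^+ 2)).
  (* The difference of the two sides is (1 - c) (1 - s)^2 / 2. *)
  have : 0 <= (1 - s) ^+ 2 * (1 - c) by rewrite mulr_ge0 ?sqr_ge0 ?subr_ge0.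
  by rewrite !expr2; nra.
by rewrite lerD2r lerD2l ler_wpM2l// mulr_ge0// ltW.
Qed.

(** In other words |G| <= C |w|^(1 - 2 al th'), because th ln(1 + |u|) >= th' ln(1 + |u|) >= th' ln
    |u|. The parameter th' meets two needs: 0 is enough inside smaller discs, while a larger value
    gives an integrable bound near z = 1. *)
Lemma logmodG_le (th' a x : R) : 0 <= th' <= th ->
  logmodG al th m a (atan x) <=
  - (th / 2) * ln kap - th' * ln m + (1 - 2 * al * th') * a.
Proof.
move=> /andP[t0 t1]; have k0 := kap_gt0; have s0 := powmod_gt0 al m0 a.
have s1 : 0 < 1 + powmod al m a by lra.
have P0 := lt_le_trans (mulr_gt0 k0 (exprn_gt0 2 s1)) (shiftmod2_ge a x).
have H1 : ln kap + 2 * ln (1 + powmod al m a) <= ln (shiftmod2 al m a (atan x)).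
  have s2 : 0 < (1 + powmod al m a) ^+ 2 by rewrite exprn_gt0.
  have le1 := shiftmod2_ge a x; have q0 := mulr_gt0 k0 s2.
  by rewrite mulr_natl -lnXn// -lnM// ler_ln.
have H2 : th' * ln (powmod al m a) <= th * ln (1 + powmod al m a).
  apply: (@le_trans _ _ (th' * ln (1 + powmod al m a))).
    by rewrite ler_wpM2l// ler_ln ?posrE// lerDr.
  by rewrite ler_wpM2r// ln_ge0// lerDl ltW.
move: H2; rewrite {1}/powmod lnM ?posrE ?expR_gt0// expRK.
have : th / 2 * (ln kap + 2 * ln (1 + powmod al m a)) <= th / 2 * ln (shiftmod2 al m a (atan x)).
  by rewrite ler_wpM2l// divr_ge0// ltW.
by rewrite /logmodG; lra.
Qed.

(** Both numerators are at most (1 + |u|)^2 in absolute value, which [shiftmod2_ge] compares with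
    the denominator. *)
Lemma dlogG_le (a x : R) :
  `|dlogG1 al th m a (atan x)| <= 1 + 2 * al * th / kap /\
  `|dlogG2 al th m a (atan x)| <= 1 + 2 * al * th / kap.
Proof.
have /andP[a0 a1] := al01.
have k0 := kap_gt0; have s0 := powmod_gt0 al m0 a.
have s1 : 0 < 1 + powmod al m a by lra.
have P0 := lt_le_trans (mulr_gt0 k0 (exprn_gt0 2 s1)) (shiftmod2_ge a x).
have c0 : 0 < 2 * al * th by rewrite !mulr_gt0.
have H y : `|y| <= (1 + powmod al m a) ^+ 2 ->
    `|2 * al * th * y / shiftmod2 al m a (atan x)| <= 2 * al * th / kap.
  move=> yb; rewrite normrM normfV normrM (gtr0_norm P0) (gtr0_norm c0).
  rewrite -mulrA ler_wpM2l ?(ltW c0)// ler_pdivrMr// mulrC ler_pdivlMr//.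
  by rewrite mulrC; apply: le_trans (shiftmod2_ge a x); rewrite ler_wpM2l ?(ltW k0).
have cb z : `|powmod al m a * cos z| <= powmod al m a.
  by rewrite normrM (gtr0_norm s0) ler_piMr ?(ltW s0)// cos_max.
have sb z : `|powmod al m a * sin z| <= powmod al m a.
  by rewrite normrM (gtr0_norm s0) ler_piMr ?(ltW s0)// sin_max.
split.
- rewrite /dlogG1 (le_trans (ler_normB _ _))// normr1 lerD2l H//.
  rewrite (le_trans (ler_normD _ _))// (ger0_norm (sqr_ge0 _)).
  by have := cb (2 * al * atan x); rewrite sqrrD expr1n mul1r -mulr_natl; lra.
- rewrite /dlogG2 ler_wpDl// H//; have := sb (2 * al * atan x).
  by have := sqr_ge0 (powmod al m a); rewrite sqrrD expr1n mul1r -mulr_natl; lra.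
Qed.

(** A constant dominating function for differentiating the circle mean in r: for |z| <= v both |1 +
    z| and |1 - z| are at least 1 - v, and every factor of [dG] is bounded. *)
Lemma dG_le (v : R) : 0 < v < 1 -> exists2 C : R, 0 <= C &
  forall r t : R, `|r| <= v -> `|dG al th m r t| <= C.
Proof.
move=> /andP[v0 v1]; have /andP[a0 a1] := al01; have k0 := kap_gt0.
pose X := 1 + 2 * al * th / kap; pose W := 4 / (1 - v) ^+ 2.
have X0 : 0 <= X by rewrite /X addr_ge0// divr_ge0 ?(ltW k0)// !mulr_ge0 ?(ltW a0) ?(ltW th0).
have v2 : 0 < (1 - v) ^+ 2 by rewrite exprn_gt0// subr_gt0.
have W0 : 0 <= W by rewrite /W divr_ge0// (ltW v2).
pose E := expR (- (th / 2) * ln kap + (ln 4 - ln ((1 - v) ^+ 2)) / 2).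
exists (E * (4 * (X * W))).
  by apply: mulr_ge0; [exact: expR_ge0|apply: mulr_ge0 => //; exact: mulr_ge0].
move=> r t rv; have r1 := le_lt_trans rv v1.
have [P1 M1] := circ_ge t r1; have P0 := circP_gt0 t r1; have M0 := circM_gt0 t r1.
have vr : (1 - v) ^+ 2 <= (1 - `|r|) ^+ 2.
  by rewrite lerXn2r ?nnegrE ?subr_ge0 ?(ltW v1) ?(ltW r1)//; lra.
have [X1 Y1] := dlogG_le (logw r t) (2 * r * sin t / (1 - r ^+ 2)).
(* The case th' = 0 of [logmodG_le], with |w| <= 2 / (1 - v). *)
have L1 : expR (logmodG al th m (logw r t) (argw r t)) <= E.
  rewrite ler_expR (le_trans (@logmodG_le 0 _ _ _))// ?lexx ?(ltW th0)//.
  rewrite mul0r mulr0 !subr0 mul1r lerD2l /logw ler_pM2r ?invr_gt0// lerB//.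
    rewrite ler_ln ?posrE// /circP.
    have : `|r * cos t| <= 1 by rewrite normrM mulr_ile1// ?cos_max// (ltW r1).
    have : r ^+ 2 <= 1 by rewrite -real_normK ?num_real// exprn_ile1// (ltW r1).
    by rewrite ler_norml => ? /andP[]; rewrite -mulrA; lra.
  by rewrite ler_ln ?posrE// (le_trans vr).
have Bd (y p : R) : 0 < p -> (1 - `|r|) ^+ 2 <= p -> `|y| <= 2 -> `|y / p| <= W / 2.
  move=> p0 p1 y2; rewrite normrM normfV (gtr0_norm p0) /W.
  rewrite (_ : 4 / (1 - v) ^+ 2 / 2 = 2 / (1 - v) ^+ 2); last first.
    by field; rewrite subr_eq0 gt_eqF.
  by rewrite ler_pM ?invr_ge0 ?(ltW p0)// lef_pV2 ?posrE// (le_trans vr).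
have cr : `|cos t| <= 1 by rewrite cos_max.
have sr : `|sin t| <= 1 by rewrite sin_max.
have Wl : `|dlogw r t| <= W.
  rewrite /dlogw (le_trans (ler_normD _ _))// [leRHS](splitr W) lerD// Bd//.
    by rewrite (le_trans (ler_normD _ _))//; lra.
  by rewrite (le_trans (ler_normB _ _))//; lra.
have We : `|dargw r t| <= W.
  by rewrite /dargw (le_trans (ler_normD _ _))// [leRHS](splitr W) lerD// Bd//; lra.
have Q (x1 y1 x2 y2 : R) : `|x1| <= X -> `|y1| <= W -> `|x2| <= X -> `|y2| <= W ->
    `|x1 * y1| + `|x2 * y2| <= 2 * (X * W).
  by move=> *; rewrite !normrM mulr_natl mulr2n lerD// ler_pM.
rewrite /dG normrM ger0_norm ?expR_ge0// ler_pM// ?expR_ge0//.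
rewrite (le_trans (ler_normB _ _))// !normrM (_ : 4 * _ = 2 * (X * W) + 2 * (X * W)); last by ring.
rewrite lerD// -[leRHS]mul1r ler_pM// ?cos_max ?sin_max//.
- by rewrite (le_trans (ler_normD _ _))// Q.
- by rewrite (le_trans (ler_normB _ _))// Q.
Qed.
End circle_mean.

Section circle_mean2.
Context (R : realType) (al th m : R).
Hypotheses (m0 : 0 < m) (al01 : 0 < al < 1) (th0 : 0 < th).


Lemma continuous_dG (r : R) : `|r| < 1 -> continuous (dG al th m r).
Proof.
move=> r1 t; have [_ d1] := is_derive_logw t r1; have [_ d2] := is_derive_argw t r1.
have c0 := cos_al_neq0 al01 (2 * r * sin t / (1 - r ^+ 2)).
have d3 := is_derive_logmodG th m0 d1 d2 c0; have d4 := is_derive_argG th m0 d1 d2 c0.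
have P0 := circP_gt0 t r1; have M0 := circM_gt0 t r1.
have [aP dP] : exists a, is_derive t 1 (circP r) a.
  by eexists; rewrite /circP; repeat is_derive_step.
have [aM dM] : exists a, is_derive t 1 (circM r) a.
  by eexists; rewrite /circM; repeat is_derive_step.
have [b1 e1] : exists b, is_derive t 1 (dlogw r) b.
  by eexists; rewrite /dlogw; repeat is_derive_step; rewrite gt_eqF.
have [b2 e2] : exists b, is_derive t 1 (dargw r) b.
  by eexists; rewrite /dargw; repeat is_derive_step; rewrite gt_eqF.
have S0 : shiftmod2 al m (logw r t) (argw r t) != 0.
  by rewrite gt_eqF//; exact: (@shiftmod2_gt0 _ al m m0 (logw r t) (argw r t) c0).
have [b3 e3] : exists b, is_derive t 1 (fun t => powmod al m (logw r t)) b.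
  by eexists; rewrite /powmod; repeat is_derive_step.
have [b4 e4] : exists b, is_derive t 1 (fun t => shiftmod2 al m (logw r t) (argw r t)) b.
  by eexists; rewrite /shiftmod2; repeat is_derive_step.
have [b5 e5] : exists b, is_derive t 1 (fun t => dlogG1 al th m (logw r t) (argw r t)) b.
  by eexists; rewrite /dlogG1; repeat is_derive_step.
have [b6 e6] : exists b, is_derive t 1 (fun t => dlogG2 al th m (logw r t) (argw r t)) b.
  by eexists; rewrite /dlogG2; repeat is_derive_step.
have [b7 e7] : exists b, is_derive t 1 (dG al th m r) b.
  by eexists; rewrite /dG; repeat is_derive_step.
exact: (is_derive1_continuous e7).
Qed.

(** Here z is real, so w is positive and so is G. *)
Lemma imG0 (r t : R) : sin t = 0 -> imG al th m r t = 0.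
Proof.
move=> st; rewrite /imG /argG /shiftarg /argw st mulr0 mul0r atan0 mulr0 tan0 mulr0 atan0.
by rewrite addr0 mulr0 subr0 sin0 mulr0.
Qed.

Lemma Rintegral_dG (r : R) : `|r| < 1 ->
  r * (\int[lebesgue_measure]_(t in `[0, pi]) dG al th m r t) = 0.
Proof.
move=> r1; rewrite -RintegralZl//; last first.
  apply: continuous_compact_integrable; first exact: segment_compact.
  by apply: continuous_subspaceT; exact: continuous_dG.
rewrite /Rintegral (@continuous_FTC2 _ _ (imG al th m r) 0 pi).
- by rewrite !imG0 ?sinpi ?sin0// subee.
- exact: pi_gt0.
- apply: continuous_subspaceT => t; apply: cvgM; [exact: cvg_cst|exact: continuous_dG].
- have c t : {for t, continuous (imG al th m r)}.
    exact: is_derive1_continuous (is_derive_imG th m0 al01 t r1).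
  split.
  + by move=> t _; have [] := is_derive_imG th m0 al01 t r1.
  + exact/cvg_at_right_filter/c.
  + exact/cvg_at_left_filter/c.
- by move=> t _; exact: is_derive1E (is_derive_imG th m0 al01 t r1).
Qed.

(** The mean value property, on half a circle since the real part of G is even in t. At r = 0 one
    has w = 1 and the integrand is constant. *)
Lemma circle_mean (r : R) : 0 <= r < 1 ->
  \int[lebesgue_measure]_(t in `[0, pi]) reG al th m r t = pi * (1 + m) `^ (- th).
Proof.
move=> /andP[r0 r1].
pose M r := \int[lebesgue_measure]_(t in `[0, pi]) reG al th m r t.
have M0 : M 0 = pi * (1 + m) `^ (- th).
  have E (t : R) : reG al th m 0 t = (1 + m) `^ (- th).
    have lw0 : logw 0 t = 0 by rewrite /logw /circP /circM mulr0 !mul0r addr0 subr0 subrr mul0r.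
    have aw0 : argw 0 t = 0 by rewrite /argw mulr0 !mul0r atan0.
    rewrite /reG lw0 aw0 /logmodG /argG /shiftarg /shiftmod2 /powmod !mulr0 expR0 tan0 mulr0 atan0.
    rewrite addr0 mulr0 subr0 cos0 !mulr1 sub0r.
    rewrite /powR gt_eqF; last by rewrite ltr_wpDr// ltW.
    congr expR; rewrite (_ : 1 + 2 * m + m ^+ 2 = (1 + m) ^+ 2); last by ring.
    by rewrite lnXn ?ltr_wpDr ?(ltW m0)// mulr2n; field.
  rewrite /M; under eq_Rintegral do rewrite E.
  have mpi : fine (lebesgue_measure `[0, (pi : R)]%classic) = pi :> R.
    by rewrite lebesgue_measure_itv/= lte_fin pi_gt0 /= subr0.
  by rewrite Rintegral_cst// mpi mulrC.
have dM (x : R) : `|x| < 1 -> is_derive x 1 M (\int[lebesgue_measure]_(t in `[0, pi]) dG al th m x t).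
  (* Half way between |x| and 1: the bound of [dG_le] is then uniform on ]- v, v[, a neighbourhood
     of x even when x = 0. *)
  move=> x1; pose v := (1 + `|x|) / 2.
  have x0 := normr_ge0 x.
  have v01 : 0 < v < 1 by rewrite /v; lra.
  have [C C0 Cb] := dG_le m0 al01 th0 v01.
  have Iv (y : R) : `](- v), v[%classic y -> `|y| < v by rewrite /= in_itv/= ltr_norml.
  have Iv1 (y : R) : `](- v), v[%classic y -> `|y| < 1.
    by move=> /Iv yv; case/andP: v01 => _; exact: lt_trans.
  have Ix : `](- v), v[%classic x.
    by rewrite /= in_itv/= -ltr_norml /v; lra.
  have ir (y : R) : `](- v), v[%classic y ->
      lebesgue_measure.-integrable `[0, pi] (EFin \o reG al th m y).
    move=> /Iv1 y1; apply: continuous_compact_integrable; first exact: segment_compact.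
    by apply: continuous_subspaceT; exact: continuous_reG.
  have iC : lebesgue_measure.-integrable `[0, (pi : R)] (EFin \o cst C).
    apply: continuous_compact_integrable; first exact: segment_compact.
    by apply: continuous_subspaceT => ?; exact: cvg_cst.
  have dr (y t : R) : `](- v), v[%classic y -> `[0, (pi : R)]%classic t ->
      derivable (fun y => reG al th m y t) y 1.
    by move=> /Iv1 y1 _; have [] := is_derive_reG th m0 al01 t y1.
  have pE (y t : R) : `|y| < 1 -> partial1of2 (fun y t => reG al th m y t) y t = dG al th m y t.
    by move=> y1; rewrite partial1of2E (@derive_val _ _ _ _ _ _ _ (is_derive_reG th m0 al01 t y1)).
  have bd (y t : R) : `](- v), v[%classic y -> `[0, (pi : R)]%classic t ->
      `|partial1of2 (fun y t => reG al th m y t) y t| <= cst C t.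
    by move=> vy _; rewrite pE ?Iv1// Cb// ltW// Iv.
  have D : derivable M x 1.
    exact: (@derivable_under_integral R _ _ lebesgue_measure (reG al th m) `[0, pi]%classic
      (measurable_itv _) x (- v) v Ix ir dr (cst C) (fun=> C0) iC bd).
  have V := (@differentiation_under_integral R _ _ lebesgue_measure (reG al th m) `[0, pi]%classic
      (measurable_itv _) x (- v) v Ix ir dr (cst C) (fun=> C0) iC bd).
  apply: DeriveDef => //; rewrite -derive1E V.
  by apply: eq_Rintegral => t _; rewrite pE.
move: r0; rewrite le_eqVlt => /predU1P[<-//|r0].
have Mc : {within `[0, r], continuous M}.
  apply: continuous_in_subspaceT => x; rewrite inE/= in_itv/= => /andP[x0 xr].
  by apply: is_derive1_continuous (dM x _); rewrite ger0_norm// (le_lt_trans xr).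
(* The intermediate point is positive, so the factor x in [Rintegral_dG] can be cancelled and the
   derivative there is zero. *)
have [] := @MVT _ M (fun x => \int[lebesgue_measure]_(t in `[0, pi]) dG al th m x t) 0 r r0 _ Mc.
  move=> x; rewrite in_itv/= => /andP[x0 xr].
  by apply: dM; rewrite gtr0_norm// (lt_trans xr).
move=> x; rewrite in_itv/= => /andP[x0 xr].
have x1 : `|x| < 1 by rewrite gtr0_norm// (lt_trans xr).
have /eqP := Rintegral_dG x1; rewrite mulf_eq0 gt_eqF//= => /eqP ->.
by rewrite mul0r => /eqP; rewrite subr_eq0 => /eqP; rewrite -M0.
Qed.
End circle_mean2.

(** * The limit r -> 1 and its domination *)

Section circle_limit.
Context (R : realType) (al th m : R).
Hypotheses (m0 : 0 < m) (al01 : 0 < al < 1) (th0 : 0 < th).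

(** From sin u >= u cos u follows u^2 (1 - sin^2 u) <= sin^2 u, that is u^2 <= (1 + u^2) sin^2 u;
    and u^2 <= 4 because pi / 2 < 2, whence the 5. *)
Lemma sin_ge_sqr (u : R) : 0 <= u <= pi / 2 -> u ^+ 2 <= 5 * sin u ^+ 2.
Proof.
move=> /andP[u0 u2]; have p0 := pi_gt0 R; have p2 := pihalf_lt2 R.
pose h := fun x : R => sin x - x * cos x.
have dh (x : R) : is_derive x 1 h (x * sin x).
  by rewrite /h; is_derive_auto; rewrite /=; ring.
have : h 0 <= h u.
  apply: (@ger0_derive1_ndecr _ h 0 u) => //.
  - move=> x; rewrite in_itv/= => /andP[x0 xu]; rewrite (is_derive1E (dh x)).
    rewrite mulr_ge0 ?(ltW x0)// sin_ge0_pi// (ltW x0)/= (le_trans (ltW xu))//; lra.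
  - by apply: continuous_subspaceT => x; exact: is_derive1_continuous (dh x).
rewrite /h sin0 mul0r subrr subr_ge0 => H.
have c0 : 0 <= cos u by rewrite cos_ge0_pihalf// u2 andbT; lra.
have : (u * cos u) ^+ 2 <= sin u ^+ 2 by rewrite lerXn2r ?nnegrE ?(le_trans _ H) ?mulr_ge0.
have cE : cos u ^+ 2 = 1 - sin u ^+ 2 by rewrite -(cos2Dsin2 u) addrK.
have u4 : u ^+ 2 <= 4 by rewrite expr2; nra.
rewrite exprMn cE; have : 0 <= sin u ^+ 2 by exact: sqr_ge0.
move: (sin u ^+ 2) (u ^+ 2) (sqr_ge0 u) u4 => s v v0 v4 s0; nra.
Qed.

(** |1 - z|^2 = (1 - r)^2 + 4 r sin^2(t / 2) is at least 2 sin^2(t / 2) for r >= 1 / 2, and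
    [sin_ge_sqr] at t / 2 gives the 10. *)
Lemma circM_ge (r t : R) : 1 / 2 <= r < 1 -> 0 <= t <= pi -> t ^+ 2 / 10 <= circM r t.
Proof.
move=> /andP[r0 r1] /andP[t0 tp].
have : (t / 2) ^+ 2 <= 5 * sin (t / 2) ^+ 2 by apply: sin_ge_sqr; lra.
rewrite /circM; have -> : cos t = 1 - 2 * sin (t / 2) ^+ 2.
  rewrite {1}(splitr t) cosD; have := cos2Dsin2 (t / 2).
  by move: (cos _) (sin _) => c s H; rewrite -!expr2; lra.
have := sqr_ge0 (sin (t / 2)); have := sqr_ge0 (1 - r).
have -> : (t / 2) ^+ 2 = t ^+ 2 / 4 by field.
by move: (sin _ ^+ 2) (t ^+ 2) => s v; rewrite !expr2; nra.
Qed.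

(** |1 + z|^2 <= 4 and [circM_ge] give |w|^2 <= 40 / t^2 <= (7 / t)^2, uniformly in r; the condition
    2 al th' <= 1 keeps the exponent of |w| nonnegative. *)
Lemma reG_le (r t : R) (th' : R) : 1 / 2 <= r < 1 -> 0 < t <= pi -> 0 <= th' <= th ->
  2 * al * th' <= 1 ->
  `|reG al th m r t| <= expR (- (th / 2) * ln (kap al) - th' * ln m) *
      expR ((1 - 2 * al * th') * ln (7 / t)).
Proof.
move=> r1 /andP[t0 tp] th'0 a1; rewrite /reG normrM ger0_norm ?expR_ge0//.
have /andP[r0 rr] := r1.
rewrite -[leRHS]mulr1 ler_pM ?expR_ge0 ?cos_max// -expRD ler_expR.
apply: (le_trans (logmodG_le m0 al01 th0 _ _ th'0)); rewrite lerD2l.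
apply: ler_wpM2l; first by lra.
have rn : `|r| < 1 by rewrite ger0_norm//; lra.
have P0 := circP_gt0 t rn; have M0 := circM_gt0 t rn.
have M1 : t ^+ 2 / 10 <= circM r t by apply: circM_ge; rewrite ?(ltW t0).
have t2 : 0 < t ^+ 2 / 10 by rewrite divr_gt0 ?exprn_gt0.
have P4 : circP r t <= 4.
  have := cos_le1 t; rewrite /circP expr2; move: (cos t) => c c1; nra.
have E2 : ln (7 / t) * 2 = ln ((7 / t) ^+ 2) by rewrite lnXn ?divr_gt0// mulr_natr.
rewrite /logw ler_pdivrMr// E2 -ln_div ?posrE//.
rewrite ler_ln ?posrE ?divr_gt0 ?exprn_gt0//; last by rewrite divr_gt0.
rewrite ler_pdivrMr// (le_trans P4)// -ler_pdivrMl ?exprn_gt0 ?divr_gt0//.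
apply: le_trans M1; rewrite expr_div_n invf_div mulrAC; move: (t ^+ 2) t2 => v v0; lra.
Qed.

Lemma integrable_powR_near0 (de C : R) : 0 <= de < 1 -> 0 <= C ->
  lebesgue_measure.-integrable `]0, (pi : R)[ (EFin \o (fun t : R => C * t `^ (- de))).
Proof.
move=> /andP[d0 d1] C0; have p0 := pi_gt0 R.
(* atan (x^(1 - de)) maps ]0, oo[ onto the bounded interval ]0, pi/2[ *)
pose F (x : R) := atan (x `^ (1 - de)).
pose f (x : R) := (1 - de) * x `^ (- de) / (1 + (x `^ (1 - de)) ^+ 2).
have dF (x : R) : 0 < x -> is_derive x 1 F (f x).
  move=> x0; rewrite /F; is_derive_auto => //; rewrite /f /= mulr1.
  by congr (_ * _ `^ _ / _); ring.
have f0 (x : R) : 0 < x -> 0 < f x.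
  by move=> x0; rewrite /f divr_gt0 ?mulr_gt0 ?powR_gt0 ?subr_gt0// ltr_pwDl// sqr_ge0.
have cf (x : R) : 0 < x -> {for x, continuous f}.
  move=> x0; have [a da] : exists a, is_derive x 1 f a.
    eexists; rewrite /f; repeat is_derive_step => //.
    by rewrite gt_eqF// ltr_pwDl// sqr_ge0.
  exact: is_derive1_continuous da.
have img : F @` `]0, +oo[ = `]0, (pi / 2)[%classic.
  apply/seteqP; split => y /=.
    move=> [x]; rewrite in_itv/= andbT => x0 <-; rewrite in_itv/= /F atan_ltpi2 andbT.
    by rewrite -[ltLHS]atan0 lt_atan// powR_gt0.
  rewrite in_itv/= => /andP[y0 y1]; have t0 : 0 < tan y.
    by rewrite divr_gt0// ?sin_gt0_pihalf ?y0// cos_gt0_pihalf// y1 andbT; lra.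
  exists ((tan y) `^ ((1 - de)^-1)); first by rewrite in_itv/= andbT powR_gt0.
  rewrite /F -powRrM mulVf ?powRr1 ?(ltW t0)//; last by rewrite gt_eqF// subr_gt0.
  by rewrite tanK// in_itv/= y1 andbT; lra.
have cc (y : R) : `]0, (pi / 2)[%classic y -> {for y, continuous (cst (1 : R) : R -> R)}.
  by move=> _; exact: cvg_cst.
have S := @ge0_substitution_0y _ F f (cst 1) _ dF f0 cf img cc (fun y _ => ler01).
(* On ]0, pi[ the denominator of [f] stays between 1 and its value at pi, so x^(- de) is at most a
   multiple of [f]. *)
have B (x : R) : 0 < x -> x < pi -> C * x `^ (- de) <=
    C * ((1 + (pi `^ (1 - de)) ^+ 2) / (1 - de)) * f x.
  move=> x0 xp; rewrite /f -!mulrA ler_wpM2l//.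
  rewrite [leRHS](_ : _ = x `^ (- de) * ((1 + (pi `^ (1 - de)) ^+ 2) / (1 + (x `^ (1 - de)) ^+ 2))); last first.
    have q1 : 1 - de != 0 by rewrite subr_eq0 gt_eqF.
    have q2 : 1 + (x `^ (1 - de)) ^+ 2 != 0 by rewrite gt_eqF// ltr_pwDl// sqr_ge0.
    by field; rewrite q1 q2.
  rewrite ler_peMr ?powR_ge0// ler_pdivlMr; last by rewrite ltr_pwDl// sqr_ge0.
  rewrite mul1r lerD2l lerXn2r ?nnegrE ?powR_ge0//.
  by rewrite ge0_ler_powR ?nnegrE ?subr_ge0 ?(ltW d1) ?(ltW x0) ?(ltW xp) ?(ltW p0).
apply/integrableP; split.
  apply/measurable_EFinP; apply: measurable_funM => //.
  by apply: measurable_funTS; exact: measurable_powR.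
pose K := C * ((1 + (pi `^ (1 - de)) ^+ 2) / (1 - de)).
have K0 : 0 <= K.
  by rewrite /K mulr_ge0// divr_ge0 ?subr_ge0 ?(ltW d1)// addr_ge0// sqr_ge0.
have mf (D : set R) : measurable D -> D `<=` `]0, +oo[ -> measurable_fun D f.
  move=> mD DS; apply: measurable_funS DS _ => //.
  apply: open_continuous_measurable_fun; first exact: interval_open.
  by move=> x; rewrite inE/= in_itv/= andbT => /cf.
have sub : `]0, (pi : R)[%classic `<=` `]0, +oo[%classic.
  by move=> x /=; rewrite !in_itv/= => /andP[->].
apply: (@le_lt_trans _ _ (\int[lebesgue_measure]_(x in `]0%R, (pi : R)[) (K%:E * (f x)%:E))%E).
  apply: ge0_le_integral => //.
  - apply/measurable_EFinP; apply: measurableT_comp => //; apply: measurable_funM => //.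
    by apply: measurable_funTS; exact: measurable_powR.
  - by apply: emeasurable_funM; [exact: measurable_cst|apply/measurable_EFinP; exact: mf].
  - move=> x /=; rewrite in_itv/= => /andP[x0 xp]; rewrite -EFinM lee_fin.
    by rewrite ger0_norm ?B// mulr_ge0 ?powR_ge0.
rewrite ge0_integralZl//; last 2 first.
- by apply/measurable_EFinP; exact: mf.
- by move=> x /=; rewrite in_itv/= => /andP[x0 _]; rewrite lee_fin ltW// f0.
rewrite lte_mul_pinfty ?lee_fin//.
apply: (@le_lt_trans _ _ (\int[lebesgue_measure]_(x in `]0%R, +oo[) (f x)%:E)%E).
  apply: ge0_subset_integral => //.
    by apply/measurable_EFinP; exact: mf.
  by move=> x /=; rewrite in_itv/= andbT => x0; rewrite lee_fin ltW// f0.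
under eq_integral do rewrite -[f _]mul1r.
have E1 : (\int[lebesgue_measure]_(y in `]0%R, (pi / 2)%R[) (cst 1 y)%:E)%E =
  (\int[lebesgue_measure]_(y in `]0%R, ((pi : R) / 2)%R[) cst 1%E y)%E by [].
rewrite -S E1 integral_cst//= mul1e lebesgue_measure_itv/= lte_fin divr_gt0//.
by rewrite sube0 ltry.
Qed.
End circle_limit.

Section circle_limit2.
Context (R : realType) (al th m : R).
Hypotheses (m0 : 0 < m) (al01 : 0 < al < 1) (th0 : 0 < th).

(** This is ln cot(t / 2), the value of ln |w| on the unit circle. *)
Definition logw1 (t : R) : R := (ln (2 + 2 * cos t) - ln (2 - 2 * cos t)) / 2.

(* On the slit |zeta| = 1 the argument of w = (1 + zeta) / (1 - zeta) is pi / 2. *)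
Definition reG1 (t : R) : R :=
  expR (logmodG al th m (logw1 t) (pi / 2)) * cos (argG al th m (logw1 t) (pi / 2)).

Let cos_lt1 (t : R) : 0 < t < pi -> - 1 < cos t < 1.
Proof.
move=> /andP[t0 tp]; rewrite -cospi -(@cos0 R) !ltr_cos ?in_itv/= ?lexx ?pi_ge0 ?(ltW t0) ?(ltW tp)//.
by rewrite tp t0.
Qed.

Let shiftmod2_pihalf_gt0 (a : R) : 0 < shiftmod2 al m a (pi / 2).
Proof.
have /andP[a0 a1] := al01; have p0 := pi_gt0 R.
apply: shiftmod2_gt0 => //; rewrite gt_eqF// cos_gt0_pihalf//.
by apply/andP; split; nra.
Qed.

(** Starting at 1 / 2 keeps every radius in the range of [circM_ge]. *)
Let r_ (n : nat) : R := 1 - n.+2%:R^-1.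

Let r_itv n : 1 / 2 <= r_ n < 1.
Proof.
rewrite /r_ gtrBl invr_gt0 ltr0n andbT; have : n.+2%:R^-1 <= 2^-1 :> R.
  by rewrite lef_pV2 ?posrE// ler_nat.
by move: (n.+2%:R^-1) => x; lra.
Qed.

Let r_cvg : r_ n @[n --> \oo] --> (1 : R).
Proof.
rewrite -[X in _ --> X]subr0; apply: cvgB; first exact: cvg_cst.
by rewrite (cvg_shiftS (fun n => n.+1%:R^-1 : R)); exact: cvg_harmonic.
Qed.

Lemma reG_cvg (t : R) : 0 < t < pi -> reG al th m (r_ n) t @[n --> \oo] --> reG1 t.
Proof.
move=> t0; have /andP[c1 c2] := cos_lt1 t0; have p0 := pi_gt0 R.
have st : 0 < sin t by apply: sin_gt0_pi.
have lnc (f : nat -> R) (l : R) : 0 < l -> f n @[n --> \oo] --> l -> ln (f n) @[n --> \oo] --> ln l.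
  by move=> l0 fl; apply: continuous_cvg fl; exact: continuous_ln.
have ca : logw (r_ n) t @[n --> \oo] --> logw1 t.
  rewrite /logw /logw1; apply: cvgM; last exact: cvg_cst.
  apply: cvgB; apply: lnc.
  - by lra.
  - rewrite /circP (_ : 2 + 2 * cos t = 1 + 2 * 1 * cos t + 1 ^+ 2); last by rewrite expr1n; ring.
    apply: cvgD; [apply: cvgD; [exact: cvg_cst|]|].
      by apply: cvgM; [apply: cvgM; [exact: cvg_cst|exact: r_cvg]|exact: cvg_cst].
    by under eq_fun do rewrite expr2; rewrite expr2; apply: cvgM; exact: r_cvg.
  - by lra.
  - rewrite /circM (_ : 2 - 2 * cos t = 1 - 2 * 1 * cos t + 1 ^+ 2); last by rewrite expr1n; ring.
    apply: cvgD; [apply: cvgB; [exact: cvg_cst|]|].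
      by apply: cvgM; [apply: cvgM; [exact: cvg_cst|exact: r_cvg]|exact: cvg_cst].
    by under eq_fun do rewrite expr2; rewrite expr2; apply: cvgM; exact: r_cvg.
(* 1 - r^2 <= 2 / (n + 2) while 2 r >= 1, so the tangent of the argument is at least (n + 2) sin t /
   2 and tends to +oo. *)
have ce : argw (r_ n) t @[n --> \oo] --> (pi / 2 : R).
  apply: (cvg_comp _ _ _ (@cvgy_atan R)).
  apply/cvgryPge => A; near=> n.
  have /andP[rn0 rn1] := r_itv n.
  have rE : 1 - r_ n ^+ 2 <= 2 * n.+2%:R^-1.
    rewrite /r_; have := sqr_ge0 (n.+2%:R^-1 : R); by move: (n.+2%:R^-1) => x; rewrite !expr2; lra.
  have rp : 0 < 1 - r_ n ^+ 2 by rewrite subr_gt0 exprn_ilt1//; lra.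
  rewrite (@le_trans _ _ (sin t / (2 * n.+2%:R^-1)))//.
    rewrite (_ : sin t / (2 * n.+2%:R^-1) = sin t / 2 * n.+2%:R); last by field.
    rewrite -ler_pdivrMl ?divr_gt0// (@le_trans _ _ n%:R) ?ler_nat//; last by rewrite -addn2 leq_addr.
    near: n; exact: nbhs_infty_ger.
  rewrite ler_pM ?invr_ge0 ?(ltW st) ?mulr_ge0 ?invr_ge0//.
    by rewrite ler_peMl ?(ltW st)//; lra.
  by rewrite lef_pV2 ?posrE ?mulr_gt0 ?invr_gt0.
have cp : powmod al m (logw (r_ n) t) @[n --> \oo] --> powmod al m (logw1 t).
  apply: cvgM; first exact: cvg_cst.
  apply: continuous_cvg; first exact: continuous_expR.
  by apply: cvgM; [exact: cvg_cst|exact: ca].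
have cae (k : R) : k * argw (r_ n) t @[n --> \oo] --> k * (pi / 2).
  by apply: cvgM; [exact: cvg_cst|exact: ce].
have cS : shiftmod2 al m (logw (r_ n) t) (argw (r_ n) t) @[n --> \oo] -->
    shiftmod2 al m (logw1 t) (pi / 2).
  apply: cvgD.
    apply: cvgD; first exact: cvg_cst.
    apply: cvgM; first by apply: cvgM; [exact: cvg_cst|exact: cp].
    by apply: continuous_cvg; [exact: continuous_cos|exact: cae].
  by under eq_fun do rewrite expr2; rewrite expr2; apply: cvgM; exact: cp.
have cL : logmodG al th m (logw (r_ n) t) (argw (r_ n) t) @[n --> \oo] -->
    logmodG al th m (logw1 t) (pi / 2).
  apply: cvgB; first exact: ca.
  by apply: cvgM; [exact: cvg_cst|apply: lnc => //].
have p1 : 0 < powmod al m (logw1 t) by exact: powmod_gt0.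
have ct : cos (al * (pi / 2)) != 0.
  have /andP[a0 a1] := al01; rewrite gt_eqF// cos_gt0_pihalf//.
  by apply/andP; split; nra.
have cA : argG al th m (logw (r_ n) t) (argw (r_ n) t) @[n --> \oo] -->
    argG al th m (logw1 t) (pi / 2).
  apply: cvgB; first exact: ce.
  apply: cvgM; first exact: cvg_cst.
  apply: cvgD; first exact: cae.
  apply: continuous_cvg; first exact: continuous_atan.
  apply: cvgM; last by apply: continuous_cvg; [exact: continuous_tan|exact: cae].
  apply: cvgM; first by apply: cvgB; [exact: cp|exact: cvg_cst].
  apply: cvgV; first by rewrite gt_eqF// ltr_wpDr.
  by apply: cvgD; [exact: cp|exact: cvg_cst].
apply: cvgM.
  by apply: continuous_cvg; [exact: continuous_expR|exact: cL].
by apply: continuous_cvg; [exact: continuous_cos|exact: cA].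
Unshelve. all: by end_near. Qed.

Lemma integral_reG1 :
  (\int[lebesgue_measure]_(t in `]0%R, (pi : R)[) (reG1 t)%:E =
   (pi * (1 + m) `^ (- th))%:E)%E.
Proof.
have /andP[a0 a1] := al01; have p0 := pi_gt0 R.
(* The largest th' <= th with 2 al th' <= 1. As th' > 0, the exponent de = 1 - 2 al th' lies in [0,
   1[ and t^(- de) is integrable at 0. *)
pose th' := Num.min th (2 * al)^-1.
have i0 : 0 < (2 * al)^-1 by rewrite invr_gt0 mulr_gt0.
have t'0 : 0 < th' by rewrite /th' lt_min th0.
have t'1 : 0 <= th' <= th by rewrite (ltW t'0)/= /th' ge_min lexx.
have t'2 : 2 * al * th' <= 1.
  by rewrite -ler_pdivlMl ?mulr_gt0// mulr1 /th' ge_min lexx orbT.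
pose de := 1 - 2 * al * th'.
have de01 : 0 <= de < 1 by rewrite /de subr_ge0 t'2 gtrBl !mulr_gt0.
pose C := expR (- (th / 2) * ln (kap al) - th' * ln m) * 7 `^ de.
have C0 : 0 <= C by rewrite mulr_ge0 ?expR_ge0 ?powR_ge0.
have cr n : `|r_ n| < 1 by have /andP[? ?] := r_itv n; rewrite ger0_norm//; lra.
have mr n (D : set R) : measurable D -> measurable_fun D (fun t => (reG al th m (r_ n) t)%:E).
  move=> mD; apply/measurable_EFinP; apply: measurable_funTS.
  by apply: continuous_measurable_fun; exact: continuous_reG.
have bd (t : R) n : `]0, (pi : R)[%classic t -> `|reG al th m (r_ n) t| <= C * t `^ (- de).
  rewrite /= in_itv/= => /andP[tp0 tp1].
  apply: (le_trans (reG_le m0 al01 th0 (r_itv n) _ t'1 t'2)); first by rewrite tp0 ltW.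
  rewrite /C -[leRHS]mulrA ler_wpM2l ?expR_ge0// -/de.
  by rewrite /powR !gt_eqF// -expRD ler_expR ln_div ?posrE// mulrBr mulNr.
have mlim : measurable_fun `]0, (pi : R)[ (fun t => (reG1 t)%:E).
  apply: (emeasurable_fun_cvg (fun n t => (reG al th m (r_ n) t)%:E)).
  - by move=> n; exact: mr.
  - move=> t; rewrite /= in_itv/= => tp; apply/fine_cvgP; split; first exact: nearW.
    exact: reG_cvg.
have [] := @dominated_convergence _ _ _ lebesgue_measure `]0, (pi : R)[%classic (measurable_itv _)
  (fun n t => (reG al th m (r_ n) t)%:E) (fun t => (reG1 t)%:E) (EFin \o (fun t : R => C * t `^ (- de))).
- by move=> n; exact: mr.
- exact: mlim.
- apply: aeW => t; rewrite /= in_itv/= => tp; apply/fine_cvgP; split; first exact: nearW.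
  exact: reG_cvg.
- exact: integrable_powR_near0.
- by apply: aeW => t n tp; rewrite abse_EFin lee_fin bd.
move=> _ _ H; rewrite -(cvg_lim (@ereal_hausdorff R) H).
rewrite (_ : (fun n => _) = fun=> (pi * (1 + m) `^ (- th))%:E) ?lim_cst//.
apply/funext => n; have /andP[rn0 rn1] := r_itv n.
rewrite integral_itv_bndo_bndc; last exact: mr.
rewrite integral_itv_obnd_cbnd; last exact: mr.
rewrite -(circle_mean m0 al01 th0 (r := r_ n)); last by rewrite rn1 andbT; lra.
rewrite /Rintegral fineK//; apply: integrable_fin_num => //.
apply: continuous_compact_integrable; first exact: segment_compact.
by apply: continuous_subspaceT; exact: continuous_reG.
Qed.
End circle_limit2.

(** * The boundary values as a density on the half-line *)

Section slit_integral.
Context (R : realType) (al th : R).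
Hypotheses (al01 : 0 < al < 1) (th0 : 0 < th) (alth : al * th < 1).

(** Let zeta = x^al + e^(i pi al). The denominator is |zeta|^th and [Calpha al x] is arg zeta, so
    this is x^(al th - 1) / pi times the opposite of the imaginary part of zeta^(- th). *)
Definition stable_ratio_density (x : R) : R :=
  pi^-1 * (x `^ (al * th - 1) * sin (th * Calpha al x) /
  (x `^ (2 * al) + 2 * x `^ al * cos (pi * al) + 1) `^ (th / 2)).

Let pial : 0 < (pi : R) * al < pi.
Proof.
have /andP[a0 a1] := al01; have p0 := pi_gt0 R.
by rewrite mulr_gt0//= gtr_pMr.
Qed.

Lemma acot_lt_mono (x y : R) : x < y -> acot y < acot x.
Proof. by move=> xy; rewrite /acot ltrD2l ltrN2 lt_atan. Qed.

Lemma cot_acotE (x y : R) : 0 < y < pi -> cot y = x -> y = acot x.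
Proof.
move=> yp <-; have s0 := sin_gt0_pi yp; rewrite /acot /cot.
have yq : pi / 2 - y \in `](- (pi / 2)), (pi / 2)[ by rewrite in_itv/=; move: yp => /andP[? ?]; apply/andP; split; lra.
have H : tan (pi / 2 - y) = cos y / sin y.
  by rewrite /tan sinB cosB sin_pihalf cos_pihalf; congr (_ / _); ring.
by rewrite -H tanK//; ring.
Qed.

Lemma Calpha_itv (x : R) : 0 < x -> 0 < Calpha al x < pi * al.
Proof.
move=> x0; have s0 := sin_gt0_pi pial.
rewrite /Calpha (andP (acot_itv _)).1 /=.
rewrite [ltRHS](cot_acotE pial erefl); apply: acot_lt_mono.
by rewrite ltrDl divr_gt0 ?powR_gt0.
Qed.

(** This is where al th < 1 gives the sign of the density: th arg zeta < th pi al < pi. *)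
Lemma sin_Calpha_gt0 (x : R) : 0 < x -> 0 < sin (th * Calpha al x).
Proof.
move=> /Calpha_itv/andP[c0 c1]; apply: sin_gt0_pi; rewrite mulr_gt0//=.
rewrite (@lt_le_trans _ _ (th * (pi * al)))// ?ltr_pM2l//.
by rewrite mulrCA mulrC -[leRHS]mul1r ler_pM2r ?pi_gt0// mulrC ltW.
Qed.

(** The expression is |x^al + e^(i pi al)|^2, and the imaginary part sin(pi al) is nonzero. *)
Lemma stable_denom_gt0 (x : R) : 0 < x -> 0 < x `^ (2 * al) + 2 * x `^ al * cos (pi * al) + 1.
Proof.
move=> x0; have xa := powR_gt0 al x0; have s0 := sin_gt0_pi pial.
rewrite mulrC powRrM -[2]/(2%:R) powR_mulrn ?powR_ge0//.
rewrite (_ : _ + _ + 1 = (x `^ al + cos (pi * al)) ^+ 2 + sin (pi * al) ^+ 2).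
  by rewrite ltr_wpDl ?sqr_ge0// exprn_gt0.
have sE : sin (pi * al) ^+ 2 = 1 - cos (pi * al) ^+ 2 by rewrite -(cos2Dsin2 (pi * al)) addrC addKr.
by ring: sE.
Qed.

Lemma stable_ratio_density_gt0 (x : R) : 0 < x -> 0 < stable_ratio_density x.
Proof.
move=> x0; rewrite mulr_gt0 ?invr_gt0 ?pi_gt0// divr_gt0 ?mulr_gt0 ?powR_gt0//.
- exact: sin_Calpha_gt0.
- exact: stable_denom_gt0.
Qed.

(* z = w^2 = - r with r = 1 / (lam x), so that lam^al (- z)^al = x^(- al). *)
Lemma shiftargE (x : R) : 0 < x ->
  al * (pi / 2) + atan ((x `^ (- al) - 1) / (x `^ (- al) + 1) * tan (al * (pi / 2))) =
  Calpha al x.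
Proof.
move=> x0; have p0 := pi_gt0 R; have /andP[a0 a1] := al01.
have xa := powR_gt0 al x0; have s0 := sin_gt0_pi pial.
set y := al * (pi / 2); have y0 : 0 < y < pi / 2.
  by rewrite /y mulr_gt0 ?divr_gt0//= gtr_pMl// divr_gt0.
have sy : 0 < sin y by apply: sin_gt0_pihalf.
have cy : 0 < cos y by apply: cos_gt0_pihalf; have /andP[? ?] := y0; apply/andP; split; lra.
have ty : 0 < tan y by rewrite divr_gt0.
have pE : pi * al = y + y by rewrite /y; field.
rewrite powRN; set k := ((_ - 1) / _ * _).
have kE : k = (1 - x `^ al) / (1 + x `^ al) * tan y.
  by rewrite /k; field; rewrite !gt_eqF// ltr_wpDl// ltW.
have k1 : - tan y < k < tan y.
  have u1 : 0 < 1 + x `^ al by rewrite ltr_wpDl// ltW.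
  have /andP[ul ur] : - 1 < (1 - x `^ al) / (1 + x `^ al) < 1.
    by rewrite ltr_pdivlMr// ltr_pdivrMr//; apply/andP; split; lra.
  by rewrite kE gtr_pMl// ur andbT -mulN1r ltr_pM2r.
have yy : y \in `](- (pi / 2)), (pi / 2)[.
  by rewrite in_itv/=; have /andP[? ?] := y0; apply/andP; split; lra.
(* This places the sum of the two angles between 0 and 2 y = pi al < pi, where [cot] determines an
   angle. *)
have ak : - y < atan k < y.
  have /andP[/lt_atan k2 /lt_atan k3] := k1.
  by move: k2 k3; rewrite atanN !tanK// => -> ->.
apply: cot_acotE.
  by have /andP[? ?] := ak; have /andP[? ?] := y0; apply/andP; split; lra.
rewrite /cot pE sinD cosD.
have kk : atan k \in `](- (pi / 2)), (pi / 2)[ by rewrite in_itv/= atan_gtNpi2 atan_ltpi2.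
have ck : cos (atan k) != 0 by rewrite gt_eqF// cos_gt0_pihalf// atan_gtNpi2 atan_ltpi2.
have sk : sin (atan k) = k * cos (atan k) by rewrite -{2}[k]atanK /tan divfK.
rewrite !sinD !cosD sk; move: (cos (atan k)) ck => q q0; rewrite kE /tan.
have cE := cos2Dsin2 y.
move: (x `^ al) xa (cos y) (sin y) sy cy cE => v v0 c s s0' c0 cs.
have u1 : 1 + v != 0 by rewrite gt_eqF// ltr_wpDl// ltW.
have sE : s ^+ 2 = 1 - c ^+ 2 by rewrite -cs addrC addKr.
have E1 : s * q + c * ((1 - v) / (1 + v) * (s / c) * q) = 2 * s * q / (1 + v).
  by field; rewrite u1 gt_eqF.
have E2 : c * q - s * ((1 - v) / (1 + v) * (s / c) * q) = q * (c ^+ 2 - s ^+ 2 + v) / (c * (1 + v)).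
  by field: sE; rewrite u1 gt_eqF.
rewrite E1 E2; have sc : 0 < s * c + c * s by rewrite addr_gt0// mulr_gt0.
field: sE.
by rewrite u1 q0 (gt_eqF sc) (gt_eqF s0') (gt_eqF c0).
Qed.
End slit_integral.

Section slit_integral2.
Context (R : realType) (al th : R).
Hypotheses (al01 : 0 < al < 1) (th0 : 0 < th) (alth : al * th < 1).

Lemma powR_expR (x r : R) : 0 < x -> x `^ r = expR (r * ln x).
Proof. by move=> x0; rewrite /powR gt_eqF. Qed.

Lemma stable_ratio_density_derive (x : R) : 0 < x ->
  exists b, is_derive x 1 (stable_ratio_density al th) b.
Proof.
move=> x0; have D0 := stable_denom_gt0 al01 x0.
have [b1 db1] : exists b, is_derive x 1 (Calpha al) b.
  have e := is_derive1_sub (is_derive1_cst (pi / 2) x) (is_derive1_atanf (is_derive1_add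
    (is_derive1_cst (cot (pi * al)) x) (is_derive1_mul
      (is_derive1_powRf (f := fun y => y) al x0 (is_derive1_id x)) (is_derive1_cst (sin (pi * al))^-1 x)))).
  by eexists; exact: e.
have [b2 db2] : exists b, is_derive x 1 (fun x => x `^ (2 * al) + 2 * x `^ al * cos (pi * al) + 1) b.
  by eexists; repeat is_derive_step.
have D1 : (x `^ (2 * al) + 2 * x `^ al * cos (pi * al) + 1) `^ (th / 2) != 0 by rewrite gt_eqF// powR_gt0.
have e := is_derive1_mul (is_derive1_cst pi^-1 x) (is_derive1_mul (is_derive1_mul
  (is_derive1_powRf (f := fun y => y) (al * th - 1) x0 (is_derive1_id x))
  (is_derive1_sin (is_derive1_mul (is_derive1_cst th x) db1)))
  (is_derive1_inv (f := fun x => (x `^ (2 * al) + 2 * x `^ al * cos (pi * al) + 1) `^ (th / 2)) D1 (is_derive1_powRf (f := fun x => x `^ (2 * al) + 2 * x `^ al * cos (pi * al) + 1) (th / 2) D0 db2))).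
by eexists; exact: e.
Qed.

Let ct : cos (al * (pi / 2)) != 0 :> R.
Proof.
have /andP[a0 a1] := al01; have p0 := pi_gt0 R; rewrite gt_eqF// cos_gt0_pihalf//.
by apply/andP; split; nra.
Qed.

Variable lam : R.
Hypothesis lam0 : 0 < lam.

Let F (x : R) : R := 2 * atan ((lam * x) `^ 2^-1).
Let f (x : R) : R := lam * (lam * x) `^ (- 2^-1) / (1 + lam * x).

Let sqr_half (x : R) : 0 < x -> ((lam * x) `^ 2^-1) ^+ 2 = lam * x.
Proof.
by move=> x0; have lx := mulr_gt0 lam0 x0; rewrite powR12_sqrt ?(ltW lx)// sqr_sqrtr// ltW.
Qed.

Let dF (x : R) : 0 < x -> is_derive x 1 F (f x).
Proof.
move=> x0; have lx := mulr_gt0 lam0 x0; have l1 : 1 + lam * x != 0 by rewrite gt_eqF// ltr_wpDl// ltW.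
rewrite /F; is_derive_auto => //; rewrite /= sqr_half// /f.
rewrite (_ : 2^-1 - 1 = - 2^-1 :> R); last by field.
by field.
Qed.

Let cos_F (x : R) : 0 < x -> cos (F x) = (1 - lam * x) / (1 + lam * x).
Proof.
move=> x0; have lx := mulr_gt0 lam0 x0; have l1 : 0 < 1 + lam * x by rewrite ltr_wpDl// ltW.
rewrite /F mulr_natl mulr2n cosD -!expr2.
have sE (u : R) : sin u ^+ 2 = 1 - cos u ^+ 2 by rewrite -(cos2Dsin2 u) addrC addKr.
rewrite sE cos_atan sqr_half// exprVn sqr_sqrtr ?(ltW l1)//.
by field; rewrite gt_eqF.
Qed.

Let img : F @` `]0, +oo[ = `]0, pi[%classic.
Proof.
have p0 := pi_gt0 R.
apply/seteqP; split => y /=.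
  move=> [x]; rewrite in_itv/= andbT => x0 <-; rewrite in_itv/= /F.
  have lx : 0 < (lam * x) `^ 2^-1 by rewrite powR_gt0 ?mulr_gt0.
  have := lt_atan lx; rewrite atan0; have := atan_ltpi2 ((lam * x) `^ 2^-1).
  by move: (atan _) => z z1 z2; apply/andP; split; lra.
rewrite in_itv/= => /andP[y0 y1].
have t0 : 0 < tan (y / 2).
  by rewrite divr_gt0 ?sin_gt0_pihalf ?cos_gt0_pihalf//; apply/andP; split; lra.
exists (tan (y / 2) ^+ 2 / lam); first by rewrite in_itv/= andbT divr_gt0 ?exprn_gt0.
rewrite /F mulrCA divff ?gt_eqF// mulr1 powR12_sqrt ?sqr_ge0// sqrtr_sqr gtr0_norm//.
rewrite tanK; first by field.
by rewrite in_itv/=; apply/andP; split; lra.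
Qed.

(** On the boundary |w| = (lam x)^(-1/2), which times the Jacobian lam (lam x)^(-1/2) / (1 + lam x)
    is 1 / (x (1 + lam x)). The other factor of G is (1 + x^(- al) e^(i pi al))^(- th), free of lam,
    and cos(pi / 2 - th C) = sin(th C) for C = [Calpha al x]. *)
Let reG1_F (x : R) : 0 < x ->
  reG1 al th (lam `^ al) (F x) * f x = pi * ((1 + lam * x)^-1 * stable_ratio_density al th x).
Proof.
move=> x0; have lx := mulr_gt0 lam0 x0; have l1 : 0 < 1 + lam * x by rewrite ltr_wpDl// ltW.
have D0 := stable_denom_gt0 al01 x0; have p0 := pi_gt0 R.
have lw : logw1 (F x) = - (ln lam + ln x) / 2.
  rewrite /logw1 cos_F//; congr (_ / _).
  rewrite (_ : 2 + 2 * _ = 4 / (1 + lam * x)); last by field; rewrite gt_eqF.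
  rewrite (_ : 2 - 2 * _ = 4 * (lam * x) / (1 + lam * x)); last by field; rewrite gt_eqF.
  by rewrite !ln_div ?posrE ?mulr_gt0// lnM ?posrE// lnM ?posrE//; ring.
have pm : powmod al (lam `^ al) (- (ln lam + ln x) / 2) = x `^ (- al).
  by rewrite /powmod !powR_expR// -expRD; congr expR; field.
have sm : shiftmod2 al (lam `^ al) (- (ln lam + ln x) / 2) (pi / 2) =
    x `^ (- (2 * al)) * (x `^ (2 * al) + 2 * x `^ al * cos (pi * al) + 1).
  rewrite /shiftmod2 pm (_ : 2 * al * (pi / 2) = pi * al); last by field.
  have e0 : expR (al * ln x) != 0 by rewrite gt_eqF// expR_gt0.
  rewrite !powR_expR// (_ : 2 * al * ln x = al * ln x + al * ln x); last by ring.
  rewrite (_ : - (2 * al) * ln x = - (al * ln x + al * ln x)); last by ring.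
  rewrite mulNr !expRN expRD; move: (expR _) e0 => e e0.
  by field.
have pa : powmod al (lam `^ al) (- (ln lam + ln x) / 2) = x `^ (- al) by exact: pm.
rewrite /reG1 lw /argG /shiftarg pa shiftargE// -[pi / 2 - _]opprB cosN cosBpihalf.
rewrite /logmodG sm lnM ?posrE ?powR_gt0// ln_powR /f /stable_ratio_density.
rewrite (powR_expR (th / 2) D0).
rewrite (powR_expR _ lx) (powR_expR (al * th - 1) x0) lnM ?posrE//.
rewrite -{2}[lam](lnK lam0) ?posrE//.
(* All powers become exponentials of linear forms in ln lam, ln x and [D], so that only an identity
   between exponents remains. *)
set D := ln (x `^ (2 * al) + 2 * x `^ al * cos (pi * al) + 1); set s := sin _.
transitivity (expR (- (ln lam + ln x) / 2 - th / 2 * (- (2 * al) * ln x + D)) *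
   expR (ln lam) * expR (- 2^-1 * (ln lam + ln x)) * s / (1 + lam * x)); first by ring.
transitivity (expR ((al * th - 1) * ln x) * expR (- (th / 2 * D)) * s / (1 + lam * x)).
  by rewrite -!expRD; congr (expR _ * _ / _); field.
rewrite expRN [RHS]mulrCA mulVKf ?gt_eqF//.
move: (expR _) (expR _) => e1 e2; by ring.
Qed.

Lemma integral_stable_ratio_density :
  (\int[lebesgue_measure]_(x in `]0%R, +oo[)
     ((1 + lam * x)^-1 * stable_ratio_density al th x)%:E =
   ((1 + lam `^ al) `^ (- th))%:E)%E.
Proof.
have p0 := pi_gt0 R; have la0 : 0 < lam `^ al by rewrite powR_gt0.
have JF (t : R) : `]0, (pi : R)[%classic t -> exists2 x : R, 0 < x & F x = t.
  by rewrite -img => -[x]; rewrite /= in_itv/= andbT => x0 <-; exists x.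
have f0 (x : R) : 0 < x -> 0 < f x.
  move=> x0; have lx := mulr_gt0 lam0 x0.
  by rewrite divr_gt0 ?mulr_gt0 ?powR_gt0// ltr_wpDl// ltW.
have cf (x : R) : 0 < x -> {for x, continuous f}.
  move=> x0; have lx := mulr_gt0 lam0 x0; have [a da] : exists a, is_derive x 1 f a.
    eexists; rewrite /f; repeat is_derive_step => //.
    by rewrite gt_eqF// ltr_wpDl// ltW.
  exact: is_derive1_continuous da.
have h0 (x : R) : 0 < x -> 0 < (1 + lam * x)^-1 * stable_ratio_density al th x.
  move=> x0; have lx := mulr_gt0 lam0 x0.
  by rewrite mulr_gt0 ?invr_gt0 ?stable_ratio_density_gt0// ltr_wpDl// ltW.
(* The sign of the boundary values is read off after the substitution, through [reG1_F]. *)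
have G0 (t : R) : `]0, (pi : R)[%classic t -> 0 <= reG1 al th (lam `^ al) t.
  move=> /JF[x x0 <-]; rewrite -(pmulr_lge0 _ (f0 _ x0)) reG1_F// mulr_ge0 ?(ltW p0)//.
  by rewrite ltW// h0.
have cG (t : R) : `]0, (pi : R)[%classic t -> {for t, continuous (reG1 al th (lam `^ al))}.
  rewrite /= in_itv/= => tp.
  have tp' : - 1 < cos t < 1.
    move: tp => /andP[t0 t1]; rewrite -cospi -(@cos0 R).
    by rewrite !ltr_cos ?in_itv/= ?lexx ?pi_ge0 ?(ltW t0) ?(ltW t1)// t0 t1.
  have /andP[c1 c2] := tp'.
  have [a da] : exists a, is_derive t 1 (@logw1 R) a.
    eexists; rewrite /logw1; repeat is_derive_step; lra.
  have de : is_derive t 1 (fun _ : R => pi / 2 : R) 0 by exact: is_derive1_cst.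
  have d3 := is_derive_logmodG th la0 da de ct; have d4 := is_derive_argG th la0 da de ct.
  have [b db] : exists b, is_derive t 1 (reG1 al th (lam `^ al)) b.
    by eexists; rewrite /reG1; repeat is_derive_step.
  exact: is_derive1_continuous db.
have := integral_reG1 la0 al01 th0.
rewrite (ge0_substitution_0y dF f0 cf img cG G0).
have -> : (\int[lebesgue_measure]_(x in `]0%R, +oo[) (reG1 al th (lam `^ al) (F x) * f x)%:E)%E =
  (pi%:E * \int[lebesgue_measure]_(x in `]0%R, +oo[) ((1 + lam * x)^-1 * stable_ratio_density al th x)%:E)%E.
  rewrite -ge0_integralZl//.
  - apply: eq_integral => x; rewrite inE/= in_itv/= andbT => x0.
    by rewrite reG1_F// EFinM.
  - apply/measurable_EFinP; apply: open_continuous_measurable_fun; first exact: interval_open.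
    move=> x; rewrite inE/= in_itv/= andbT => x0.
    have lx := mulr_gt0 lam0 x0.
    have l1 : 1 + lam * x != 0 by rewrite gt_eqF// ltr_wpDl// ltW.
    have [b1 db1] := stable_ratio_density_derive x0.
    have [b db] : exists b, is_derive x 1 (fun x => (1 + lam * x)^-1 * stable_ratio_density al th x) b.
      by eexists; repeat is_derive_step.
    exact: is_derive1_continuous db.
  - by move=> x; rewrite /= in_itv/= andbT => x0; rewrite lee_fin ltW// h0.
  - by rewrite lee_fin ltW.
rewrite EFinM => H; have pi0 : pi != 0 :> R by rewrite gt_eqF.
have := congr1 (fun y => (pi^-1)%:E * y)%E H.
by rewrite !muleA -!EFinM mulVf// mul1e mul1r.
Qed.
End slit_integral2.

(** * Beta and gamma variables with parameters adding up to one *)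

Section fraction_substitution.
Context (R : realType).

Lemma continuous_measurable_fun_0y (f : R -> R) :
  (forall x : R, 0 < x -> {for x, continuous f}) -> measurable_fun (`]0, +oo[ : set R) f.
Proof.
move=> cf; apply: open_continuous_measurable_fun; first exact: interval_open.
by move=> x; rewrite inE/= in_itv/= andbT; exact: cf.
Qed.

Lemma continuous_measurable_fun_01 (f : R -> R) :
  (forall x : R, 0 < x < 1 -> {for x, continuous f}) -> measurable_fun (`]0, 1[ : set R) f.
Proof.
move=> cf; apply: open_continuous_measurable_fun; first exact: interval_open.
by move=> x; rewrite inE/= in_itv/=; exact: cf.
Qed.

(** [k] is free because several values are needed: 1 and (1 + s)^-1 for beta integrals, c^-1 for
    occupation times. *)
Lemma integral_frac_itv01 (k : R) (G : R -> R) : 0 < k ->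
  (forall y : R, 0 < y < 1 -> {for y, continuous G}) -> (forall y : R, 0 < y < 1 -> 0 <= G y) ->
  (\int[lebesgue_measure]_(y in `]0%R, 1%R[) (G y)%:E =
   \int[lebesgue_measure]_(x in `]0%R, +oo[) (G (x / (x + k)) * (k / (x + k) ^+ 2))%:E)%E.
Proof.
move=> k0 cG G0.
have xk (x : R) : 0 < x -> 0 < x + k by move=> x0; rewrite addr_gt0.
apply: (@ge0_substitution_0y R (fun x => x / (x + k)) (fun x => k / (x + k) ^+ 2)).
- move=> x x0; have xk0 : x + k != 0 by rewrite gt_eqF// xk.
  is_derive_auto => //.
  by rewrite /=; field.
- by move=> x x0; rewrite divr_gt0 ?exprn_gt0 ?xk.
- move=> x x0; have [b db] : exists b, is_derive x 1 (fun x : R => k / (x + k) ^+ 2) b.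
    by eexists; repeat is_derive_step; rewrite expf_neq0// gt_eqF// xk.
  exact: is_derive1_continuous db.
- apply/seteqP; split => y /=; rewrite !in_itv/=.
    move=> [x]; rewrite in_itv/= andbT => x0 <-; rewrite divr_gt0 ?xk//=.
    by rewrite ltr_pdivrMr ?xk// mul1r ltrDl.
  move=> /andP[y0 y1]; have y1' : 0 < 1 - y by rewrite subr_gt0.
  exists (k * y / (1 - y)); first by rewrite in_itv/= andbT divr_gt0 ?mulr_gt0.
  have : k * y / (1 - y) + k = k / (1 - y) by field; rewrite gt_eqF.
  by move=> ->; field; rewrite !gt_eqF.
- by move=> y; rewrite /= in_itv/=; exact: cG.
- by move=> y; rewrite /= in_itv/=; exact: G0.
Qed.

End fraction_substitution.

Section beta.
Context d (T : measurableType d) (R : realType) (P : probability T R).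

(** As the beta parameters add up to one, the powers of x + k contributed by the two factors and by
    the Jacobian collapse to (x + k)^-1. *)
Lemma powR_beta_frac (a k x : R) : 0 < k -> 0 < x ->
  (x / (x + k)) `^ (a - 1) * (1 - x / (x + k)) `^ (1 - a - 1) * (k / (x + k) ^+ 2) =
  k `^ (1 - a) * (x `^ (a - 1) * (x + k)^-1).
Proof.
move=> k0 x0; have xk : 0 < x + k by rewrite addr_gt0.
have -> : 1 - x / (x + k) = k / (x + k) by field; rewrite gt_eqF.
rewrite !powRM ?ltW ?invr_gt0// -[(x + k)^-1]powR_inv1 ?ltW// -!powRrM.
have -> : k / (x + k) ^+ 2 = k `^ 1 * (x + k) `^ (- 2).
  by rewrite powRr1 ?ltW// powRN -powR_mulrn ?ltW.
have E b : x `^ (a - 1) * (x + k) `^ (-1 * (a - 1)) * (k `^ (1 - a - 1) * (x + k) `^ (-1 * (1 - a - 1))) * (k `^ 1 * b) =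
  x `^ (a - 1) * (k `^ (1 - a - 1) * k `^ 1) * ((x + k) `^ (-1 * (a - 1)) * (x + k) `^ (-1 * (1 - a - 1)) * b) by ring.
rewrite E -!powRD; last 3 first.
- by rewrite ?(gt_eqF xk) ?(gt_eqF k0) implybT.
- by rewrite ?(gt_eqF xk) ?(gt_eqF k0) implybT.
- by rewrite ?(gt_eqF xk) ?(gt_eqF k0) implybT.
rewrite (_ : -1 * (a - 1) + -1 * (1 - a - 1) + - 2 = -1); last by ring.
rewrite (_ : 1 - a - 1 + 1 = 1 - a); last by ring.
by ring.
Qed.

(** [Beta_fun] is never evaluated. The substitution with k = 1 turns the transform into the integral
    of C x^(a-1) / (1 + (1 + s) x), and the substitution with k = (1 + s)^-1 turns the total mass
    into (1 + s)^a times the same integral. *)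
Lemma beta_stieltjes (a s : R) (B : T -> R) : 0 < a < 1 -> 0 <= s ->
  measurable_fun setT B -> is_beta P a (1 - a) B ->
  (\int[P]_w ((1 + s * B w)^-1)%:E = ((1 + s) `^ (- a))%:E)%E.
Proof.
move=> a01 s0 mB Bf; have /andP[a0 a1] := a01.
have L0 : 0 < 1 + s by rewrite ltr_wpDr.
set C := (Beta_fun a (1 - a))^-1.
have B1 := has_density_preimage mB Bf (measurable_itv _).
(* The sign of the constant is read off from the nonnegativity of the density at 1 / 2. *)
have C0 : 0 <= C.
  have [_ /(_ (2^-1)) + _] := Bf; rewrite /= in_itv/= invr_gt0 invf_lt1//.
  rewrite ltr0n ltr1n/= => /(_ isT); rewrite pmulr_rge0//.
  by rewrite mulr_gt0 ?powR_gt0// ?invr_gt0// subr_gt0 invf_lt1// ltr1n.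
have cont (r : R) : 0 <= r -> forall y : R, 0 < y < 1 -> {for y, continuous (fun y : R =>
    (1 + r * y)^-1 * (y `^ (a - 1) * (1 - y) `^ (1 - a - 1) * C))}.
  move=> r0 y /andP[y0 y1].
  have [b db] : exists b, is_derive y 1 (fun y : R => (1 + r * y)^-1 * (y `^ (a - 1) * (1 - y) `^ (1 - a - 1) * C)) b.
    eexists; repeat is_derive_step => //; last by rewrite subr_gt0.
    by rewrite gt_eqF// ltr_wpDr// mulr_ge0// ltW.
  exact: is_derive1_continuous db.
have pos (r : R) : 0 <= r -> forall y : R, 0 < y < 1 -> 0 <= (1 + r * y)^-1 * (y `^ (a - 1) * (1 - y) `^ (1 - a - 1) * C).
  move=> r0 y /andP[y0 y1]; rewrite mulr_ge0 ?invr_ge0//.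
    by rewrite addr_ge0// mulr_ge0// ltW.
  by rewrite mulr_ge0// mulr_ge0 ?powR_ge0.
have E (r : R) : 0 <= r -> (\int[P]_w ((1 + r * B w)^-1)%:E =
    \int[lebesgue_measure]_(x in `]0%R, 1%R[) ((1 + r * x)^-1 * (x `^ (a - 1) * (1 - x) `^ (1 - a - 1) * C))%:E)%E.
  move=> r0; rewrite (has_density_expectation mB Bf (measurable_itv _) (g := fun x => (1 + r * x)^-1))//.
    by apply: measurable_fun_invr; apply: measurable_funD => //; apply: measurable_funM.
  move=> x; rewrite /= in_itv/= => /andP[x0 _].
  by rewrite invr_ge0 addr_ge0// mulr_ge0// ltW.
have one : (\int[lebesgue_measure]_(x in `]0%R, +oo[) (C * (x `^ (a - 1) * (1 + (1 + s) * x)^-1))%:E = ((1 + s) `^ (- a))%:E)%E.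
  have := E 0 (lexx _); under eq_integral do rewrite mul0r addr0 invr1.
  have -> : (\int[P]__ 1 = 1)%E by rewrite integral_cst// mul1e; exact: probability_setT.
  rewrite (@integral_frac_itv01 R (1 + s)^-1) ?invr_gt0//; last 2 first.
  - exact: cont.
  - exact: pos.
  move=> H; have := congr1 (fun z => ((1 + s) `^ (- a))%:E * z)%E H.
  rewrite mule1 => ->; rewrite -ge0_integralZl//; last 3 first.
  - apply/measurable_EFinP; apply: continuous_measurable_fun_0y => x x0.
    have xk : 0 < x + (1 + s)^-1 by rewrite addr_gt0// invr_gt0.
    have [b db] : exists b, is_derive x 1 (fun x => (1 + 0 * (x / (x + (1 + s)^-1)))^-1 *
      ((x / (x + (1 + s)^-1)) `^ (a - 1) * (1 - x / (x + (1 + s)^-1)) `^ (1 - a - 1) * C) *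
      ((1 + s)^-1 / (x + (1 + s)^-1) ^+ 2)) b.
      eexists; repeat is_derive_step.
      - by rewrite mul0r addr0 oner_neq0.
      - by rewrite gt_eqF.
      - by rewrite divr_gt0.
      - by rewrite gt_eqF.
      - by rewrite subr_gt0 ltr_pdivrMr// mul1r ltrDl invr_gt0.
      - by rewrite gt_eqF.
      - by rewrite gt_eqF// exprn_gt0.
    exact: is_derive1_continuous db.
  - move=> x; rewrite /= in_itv/= andbT => x0; have k0 : 0 <= (1 + s)^-1 by rewrite invr_ge0 ltW.
    have xk : 0 <= x + (1 + s)^-1 by rewrite addr_ge0// ltW.
    rewrite lee_fin mul0r addr0 invr1 mul1r; apply: mulr_ge0; apply: mulr_ge0 => //.
      by rewrite mulr_ge0 ?powR_ge0.
    by rewrite invr_ge0 exprn_ge0.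
  - by rewrite lee_fin powR_ge0.
  apply: eq_integral => x; rewrite inE/= in_itv/= andbT => x0.
  rewrite -EFinM; congr EFin; rewrite mul0r addr0 invr1 mul1r.
  rewrite mulrAC powR_beta_frac ?invr_gt0//.
  have -> : (1 + s)^-1 `^ (1 - a) = (1 + s)^-1 * (1 + s) `^ a.
    rewrite -powR_inv1 ?ltW// -powRrM -powRD; last by rewrite (gt_eqF L0) implybT.
    by congr (_ `^ _); ring.
  rewrite powRN.
  have := powR_gt0 a L0; move: ((1 + s) `^ a) (x `^ (a - 1)) => u v u0.
  have e1 : 1 + (1 + s) * x != 0 by rewrite gt_eqF// ltr_wpDl// mulr_gt0.
  have -> : x + (1 + s)^-1 = (1 + (1 + s) * x) / (1 + s) by field; rewrite gt_eqF.
  move: (1 + (1 + s) * x) (1 + s) e1 L0 => D L e1 L0; field.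
  by rewrite e1 (gt_eqF u0) (gt_eqF L0).
rewrite E// (@integral_frac_itv01 R 1)//; last 2 first.
- exact: cont.
- exact: pos.
rewrite -one; apply: eq_integral => x; rewrite inE/= in_itv/= andbT => x0.
congr EFin.
transitivity ((1 + s * (x / (x + 1)))^-1 * C *
  ((x / (x + 1)) `^ (a - 1) * (1 - x / (x + 1)) `^ (1 - a - 1) * (1 / (x + 1) ^+ 2))); first by ring.
have e1 : 1 + (1 + s) * x != 0 by rewrite gt_eqF// ltr_wpDl// mulr_gt0.
have e2 : x + 1 != 0 by rewrite gt_eqF// addr_gt0.
have -> : 1 + s * (x / (x + 1)) = (1 + (1 + s) * x) / (x + 1) by field.
rewrite powR_beta_frac// powR1; move: (1 + (1 + s) * x) (x + 1) e1 e2 => D E1 e1 e2.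
by field; rewrite e1 e2.
Qed.
End beta.

Section tonelli.
Context d1 d2 (T1 : measurableType d1) (T2 : measurableType d2) (R : realType).
Variables (m1 : {sigma_finite_measure set T1 -> \bar R}) (m2 : {sigma_finite_measure set T2 -> \bar R}).
Variables (D : set T1) (E : set T2) (f : T1 -> T2 -> R).
Hypotheses (mD : measurable D) (mE : measurable E).
Hypothesis mf : measurable_fun setT (fun z : T1 * T2 => f z.1 z.2).
Hypothesis f0 : forall x y, D x -> E y -> 0 <= f x y.

Let h : T1 * T2 -> \bar R := (fun z : T1 * T2 => (f z.1 z.2)%:E) \_ (D `*` E).

Let mh : measurable_fun setT h.
Proof.
apply/(measurable_restrictT _ (measurableX mD mE)); apply: measurable_funTS.
exact/measurable_EFinP.
Qed.

Let h0 z : (0 <= h z)%E.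
Proof.
by rewrite /h patchE; case: ifPn => //; rewrite inE => -[? ?]; rewrite lee_fin f0.
Qed.

Let hF x : (\int[m2]_y h (x, y) = ((fun x => \int[m2]_(y in E) (f x y)%:E) \_ D) x)%E.
Proof.
rewrite patchE; case: ifPn => xD.
  rewrite [RHS]integral_mkcond; apply: eq_integral => y _.
  rewrite /h !patchE; congr (if _ then _ else _).
  by rewrite in_setX xD.
transitivity (0 : \bar R)%E => //; apply: integral0_eq => y _; rewrite /h patchE in_setX (negbTE xD)//.
Qed.

Let hG y : (\int[m1]_x h (x, y) = ((fun y => \int[m1]_(x in D) (f x y)%:E) \_ E) y)%E.
Proof.
rewrite patchE; case: ifPn => yE.
  rewrite [RHS]integral_mkcond; apply: eq_integral => x _.
  rewrite /h !patchE; congr (if _ then _ else _).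
  by rewrite in_setX yE andbT.
transitivity (0 : \bar R)%E => //; apply: integral0_eq => x _; rewrite /h patchE in_setX (negbTE yE) andbF//.
Qed.

(** Nonnegativity is available on the rectangle only, so the integrand is extended by zero before
    Tonelli applies. *)
Lemma tonelli_on : (\int[m1]_(x in D) \int[m2]_(y in E) (f x y)%:E =
  \int[m2]_(y in E) \int[m1]_(x in D) (f x y)%:E)%E.
Proof.
rewrite integral_mkcond [RHS]integral_mkcond.
under eq_integral do rewrite -hF.
under [RHS]eq_integral do rewrite -hG.
by rewrite -(@fubini_tonelli1 _ _ _ _ R m1 m2 h mh h0) -(@fubini_tonelli2 _ _ _ _ R m1 m2 h mh h0).
Qed.

Lemma measurable_tonelli_on : measurable_fun D (fun x => \int[m2]_(y in E) (f x y)%:E)%E.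
Proof.
apply/(measurable_restrictT _ mD); rewrite -(funext hF).
exact: (@measurable_fun_fubini_tonelli_F _ _ _ _ R m2 h mh h0).
Qed.
End tonelli.

Section half_line.
Context (R : realType).

Lemma integral_scale_0y (k : R) (G : R -> R) : 0 < k ->
  (forall y : R, 0 < y -> {for y, continuous G}) -> (forall y : R, 0 < y -> 0 <= G y) ->
  (\int[lebesgue_measure]_(y in `]0%R, +oo[) (G y)%:E =
   \int[lebesgue_measure]_(x in `]0%R, +oo[) (G (k * x) * k)%:E)%E.
Proof.
move=> k0 cG G0.
apply: (@ge0_substitution_0y R (fun x => k * x) (fun=> k)) => //.
- by move=> x x0; is_derive_auto; rewrite mul0r add0r mulr1.
- by move=> x x0; exact: cst_continuous.
- apply/seteqP; split => y /=; rewrite !in_itv/= !andbT.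
    by move=> [x]; rewrite in_itv/= andbT => x0 <-; rewrite mulr_gt0.
  move=> y0; exists (y / k); first by rewrite in_itv/= andbT divr_gt0.
  by field; rewrite gt_eqF.
- by move=> y; rewrite /= in_itv/= andbT; exact: cG.
- by move=> y; rewrite /= in_itv/= andbT; exact: G0.
Qed.

Lemma integral_expR_0y (a : R) : 0 < a ->
  (\int[lebesgue_measure]_(x in `]0%R, +oo[) (expR (- (a * x)))%:E = (a^-1)%:E)%E.
Proof.
move=> a0.
have dF (x : R) : is_derive x 1 (fun x : R => - (a^-1 * expR (- (a * x)))) (expR (- (a * x))).
  by is_derive_auto; rewrite /=; field; rewrite gt_eqF.
have cf : continuous (fun x : R => expR (- (a * x))).
  move=> x; have [b db] : exists b, is_derive x 1 (fun x : R => expR (- (a * x))) b.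
    by eexists; repeat is_derive_step.
  exact: is_derive1_continuous db.
rewrite integral_itv_obnd_cbnd; last first.
  by apply: measurable_funTS; apply/measurable_EFinP; exact: continuous_measurable_fun.
rewrite (@ge0_continuous_FTC2y R _ (fun x => - (a^-1 * expR (- (a * x)))) 0 0)//.
- by rewrite mulr0 oppr0 expR0 mulr1 -EFinN opprK add0e.
- exact: continuous_subspaceT.
- rewrite -oppr0; apply: cvgN; rewrite -(mulr0 a^-1); apply: cvgMr.
  apply: (@cvg_comp _ _ _ (fun x => a * x) (fun x => expR (- x)) _ (pinfty_nbhs R)).
    exact: gt0_cvgMry.
  exact: cvgr_expR.
- by apply: cvg_at_right_filter; exact: is_derive1_continuous (dF 0).
- by move=> x _; rewrite (is_derive1E (dF x)).
Qed.


(** Scaling x by 1 + s. The hypothesis is the case s = 0, so [C] needs no closed form. *)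
Lemma integral_powR_stieltjes (C a s : R) : 0 <= C -> 0 <= s ->
  (\int[lebesgue_measure]_(x in `]0%R, +oo[) (C * (x `^ (a - 1) * (1 + x)^-1))%:E = 1)%E ->
  (\int[lebesgue_measure]_(x in `]0%R, +oo[) (C * (x `^ (a - 1) * (1 + (1 + s) * x)^-1))%:E =
   ((1 + s) `^ (- a))%:E)%E.
Proof.
move=> C0 s0; have L0 : 0 < 1 + s by rewrite ltr_wpDr.
rewrite (integral_scale_0y L0); last 2 first.
- move=> x x0; have [b db] : exists b, is_derive x 1 (fun x => C * (x `^ (a - 1) * (1 + x)^-1)) b.
    by eexists; repeat is_derive_step => //; rewrite gt_eqF// addr_gt0.
  exact: is_derive1_continuous db.
- by move=> x x0; rewrite mulr_ge0// mulr_ge0 ?powR_ge0// invr_ge0 addr_ge0// ltW.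
move=> H; have := congr1 (fun z => ((1 + s) `^ (- a))%:E * z)%E H.
rewrite mule1 => <-; rewrite -ge0_integralZl//; last 3 first.
- apply/measurable_EFinP; apply: continuous_measurable_fun_0y => x x0.
  have [b db] : exists b, is_derive x 1 (fun x => C * (((1 + s) * x) `^ (a - 1) * (1 + (1 + s) * x)^-1) * (1 + s)) b.
    eexists; repeat is_derive_step => //; first by rewrite mulr_gt0.
    by rewrite gt_eqF// addr_gt0// mulr_gt0.
  exact: is_derive1_continuous db.
- move=> x; rewrite /= in_itv/= andbT => x0; have lx := mulr_gt0 L0 x0.
  rewrite lee_fin mulr_ge0 ?(ltW L0)// mulr_ge0// mulr_ge0 ?powR_ge0// invr_ge0 addr_ge0//.
  exact: ltW.
- by rewrite lee_fin powR_ge0.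
apply: eq_integral => x; rewrite inE/= in_itv/= andbT => x0.
rewrite -EFinM; congr EFin; rewrite powRM ?(ltW L0) ?(ltW x0)//.
have -> : (1 + s) `^ (- a) = (1 + s) `^ (- (a - 1)) * (1 + s)^-1.
  rewrite -(powR_inv1 (ltW L0)) -powRD; last by rewrite (gt_eqF L0) implybT.
  by congr (_ `^ _); ring.
rewrite powRN; have := powR_gt0 (a - 1) L0; move: (_ `^ _) => u u0.
by rewrite mulrC; move: ((_ + _ * _)^-1) => w; field; rewrite (gt_eqF u0) (gt_eqF L0).
Qed.
End half_line.

Section measurability.
Context d (T : measurableType d) (R : realType) (D : set T) (f : T -> R).
Hypothesis mf : measurable_fun D f.

Lemma measurable_fun_norm : measurable_fun D (fun x => `|f x|).
Proof. by apply: measurableT_comp mf; exact: normr_measurable. Qed.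

Lemma measurable_fun_powR a : measurable_fun D (fun x => f x `^ a).
Proof. by apply: (measurableT_comp (f := fun x : R => x `^ a)) mf; exact: measurable_powR. Qed.

Lemma measurable_fun_expR : measurable_fun D (fun x => expR (f x)).
Proof. by apply: measurableT_comp mf; exact: measurable_expR. Qed.

Lemma measurable_fun_lnr : measurable_fun D (fun x => ln (f x)).
Proof. by apply: measurableT_comp mf; exact: measurable_ln. Qed.
End measurability.

Ltac measurability := repeat first
  [ eassumption | exact: measurable_cst | exact: measurable_id
  | exact: measurable_fst | exact: measurable_snd
  | apply: measurable_funM | apply: measurable_funD | apply: measurable_funN
  | apply: measurable_fun_invr | apply: measurable_fun_powR | apply: measurable_fun_expR
  | apply: measurable_fun_lnr | apply: measurable_fun_norm ].

Section gamma.
Context d (T : measurableType d) (R : realType) (P : probability T R).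

Lemma probability_setI1 (A B : set T) : measurable A -> measurable B ->
  P A = 1%E -> P B = 1%E -> P (A `&` B) = 1%E.
Proof.
move=> mA mB PA PB; have B0 : P (~` B) = 0%E.
  by apply: etrans (probability_setC P mB) _; rewrite PB subee.
have D0 : P (A `\` B) = 0%E.
  apply/eqP; rewrite -measure_le0 -B0 le_measure ?inE//; first exact: measurableD.
  exact: measurableC.
rewrite -PA; apply/esym; apply: (etrans (measureDI P mA mB)).
by apply: (etrans (congr1 (fun z => z + P (A `&` B))%E D0)); rewrite add0e.
Qed.

Variables (th : R) (G G' : T -> R).
Hypotheses (th01 : 0 < th < 1) (mG : measurable_fun setT G) (mG' : measurable_fun setT G').
Hypotheses (Gg : is_gamma P th G) (Gg' : is_gamma P (1 - th) G') (GG' : indep P G G').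

Let C := (gamma_fun th)^-1.
Let C' := (gamma_fun (1 - th))^-1.

Let gamma_cst_ge0 (a : R) (Y : T -> R) : is_gamma P a Y -> 0 <= (gamma_fun a)^-1.
Proof.
move=> [_ /(_ 1) + _]; rewrite /= in_itv/= ltr01 => /(_ isT).
by rewrite pmulr_rge0// mulr_gt0 ?powR_gt0// expR_gt0.
Qed.

Let C0 : 0 <= C. Proof. exact: gamma_cst_ge0 Gg. Qed.
Let C'0 : 0 <= C'. Proof. exact: gamma_cst_ge0 Gg'. Qed.

Let mI : measurable (`]0, +oo[%classic : set R). Proof. exact: measurable_itv. Qed.

(** The absolute value makes the kernel nonnegative on the whole plane, as integration against the
    joint law demands; it is inactive for x, y > 0. *)
Let ratio (s x y : R) : R := `|(1 + s * (x / (x + y)))^-1|.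
Let dens (x : R) : R := x `^ (th - 1) * expR (- x) * C.
Let dens' (y : R) : R := y `^ (1 - th - 1) * expR (- y) * C'.
Let joint (s y u : R) : R :=
  C * C' * (u `^ (th - 1) * ((1 + u) * (1 + (1 + s) * u)^-1)) * expR (- ((1 + u) * y)).

Let d0 x : 0 <= dens x.
Proof. by apply: mulr_ge0 C0; apply: mulr_ge0; [exact: powR_ge0|exact: expR_ge0]. Qed.

Let d'0 y : 0 <= dens' y.
Proof. by apply: mulr_ge0 C'0; apply: mulr_ge0; [exact: powR_ge0|exact: expR_ge0]. Qed.

Let ratioE (s x y : R) : 0 <= s -> 0 < x -> 0 < y -> ratio s x y = (1 + s * (x / (x + y)))^-1.
Proof.
move=> s0 x0 y0; rewrite /ratio ger0_norm// invr_ge0 addr_ge0// mulr_ge0// divr_ge0 ?ltW//.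
by rewrite addr_gt0.
Qed.

Let measurable_ratio s : measurable_fun setT (fun z : measurableTypeR R * measurableTypeR R => ratio s z.2 z.1).
Proof. by rewrite /ratio; measurability. Qed.

Let inner (s y : R) : 0 <= s -> 0 < y ->
  ((\int[lebesgue_measure]_(x in `]0%R, +oo[) (ratio s x y * dens x)%:E) * (dens' y)%:E =
   \int[lebesgue_measure]_(u in `]0%R, +oo[) (joint s y u)%:E)%E.
Proof.
move=> s0 y0.
rewrite -ge0_integralZr//; last 3 first.
- apply/measurable_EFinP; apply: measurable_funTS; apply: measurable_funM.
    exact: (measurableT_comp (measurable_ratio s) (measurable_pair1 _)).
  by rewrite /dens; measurability.
- by move=> x _; rewrite lee_fin mulr_ge0 ?normr_ge0.
- rewrite lee_fin; exact: d'0.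
pose q x := (1 + s * (x / (x + y)))^-1 * dens x * dens' y.
transitivity (\int[lebesgue_measure]_(x in `]0%R, +oo[) (q x)%:E)%E.
  by apply: eq_integral => x; rewrite inE/= in_itv/= andbT => x0; rewrite -EFinM ratioE.
rewrite (@integral_scale_0y R y q y0); last 2 first.
- move=> x x0; have xy : 0 < x + y by rewrite addr_gt0.
  have e1 : 0 < 1 + s * (x / (x + y)) by rewrite ltr_pwDl// mulr_ge0// divr_ge0// ?(ltW x0)// (ltW xy).
  have [b db] : exists b, is_derive x 1 q b.
    by eexists; rewrite /q /dens; repeat is_derive_step => //; rewrite gt_eqF.
  exact: is_derive1_continuous db.
- by move=> x x0; apply: mulr_ge0 (d'0 y); apply: mulr_ge0 (d0 x); rewrite -ratioE// normr_ge0.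
apply: eq_integral => u; rewrite inE/= in_itv/= andbT => u0; congr EFin.
have u1 : 0 < 1 + u by rewrite addr_gt0.
have e1 : 0 < 1 + (1 + s) * u by rewrite ltr_pwDl// mulr_ge0 ?(ltW u0)// addr_ge0.
have -> : q (y * u) = (1 + s * (y * u / (y * u + y)))^-1 * dens (y * u) * dens' y by [].
have -> : (1 + s * (y * u / (y * u + y)))^-1 = (1 + u) * (1 + (1 + s) * u)^-1.
  have -> : y * u / (y * u + y) = u / (1 + u).
    have -> : y * u + y = y * (1 + u) by ring.
    by move: (1 + u) u1 => v v1; field; rewrite !gt_eqF.
  have -> : 1 + s * (u / (1 + u)) = (1 + (1 + s) * u) / (1 + u).
    by field; rewrite gt_eqF.
  by rewrite invf_div.
rewrite /joint /dens /dens' powRM ?ltW// (_ : 1 - th - 1 = - th); last by ring.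
have -> : - ((1 + u) * y) = - (y * u) + - y by ring.
have -> : y `^ (th - 1) = y `^ th * y^-1.
  by rewrite -(powR_inv1 (ltW y0)) -powRD// (gt_eqF y0) implybT.
rewrite powRN expRD; have := powR_gt0 th y0.
move: (y `^ th) (1 + (1 + s) * u) e1 => v D e1 v0; field.
by rewrite !gt_eqF.
Qed.

(** After x = y u the powers of y cancel, the shapes adding up to one, and only exp(- (1 + u) y)
    depends on y. Exchanging the integrals and integrating y out leaves a factor 1 / (1 + u), which
    cancels the 1 + u of the kernel. *)
Lemma gamma_ratio_integral (s : R) : 0 <= s ->
  (\int[P]_w ((1 + s * (G w / (G w + G' w)))^-1)%:E =
   \int[lebesgue_measure]_(u in `]0%R, +oo[) (C * C' * (u `^ (th - 1) * (1 + (1 + s) * u)^-1))%:E)%E.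
Proof.
move=> s0.
have pG := has_density_preimage mG Gg mI; have pG' := has_density_preimage mG' Gg' mI.
pose k (y : R) := (\int[lebesgue_measure]_(x in `]0%R, +oo[) (ratio s x y * dens x)%:E)%E.
have mk : measurable_fun setT k.
  apply: (@measurable_tonelli_on _ _ (measurableTypeR R) (measurableTypeR R) R
    lebesgue_measure setT _ (fun y x => ratio s x y * dens x)) => //.
  - by apply: measurable_funM => //; rewrite /dens; measurability.
  - by move=> x y _ _; rewrite mulr_ge0 ?normr_ge0.
transitivity (\int[P]_w (ratio s (G w) (G' w))%:E)%E.
  apply: (integral_ae_full (A := G @^-1` `]0, +oo[ `&` G' @^-1` `]0, +oo[)).
  - by apply: measurableI; exact: measurable_preimage.
  - by apply: probability_setI1 => //; exact: measurable_preimage.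
  - by apply/measurable_EFinP; measurability.
  - by apply/measurable_EFinP; rewrite /ratio; measurability.
  - by move=> w [/=]; rewrite !in_itv/= !andbT => g0 g'0; rewrite ratioE.
rewrite (@indep_integral_cond _ _ _ P G' G mG' mG `]0, +oo[ (fun z => (ratio s z.2 z.1)%:E) k)//.
- rewrite (has_density_integral mG' Gg' mI mk); last first.
    by move=> y; apply: integral_ge0 => x _; rewrite lee_fin mulr_ge0 ?normr_ge0.
  transitivity (\int[lebesgue_measure]_(y in `]0%R, +oo[) \int[lebesgue_measure]_(u in `]0%R, +oo[) (joint s y u)%:E)%E.
    by apply: eq_integral => y; rewrite inE/= in_itv/= andbT => y0; exact: inner.
  have j0 (u : R) : 0 < u -> 0 <= C * C' * (u `^ (th - 1) * ((1 + u) * (1 + (1 + s) * u)^-1)).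
    move=> u0; rewrite mulr_ge0 ?(mulr_ge0 C0)// mulr_ge0 ?powR_ge0// divr_ge0//.
      by rewrite addr_ge0// ltW.
    by rewrite addr_ge0// mulr_ge0 ?(ltW u0)// addr_ge0.
  rewrite (@tonelli_on _ _ (measurableTypeR R) (measurableTypeR R) R
    lebesgue_measure lebesgue_measure _ _ (joint s))//.
  + apply: eq_integral => u; rewrite inE/= in_itv/= andbT => u0; rewrite /joint.
    have u1 : 0 < 1 + u by rewrite addr_gt0.
    under eq_integral do rewrite EFinM.
    rewrite ge0_integralZl//.
    * rewrite (integral_expR_0y u1) -EFinM; congr EFin.
      move: (1 + u) ((1 + (1 + s) * u)^-1) u1 => v e v0; field.
      by rewrite gt_eqF.
    * by apply: measurable_funTS; apply/measurable_EFinP; measurability.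
    * by rewrite lee_fin j0.
  + by rewrite /joint; measurability.
  + by move=> y u _; rewrite /= in_itv/= andbT => u0; rewrite mulr_ge0 ?expR_ge0// j0.
- exact: indepC.
- by apply/measurable_EFinP.
- by move=> z; rewrite lee_fin normr_ge0.
- move=> y _; rewrite (has_density_expectation mG Gg mI (g := fun x => ratio s x y))//.
    by rewrite /ratio; measurability.
  by move=> x _; exact: normr_ge0.
Qed.

(** The case s = 0 normalises the product of the two gamma constants; the result is the transform of
    a beta variable. *)
Lemma gamma_ratio_stieltjes (s : R) : 0 <= s ->
  (\int[P]_w ((1 + s * (G w / (G w + G' w)))^-1)%:E = ((1 + s) `^ (- th))%:E)%E.
Proof.
move=> s0; rewrite gamma_ratio_integral// integral_powR_stieltjes ?mulr_ge0//.
have := gamma_ratio_integral (lexx 0).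
under eq_integral do rewrite mul0r addr0 invr1.
have -> : (\int[P]__ 1 = 1)%E by rewrite integral_cst// mul1e; exact: probability_setT.
by move=> ->; apply: eq_integral => x _; rewrite addr0 mul1r.
Qed.
End gamma.

Section law_tools.
Context d (T : measurableType d) (R : realType) (P : probability T R).

Lemma expectationE (F : T -> R) : ('E_P[F] = \int[P]_w (F w)%:E)%E.
Proof. by rewrite unlock. Qed.

Lemma probability_sub1 (A B : set T) : measurable A -> measurable B ->
  P A = 1%E -> A `<=` B -> P B = 1%E.
Proof.
move=> mA mB PA AB; apply/eqP; rewrite eq_le probability_le1//=.
by rewrite -PA le_measure ?inE.
Qed.

Lemma integral_full (A : set T) (F : T -> \bar R) : measurable A -> P A = 1%E ->
  measurable_fun setT F -> (\int[P]_(w in A) F w = \int[P]_w F w)%E.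
Proof.
move=> mA PA mF; rewrite integral_mkcond; apply: (integral_ae_full mA PA) => //.
  by apply/(measurable_restrictT _ mA); exact: measurable_funTS.
by move=> w Aw; rewrite patchE mem_set.
Qed.
End law_tools.

(** * The ratio of stable variables: transform and logarithmic moment *)

Section laplace_derivative.
Context d (T : measurableType d) (R : realType) (P : probability T R) (al : R) (S : T -> R).
Hypotheses (mS : measurable_fun setT S) (HS : is_pos_stable P al S).

Let B : set T := S @^-1` `]0, +oo[.
Let mB : measurable B. Proof. by apply: measurable_preimage. Qed.
Let PB : P B = 1%E. Proof. by have [] := HS. Qed.
Let Bp w : B w -> 0 < S w. Proof. by rewrite /B/= in_itv/= andbT. Qed.

Lemma laplace_integral (t : R) : 0 < t ->
  (\int[P]_w (expR (- (t * S w)))%:E = (expR (- (t `^ al)))%:E)%E.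
Proof. by move=> t0; have [_ /(_ _ t0)] := HS; rewrite expectationE. Qed.

Let mul_expRN_le1 (u : R) : u * expR (- u) <= 1.
Proof.
rewrite expRN ler_pdivrMr ?expR_gt0// mul1r (le_trans _ (expR_ge1Dx u))//.
by rewrite lerDr.
Qed.

Let moment_bound (t : R) w : 0 < t -> B w -> `|S w * expR (- (t * S w))| <= t^-1.
Proof.
move=> t0 /Bp s0; rewrite ger0_norm ?mulr_ge0 ?expR_ge0 ?(ltW s0)//.
rewrite -[leRHS]mul1r ler_pdivlMr// mulrC mulrA; exact: mul_expRN_le1.
Qed.

Let integrable_moment (t : R) : 0 < t ->
  P.-integrable B (EFin \o (fun w => S w * expR (- (t * S w)))).
Proof.
move=> t0; apply: measurable_bounded_integrable => //.
- by apply: (le_lt_trans (probability_le1 P mB)); exact: ltry.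
- by apply: measurable_funTS; measurability.
- exists t^-1; split; first exact: num_real.
  by move=> M M1 w Bw; apply: (le_trans (moment_bound t0 Bw)); exact: ltW.
Qed.

Let integrable_laplace (t : R) : 0 < t ->
  P.-integrable B (EFin \o (fun w => expR (- (t * S w)))).
Proof.
move=> t0; apply: measurable_bounded_integrable => //.
- by apply: (le_lt_trans (probability_le1 P mB)); exact: ltry.
- by apply: measurable_funTS; measurability.
- exists 1; split; first exact: num_real.
  move=> M M1 w Bw; rewrite /= ger0_norm ?expR_ge0// (le_trans _ (ltW M1))//.
  by rewrite -[leRHS]expR0 ler_expR oppr_le0 mulr_ge0 ?(ltW t0)// ltW// Bp.
Qed.

(** Differentiation of the Laplace transform under the expectation, dominated by u exp(- u) <= 1.
    The absolute value is inactive almost surely and makes the integrand nonnegative everywhere. *)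
Lemma laplace_moment (t : R) : 0 < t ->
  (\int[P]_w (`|S w * expR (- (t * S w))|)%:E =
   (al * t `^ (al - 1) * expR (- (t `^ al)))%:E)%E.
Proof.
move=> t0; have dE (u x : R) : is_derive u 1 (fun u : R => expR (- (u * x))) (- 1 * (x * expR (- (u * x)))).
  by is_derive_auto; rewrite /=; ring.
have Ia : `]t / 2, t * 2[%classic t by rewrite /= in_itv/=; apply/andP; split; lra.
have Ip u : `]t / 2, t * 2[%classic u -> 0 < u by rewrite /= in_itv/= => /andP[+ _]; lra.
have key : derive1 (fun t => \int[P]_(w in B) expR (- (t * S w))) t =
    - 1 * \int[P]_(w in B) (S w * expR (- (t * S w))).
  rewrite (@differentiation_under_integral _ _ _ P
    (fun (t : R) w => expR (- (t * S w))) _ _ t (t / 2) (t * 2) _ _ _ (cst (t / 2)^-1))//.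
  - rewrite -RintegralZl//; last exact: integrable_moment.
    by apply: eq_Rintegral => w _; rewrite partial1of2E (@derive_val _ _ _ _ _ _ _ (dE t (S w))).
  - by move=> u /Ip u0; exact: integrable_laplace.
  - by move=> w /=; rewrite invr_ge0; lra.
  - apply: measurable_bounded_integrable => //.
    + by apply: (le_lt_trans (probability_le1 P mB)); exact: ltry.
    + exists (t / 2)^-1; split; first exact: num_real.
      by move=> M M1 w _ /=; rewrite ger0_norm ?(ltW M1)// invr_ge0; lra.
  - move=> u w Iu Bw; have u0 := Ip _ Iu.
    rewrite partial1of2E (@derive_val _ _ _ _ _ _ _ (dE u (S w))) mulN1r normrN.
    rewrite (le_trans (moment_bound u0 Bw))//= lef_pV2 ?posrE//; last lra.
    by move: Iu; rewrite /= in_itv/= => /andP[/ltW].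
have dR : is_derive t 1 (fun t : R => expR (- (t `^ al))) (- (al * t `^ (al - 1) * expR (- (t `^ al)))).
  by is_derive_auto => //; rewrite /=; ring.
have key2 : derive1 (fun t => \int[P]_(w in B) expR (- (t * S w))) t =
    - (al * t `^ (al - 1) * expR (- (t `^ al))).
  rewrite -(is_derive1E dR) !derive1E; apply: near_eq_derive.
  near=> u; have u0 : 0 < u by near: u; apply: open_nbhs_nbhs; split; [exact: open_gt|].
  rewrite /Rintegral integral_full//; last by apply/measurable_EFinP; measurability.
  by rewrite laplace_integral.
rewrite -(integral_full mB PB); last by apply/measurable_EFinP; measurability.
have -> : (\int[P]_(w in B) (`|S w * expR (- (t * S w))|)%:E =
    (\int[P]_(w in B) (S w * expR (- (t * S w))))%R%:E)%E.
  rewrite /Rintegral fineK; last exact: integrable_fin_num (integrable_moment t0).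
  apply: eq_integral => w; rewrite inE => /Bp s0.
  by rewrite ger0_norm// mulr_ge0 ?expR_ge0// ltW.
by congr EFin; move: key; rewrite key2 mulN1r => /oppr_inj.
Unshelve. all: by end_near.
Qed.
End laplace_derivative.

Section stable_ratio.
Context d (T : measurableType d) (R : realType) (P : probability T R) (al : R) (S S' X : T -> R).
Hypotheses (al01 : 0 < al < 1).
Hypotheses (mS : measurable_fun setT S) (mS' : measurable_fun setT S') (mX : measurable_fun setT X).
Hypotheses (HS : is_pos_stable P al S) (HS' : is_pos_stable P al S') (SS' : indep P S S').
Hypothesis XE : eq_law P X (fun w => S w / S' w).

Let A : set T := S @^-1` `]0, +oo[ `&` S' @^-1` `]0, +oo[.
Let mA : measurable A. Proof. by apply: measurableI; exact: measurable_preimage. Qed.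
Let PA : P A = 1%E.
Proof. by apply: probability_setI1; [exact: measurable_preimage|exact: measurable_preimage|case: HS|case: HS']. Qed.
Let Ap w : A w -> 0 < S w /\ 0 < S' w.
Proof. by move=> [/=]; rewrite !in_itv/= !andbT. Qed.
Let mq : measurable_fun setT (fun w => S w / S' w). Proof. by measurability. Qed.

Lemma stable_ratio_gt0 : P (X @^-1` `]0, +oo[) = 1%E.
Proof.
rewrite XE//; apply: probability_sub1 PA _ => //; first exact: measurable_preimage.
by move=> w /Ap[s0 s'0]; rewrite /= in_itv/= andbT divr_gt0.
Qed.

Let laplace_pair (lam t : R) : 0 < lam -> 0 < t ->
  (\int[P]_(w in A) (S' w * expR (- ((S' w + lam * S w) * t)))%:E =
   (expR (- ((1 + lam `^ al) * t `^ al)) * (al * t `^ (al - 1)))%:E)%E.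
Proof.
move=> lam0 t0; rewrite integral_full//; last by apply/measurable_EFinP; measurability.
pose g (z : measurableTypeR R * measurableTypeR R) : \bar R :=
  (`|z.1 * expR (- (t * z.1))| * expR (- (lam * t * z.2)))%:E.
pose k (y : R) : \bar R := (`|y * expR (- (t * y))| * expR (- ((lam * t) `^ al)))%:E.
have mk : measurable_fun setT k by apply/measurable_EFinP; rewrite /k; measurability.
transitivity (\int[P]_w g (S' w, S w))%E.
  apply: (integral_ae_full mA PA).
  - by apply/measurable_EFinP; measurability.
  - by apply/measurable_EFinP; rewrite /=; measurability.
  - move=> w /Ap[s0 s'0]; rewrite /g/= ger0_norm ?mulr_ge0 ?expR_ge0 ?(ltW s'0)//.
    have -> : - ((S' w + lam * S w) * t) = - (t * S' w) + - (lam * t * S w) by ring.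
    by rewrite expRD mulrA.
rewrite (@indep_integral_cond _ _ _ P S' S mS' mS setT g k)//.
- have c0 : 0 <= expR (- ((lam * t) `^ al)) by exact: expR_ge0.
  rewrite /k; under eq_integral do rewrite EFinM.
  rewrite ge0_integralZr//.
  + rewrite (laplace_moment mS' HS' t0) -EFinM; congr EFin.
    rewrite powRM ?ltW// mulrDl mul1r opprD expRD; ring.
  + by apply/measurable_EFinP; measurability.
- exact: indepC.
- exact: probability_setT.
- by apply/measurable_EFinP; rewrite /g; measurability.
- by move=> z; rewrite lee_fin mulr_ge0 ?expR_ge0.
- move=> y _; rewrite /g/=; under eq_integral do rewrite EFinM.
  rewrite ge0_integralZl//.
  + by rewrite (laplace_integral HS) ?mulr_gt0// -EFinM.
  + by apply/measurable_EFinP; measurability.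
Qed.

(** (1 + lam S / S')^-1 is the integral over t > 0 of S' exp(- (S' + lam S) t). By independence its
    expectation at t is the product in [laplace_pair], the derivative of an exponential in t^al, and
    the substitution of t^al finishes. *)
Lemma stable_ratio_stieltjes (lam : R) : 0 < lam ->
  (\int[P]_w ((1 + lam * X w)^-1)%:E = ((1 + lam `^ al)^-1)%:E)%E.
Proof.
move=> lam0; have /andP[al0 al1] := al01.
have m1 : measurable_fun setT (fun x : R => (`|(1 + lam * x)^-1|)%:E).
  by apply/measurable_EFinP; measurability.
transitivity (\int[P]_w (`|(1 + lam * X w)^-1|)%:E)%E.
  apply: (integral_ae_full (A := X @^-1` `]0, +oo[)).
  - exact: measurable_preimage.
  - exact: stable_ratio_gt0.
  - by apply/measurable_EFinP; measurability.
  - by apply/measurable_EFinP; measurability.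
  - move=> w; rewrite /= in_itv/= andbT => x0.
    by rewrite ger0_norm// invr_ge0 addr_ge0// mulr_ge0// ltW.
rewrite (eq_law_integral (g := fun x : R => (`|(1 + lam * x)^-1|)%:E) mX mq XE m1)//.
rewrite -(integral_full mA PA); last by apply/measurable_EFinP; measurability.
transitivity (\int[P]_(w in A) \int[lebesgue_measure]_(t in `]0%R, +oo[)
    (S' w * expR (- ((S' w + lam * S w) * t)))%:E)%E.
  apply: eq_integral => w; rewrite inE => /Ap[s0 s'0].
  have e0 : 0 < S' w + lam * S w by rewrite addr_gt0// mulr_gt0.
  under [RHS]eq_integral do rewrite EFinM.
  rewrite ge0_integralZl//.
  - rewrite (integral_expR_0y e0) -EFinM; congr EFin.
    rewrite ger0_norm; last by rewrite invr_ge0 addr_ge0// mulr_ge0 ?divr_ge0// ltW.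
    have -> : 1 + lam * (S w / S' w) = (S' w + lam * S w) / S' w by field; rewrite gt_eqF.
    by rewrite invf_div.
  - by apply: measurable_funTS; apply/measurable_EFinP; measurability.
  - by rewrite lee_fin ltW.
rewrite (@tonelli_on _ _ T (measurableTypeR R) R P lebesgue_measure A _
  (fun w t => S' w * expR (- ((S' w + lam * S w) * t))))//.
- transitivity (\int[lebesgue_measure]_(t in `]0%R, +oo[)
      (expR (- ((1 + lam `^ al) * t `^ al)) * (al * t `^ (al - 1)))%:E)%E.
    by apply: eq_integral => t; rewrite inE/= in_itv/= andbT => t0; exact: laplace_pair.
  have e0 : 0 < 1 + lam `^ al by rewrite ltr_wpDr// powR_ge0.
  rewrite -(integral_expR_0y e0); apply/esym.
  apply: (@ge0_substitution_0y R (fun t => t `^ al) (fun t => al * t `^ (al - 1))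
    (fun u => expR (- ((1 + lam `^ al) * u)))).
  + by move=> t t0; rewrite mulr_gt0 ?powR_gt0.
  + move=> t t0; have [b db] : exists b, is_derive t 1 (fun t : R => al * t `^ (al - 1)) b.
      by eexists; repeat is_derive_step.
    exact: is_derive1_continuous db.
  + apply/seteqP; split => y /=; rewrite !in_itv/= !andbT.
      by move=> [x]; rewrite in_itv/= andbT => x0 <-; rewrite powR_gt0.
    move=> y0; exists (y `^ al^-1); first by rewrite in_itv/= andbT powR_gt0.
    by rewrite -powRrM mulVf ?gt_eqF// powRr1// ltW.
  + move=> t _; have [b db] : exists b, is_derive t 1 (fun u : R => expR (- ((1 + lam `^ al) * u))) b.
      by eexists; repeat is_derive_step.
    exact: is_derive1_continuous db.
  + by move=> t _; rewrite expR_ge0.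
- have q1 : measurable_fun setT (fun z : T * measurableTypeR R => S z.1) by exact: (measurableT_comp mS measurable_fst).
  have q2 : measurable_fun setT (fun z : T * measurableTypeR R => S' z.1) by exact: (measurableT_comp mS' measurable_fst).
  by measurability.
- by move=> w t /Ap[s0 s'0] _; rewrite mulr_ge0 ?expR_ge0// ltW.
Qed.
End stable_ratio.

Section log_integral.
Context (R : realType).

(** An antiderivative is - al^-1 ln(1 + m (1 + x)^(- al)). The exponent 1 serves to represent a
    logarithm, the general exponent to recognise the averaged integral. *)
Lemma integral_log_kernel (al m : R) : 0 < al -> 0 <= m ->
  (\int[lebesgue_measure]_(x in `]0%R, +oo[)
    (m * (1 + x) `^ (- al - 1) / (1 + m * (1 + x) `^ (- al)))%:E = (al^-1 * ln (1 + m))%:E)%E.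
Proof.
move=> al0 m0; pose f (x : R) := m * (1 + x) `^ (- al - 1) / (1 + m * (1 + x) `^ (- al)).
have x1 (x : R) : 0 <= x -> 0 < 1 + x by move=> x0; rewrite ltr_pwDl.
have e1 (x : R) : 0 < 1 + m * (1 + x) `^ (- al) by rewrite ltr_pwDl// mulr_ge0// powR_ge0.
have dF (x : R) : 0 <= x -> is_derive x 1 (fun x : R => - (al^-1 * ln (1 + m * (1 + x) `^ (- al)))) (f x).
  move=> /x1 x0; have {}e1 := e1 x; is_derive_auto => //; rewrite /f /=.
  move: (_ `^ (- al - 1)) (1 + m * (1 + x) `^ (- al)) e1 => u D D0; field.
  by rewrite !gt_eqF.
have cf (x : R) : 0 <= x -> {for x, continuous f}.
  move=> /x1 x0; have e2 : 1 + m * (1 + x) `^ (- al) != 0 by rewrite gt_eqF.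
  have [b db] : exists b, is_derive x 1 f b by eexists; rewrite /f; repeat is_derive_step.
  exact: is_derive1_continuous db.
rewrite integral_itv_obnd_cbnd; last first.
  apply/measurable_EFinP; apply: continuous_measurable_fun_0y => x x0; exact: cf (ltW x0).
rewrite (@ge0_continuous_FTC2y R f (fun x => - (al^-1 * ln (1 + m * (1 + x) `^ (- al)))) 0 0).
- by rewrite addr0 powR1 mulr1 EFinN oppeK add0e.
- by move=> x x0; rewrite /f divr_ge0 ?(ltW (e1 x))// mulr_ge0// powR_ge0.
- apply: continuous_in_subspaceT => x; rewrite inE/= in_itv/= andbT; exact: cf.
- have -> : 0 = - (al^-1 * ln (1 + m * 0)) :> R by rewrite mulr0 addr0 ln1 mulr0 oppr0.
  apply: cvgN; apply: cvgMr; apply: (@continuous_cvg _ _ _ _ _ _ (@ln R)).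
    by rewrite mulr0 addr0; exact: continuous_ln.
  apply: cvgD; first exact: cvg_cst.
  apply: cvgMr.
  have E : {near +oo%R, (fun x : R => expR (- (al * ln (1 + x)))) =1 (fun x : R => (1 + x) `^ (- al))}.
    near=> x; have x0 : 0 <= x by near: x; exact: nbhs_pinfty_ge.
    by rewrite powR_expR ?x1// mulNr.
  apply: cvg_trans (near_eq_cvg E) _.
  apply: (@cvg_comp _ _ _ (fun x => al * ln (1 + x)) (fun x => expR (- x)) _ (pinfty_nbhs R)); last exact: cvgr_expR.
  apply/cvgryPge => K; near=> x.
  have x0 : expR (al^-1 * K) <= x by near: x; exact: nbhs_pinfty_ge.
  rewrite -ler_pdivrMl// -[leLHS]expRK ler_ln ?posrE ?expR_gt0//.
    by rewrite (le_trans x0)// lerDr.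
  by rewrite x1// (le_trans _ x0)// expR_ge0.
- by move=> x x0; have [] := dF x (ltW x0).
- by apply: cvg_at_right_filter; exact: is_derive1_continuous (dF 0 (lexx 0)).
- by move=> x; rewrite in_itv/= andbT => x0; rewrite (is_derive1E (dF x (ltW x0))).
Unshelve. all: by end_near.
Qed.

(** The logarithm as a superposition of Stieltjes kernels with parameters lam / (1 + t), so that a
    known transform yields logarithmic moments. *)
Lemma ln1p_integral (lam x : R) : 0 <= lam -> 0 <= x ->
  (\int[lebesgue_measure]_(t in `]0%R, +oo[)
     ((1 + t)^-1 * (1 - (1 + lam / (1 + t) * x)^-1))%:E = (ln (1 + lam * x))%:E)%E.
Proof.
move=> l0 x0; have lx : 0 <= lam * x by rewrite mulr_ge0.
have := integral_log_kernel ltr01 lx; rewrite invr1 mul1r => <-.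
apply: eq_integral => t; rewrite inE/= in_itv/= andbT => t0.
have t1 : 0 < 1 + t by rewrite addr_gt0.
rewrite (powR_inv1 (ltW t1)) (_ : - 1 - 1 = - 2%:R); last by rewrite -opprD.
rewrite powRN powR_mulrn ?(ltW t1)//; congr EFin.
have e1 : 0 < 1 + t + lam * x by rewrite ltr_wpDr.
have -> : 1 + lam / (1 + t) * x = (1 + t + lam * x) / (1 + t) by field; rewrite gt_eqF.
have -> : 1 + lam * x * (1 + t)^-1 = (1 + t + lam * x) / (1 + t) by field; rewrite gt_eqF.
rewrite !invf_div; move: (1 + t) t1 e1 => v v0 e1.
by field; rewrite !gt_eqF.
Qed.
End log_integral.

Section log_moment.
Context d (T : measurableType d) (R : realType) (P : probability T R) (al : R) (X : T -> R).
Hypotheses (al0 : 0 < al) (mX : measurable_fun setT X) (X0 : P (X @^-1` `[0, +oo[) = 1%E).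
Hypothesis HX : forall lam : R, 0 < lam ->
  (\int[P]_w ((1 + lam * X w)^-1)%:E = ((1 + lam `^ al)^-1)%:E)%E.

Let B : set T := X @^-1` `[0, +oo[.
Let mB : measurable B. Proof. exact: measurable_preimage. Qed.
Let Bp w : B w -> 0 <= X w. Proof. by rewrite /B/= in_itv/= andbT. Qed.

Let complement (lam : R) : 0 < lam ->
  (\int[P]_(w in B) (1 - (1 + lam * X w)^-1)%:E = (1 - (1 + lam `^ al)^-1)%:E)%E.
Proof.
move=> l0.
have H : (\int[P]_(w in B) (1 - (1 + lam * X w)^-1)%:E + ((1 + lam `^ al)^-1)%:E = 1)%E.
  rewrite -(HX l0) -(integral_full mB X0); last by apply/measurable_EFinP; measurability.
  rewrite -ge0_integralD//.
  - under eq_integral do rewrite -EFinD subrK.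
    by rewrite integral_cst// mul1e; exact: X0.
  - move=> w /Bp x0; have /andP[_] := stieltjes_kernel01 (ltW l0) x0.
    by rewrite lee_fin subr_ge0.
  - by apply: measurable_funTS; apply/measurable_EFinP; measurability.
  - by move=> w /Bp x0; have /andP[] := stieltjes_kernel01 (ltW l0) x0.
  - by apply: measurable_funTS; apply/measurable_EFinP; measurability.
by rewrite EFinB -H addeK.
Qed.

(** Averaging [ln1p_integral] replaces lam x / (1 + t) in the kernel by (lam / (1 + t))^al; what
    results is the kernel of [integral_log_kernel] with exponent [al] and m = lam^al. *)
Lemma log_moment (lam : R) : 0 < lam ->
  (\int[P]_w (ln (1 + lam * X w))%:E = (al^-1 * ln (1 + lam `^ al))%:E)%E.
Proof.
move=> l0; rewrite -(integral_full mB X0); last by apply/measurable_EFinP; measurability.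
transitivity (\int[P]_(w in B) \int[lebesgue_measure]_(t in `]0%R, +oo[)
    ((1 + t)^-1 * (1 - (1 + lam / (1 + t) * X w)^-1))%:E)%E.
  by apply: eq_integral => w; rewrite inE => /Bp x0; rewrite ln1p_integral// ltW.
have t1 (t : R) : 0 < t -> 0 < 1 + t by move=> t0; rewrite addr_gt0.
have k0 (t x : R) : 0 < t -> 0 <= x -> 0 <= 1 - (1 + lam / (1 + t) * x)^-1.
  move=> t0 x0; have lt0 : 0 <= lam / (1 + t) by rewrite divr_ge0 ?ltW ?t1.
  by have /andP[_] := stieltjes_kernel01 lt0 x0; rewrite subr_ge0.
rewrite (@tonelli_on _ _ T (measurableTypeR R) R P lebesgue_measure B _
  (fun w t => (1 + t)^-1 * (1 - (1 + lam / (1 + t) * X w)^-1)))//.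
- rewrite -(integral_log_kernel al0 (powR_ge0 lam al)).
  apply: eq_integral => t; rewrite inE/= in_itv/= andbT => t0; have {}t1 := t1 _ t0.
  under eq_integral do rewrite EFinM.
  rewrite ge0_integralZl//.
  + rewrite complement ?divr_gt0// -EFinM; congr EFin.
    rewrite powRM ?invr_ge0 ?ltW// -(powR_inv1 (ltW t1)) -powRrM mulN1r.
    have -> : (1 + t) `^ (- al - 1) = (1 + t) `^ (- al) * (1 + t) `^ (- 1).
      by rewrite -powRD// (gt_eqF t1) implybT.
    have e1 : 0 < 1 + lam `^ al * (1 + t) `^ (- al) by rewrite ltr_pwDl// mulr_ge0// powR_ge0.
    move: (lam `^ al) (_ `^ (- al)) (_ `^ (- 1)) e1 => a b e e1.
    by field; rewrite gt_eqF.
  + by apply: measurable_funTS; apply/measurable_EFinP; measurability.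
  + by move=> w /Bp x0; rewrite lee_fin k0.
  + by rewrite lee_fin invr_ge0 ltW.
- have q1 : measurable_fun setT (fun z : T * measurableTypeR R => X z.1) by exact: (measurableT_comp mX measurable_fst).
  by measurability.
- by move=> w t /Bp x0; rewrite /= in_itv/= andbT => t0; rewrite mulr_ge0 ?invr_ge0 ?(ltW (t1 _ t0))// k0.
Qed.
End log_moment.

(** * Dirichlet means and beta products *)

Section mixture.
Context d (T : measurableType d) (R : realType) (P : probability T R).

Import HBNNSimple.

(** [is_dirichlet_mean] integrates against a bare set function; its values on measurable sets
    suffice, so it may be exchanged for a genuine measure. *)
Lemma eq_integral_setfun d' (T' : measurableType d') (m1 m2 : set T' -> \bar R) (D : set T')
    (f : T' -> \bar R) : (forall U, measurable U -> m1 U = m2 U) ->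
  (\int[m1]_(x in D) f x = \int[m2]_(x in D) f x)%E.
Proof.
move=> m12; have E (h : T' -> \bar R) :
    ereal_sup [set sintegral m1 h' | h' in [set h' : {nnsfun T' >-> R} | forall x, ((h' x)%:E <= h x)%E]] =
    ereal_sup [set sintegral m2 h' | h' in [set h' : {nnsfun T' >-> R} | forall x, ((h' x)%:E <= h x)%E]].
  congr ereal_sup; apply: eq_imagel => h' _.
  by rewrite /sintegral; apply: eq_fsbigr => r _; rewrite m12//; exact: measurable_sfunP.
by rewrite /integral; congr (_ - _)%E; exact: E.
Qed.

(** The atom at 0 contributes nothing as g 0 = 0, which for g = ln(1 + lam x) means that mixing with
    it just multiplies the logarithmic moment by r. *)
Lemma integral_mix0 (r : R) (H : set R -> \bar R) (Y : T -> R) (mY : measurable_fun setT Y) (g : R -> R) :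
  0 <= r <= 1 -> (forall U, measurable U -> H U = P (Y @^-1` U)) ->
  P (Y @^-1` `[0, +oo[) = 1%E -> measurable_fun setT g -> (forall x, 0 <= x -> 0 <= g x) -> g 0 = 0 ->
  (\int[mix0 r H]_(x in `[0%R, +oo[) (g x)%:E = r%:E * \int[P]_w (g (Y w))%:E)%E.
Proof.
move=> /andP[r0 r1] HY Y0 mg g0 g00; have r1' : 0 <= 1 - r by rewrite subr_ge0.
pose Y' : {mfun T >-> R} := HB.pack Y (isMeasurableFun.Build _ _ T R Y mY).
pose m2 := measure_add (mscale (NngNum r0) (distribution P Y')) (mscale (NngNum r1') (\d_(0 : R))).
rewrite (@eq_integral_setfun _ R (mix0 r H) m2); last first.
  by move=> U mU; rewrite /mix0 HY// /m2 measure_addE.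
have mg' (D : set R) : measurable_fun D (fun x => (g x)%:E).
  by apply: measurable_funTS; exact/measurable_EFinP.
have g0' (x : R) : `[0, +oo[%classic x -> (0 <= (g x)%:E)%E.
  by rewrite /= in_itv/= andbT lee_fin; exact: g0.
have mI : measurable (`[0, +oo[%classic : set R) by exact: measurable_itv.
rewrite /m2 ge0_integral_measure_add// !ge0_integral_mscale//.
rewrite integral_dirac// g00 mule0 mule0 adde0; congr (_ * _)%E.
rewrite /distribution ge0_integral_pushforward//; last by move=> x; rewrite inE; exact: g0'.
transitivity (\int[P]_(w in Y @^-1` `[0%R, +oo[) (g (Y w))%:E)%E; first by [].
apply: integral_full => //; first exact: measurable_preimage.
by apply/measurable_EFinP; apply: (measurableT_comp mg mY).
Qed.

Lemma integral_law_ln (H : set R -> \bar R) (Y : T -> R) (mY : measurable_fun setT Y) (lam : R) :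
  (forall U, measurable U -> H U = P (Y @^-1` U)) -> 0 < lam ->
  P (Y @^-1` `[0, +oo[) = 1%E ->
  (\int[H]_(x in `[0%R, +oo[) (ln (1 + lam * x))%:E = \int[P]_w (ln (1 + lam * Y w))%:E)%E.
Proof.
move=> HY l0 Y0; rewrite -[RHS]mul1e -(@integral_mix0 1 H Y mY (fun x => ln (1 + lam * x)))//.
- by apply: eq_integral_setfun => U mU; rewrite /mix0 mul1e subrr mul0e adde0.
- by rewrite ler01 lexx.
- by measurability.
- by move=> x x0; rewrite ln_ge0// lerDl mulr_ge0// ltW.
- by rewrite mulr0 addr0 ln1.
Qed.

Lemma integral_mix0_ln (r : R) (H : set R -> \bar R) (Y : T -> R) (mY : measurable_fun setT Y) (lam : R) :
  0 <= r <= 1 -> (forall U, measurable U -> H U = P (Y @^-1` U)) -> 0 < lam ->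
  P (Y @^-1` `[0, +oo[) = 1%E ->
  (\int[mix0 r H]_(x in `[0%R, +oo[) (ln (1 + lam * x))%:E =
   r%:E * \int[P]_w (ln (1 + lam * Y w))%:E)%E.
Proof.
move=> r01 HY l0 Y0; apply: (@integral_mix0 r H Y mY (fun x => ln (1 + lam * x))) => //.
- by measurability.
- by move=> x x0; rewrite ln_ge0// lerDl mulr_ge0// ltW.
- by rewrite mulr0 addr0 ln1.
Qed.

Lemma dirichlet_mean_transform (tau : R) (H : set R -> \bar R) (M : T -> R) (lam L : R) :
  is_dirichlet_mean P tau H M -> 0 < lam ->
  (\int[H]_(x in `[0%R, +oo[) (ln (1 + lam * x))%:E = L%:E)%E ->
  (\int[P]_w ((1 + lam * M w) `^ (- tau))%:E = (expR (- (tau * L)))%:E)%E.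
Proof. by move=> [_ /(_ lam) +] l0 HL => /(_ l0); rewrite expectationE HL. Qed.

Lemma dirichlet_mean1_stieltjes (H : set R -> \bar R) (M : T -> R) (mM : measurable_fun setT M) (lam L : R) :
  is_dirichlet_mean P 1 H M -> 0 < lam ->
  (\int[H]_(x in `[0%R, +oo[) (ln (1 + lam * x))%:E = L%:E)%E ->
  (\int[P]_w ((1 + lam * M w)^-1)%:E = (expR (- L))%:E)%E.
Proof.
move=> HM l0 HL; have := dirichlet_mean_transform HM l0 HL; rewrite mul1r => <-.
apply: (integral_ae_full (A := M @^-1` `[0, +oo[)).
- exact: measurable_preimage.
- by case: HM.
- by apply/measurable_EFinP; measurability.
- by apply/measurable_EFinP; measurability.
- move=> w; rewrite /= in_itv/= andbT => M0.
  by rewrite powR_inv1// addr_ge0// mulr_ge0// ltW.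
Qed.
End mixture.

Section transforms.
Context d (T : measurableType d) (R : realType) (P : probability T R).

(** Given V = v, [beta_stieltjes] applies with s v. Multiplying by an independent beta variable thus
    lowers the order of a transform from a to one, which is how masses and means of order alpha
    theta become comparable with means of order one. *)
Lemma beta_mul_stieltjes (a s : R) (B V : T -> R) (mB : measurable_fun setT B) (mV : measurable_fun setT V) :
  0 < a < 1 -> 0 <= s -> is_beta P a (1 - a) B -> indep P B V ->
  P (V @^-1` `[0, +oo[) = 1%E ->
  (\int[P]_w ((1 + s * (B w * V w))^-1)%:E = \int[P]_w ((1 + s * V w) `^ (- a))%:E)%E.
Proof.
move=> a01 s0 HB BV V0; have B1 := has_density_preimage mB HB (measurable_itv _).
pose g (z : measurableTypeR R * measurableTypeR R) : \bar R := (`|(1 + s * (z.2 * z.1))^-1|)%:E.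
transitivity (\int[P]_w g (V w, B w))%E.
  apply: (integral_ae_full (A := B @^-1` `]0, 1[ `&` V @^-1` `[0, +oo[)).
  - by apply: measurableI; exact: measurable_preimage.
  - by apply: probability_setI1 => //; exact: measurable_preimage.
  - by apply/measurable_EFinP; measurability.
  - by apply/measurable_EFinP; rewrite /=; measurability.
  - move=> w [/=]; rewrite !in_itv/= andbT => /andP[b0 _] v0; rewrite /g/= ger0_norm//.
    by rewrite invr_ge0 addr_ge0// mulr_ge0// mulr_ge0// ltW.
apply: (@indep_integral_cond _ _ _ P V B mV mB `[0, +oo[ g (fun v => ((1 + s * v) `^ (- a))%:E)) => //.
- exact: indepC.
- by apply/measurable_EFinP; rewrite /g; measurability.
- by move=> z; rewrite lee_fin normr_ge0.
- by apply/measurable_EFinP; measurability.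
- move=> v; rewrite /= in_itv/= andbT => v0; have sv : 0 <= s * v by rewrite mulr_ge0.
  rewrite -(beta_stieltjes a01 sv mB HB); apply: (integral_ae_full (A := B @^-1` `]0, 1[)) => //.
  - exact: measurable_preimage.
  - by apply/measurable_EFinP; rewrite /g/=; measurability.
  - by apply/measurable_EFinP; measurability.
  - move=> w; rewrite /= in_itv/= => /andP[b0 _]; rewrite /g/= ger0_norm.
      by rewrite mulrA mulrAC.
    by rewrite invr_ge0 addr_ge0// mulr_ge0// mulr_ge0// ltW.
Qed.

(** Given B = b, the transform of X at lam b^(1/al) is (1 + lam^al b)^-1, a beta kernel with
    parameter lam^al. *)
Lemma beta_powR_mul_stieltjes (al th lam : R) (B X : T -> R) (mB : measurable_fun setT B) (mX : measurable_fun setT X) :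
  0 < al -> 0 < th < 1 -> 0 < lam -> is_beta P th (1 - th) B -> indep P B X ->
  P (X @^-1` `[0, +oo[) = 1%E ->
  (forall lam : R, 0 < lam -> (\int[P]_w ((1 + lam * X w)^-1)%:E = ((1 + lam `^ al)^-1)%:E)%E) ->
  (\int[P]_w ((1 + lam * (B w `^ al^-1 * X w))^-1)%:E = ((1 + lam `^ al) `^ (- th))%:E)%E.
Proof.
move=> al0 th01 l0 HB BX X0 HX; have B1 := has_density_preimage mB HB (measurable_itv _).
pose g (z : measurableTypeR R * measurableTypeR R) : \bar R := (`|(1 + lam * (z.1 `^ al^-1 * z.2))^-1|)%:E.
transitivity (\int[P]_w g (B w, X w))%E.
  apply: (integral_ae_full (A := X @^-1` `[0, +oo[)) => //.
  - exact: measurable_preimage.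
  - by apply/measurable_EFinP; measurability.
  - by apply/measurable_EFinP; rewrite /=; measurability.
  - move=> w /=; rewrite in_itv/= andbT => x0; rewrite /g/= ger0_norm//.
    by rewrite invr_ge0 addr_ge0// mulr_ge0 ?(ltW l0)// mulr_ge0// powR_ge0.
rewrite -(beta_stieltjes th01 (powR_ge0 lam al) mB HB).
apply: (@indep_integral_cond _ _ _ P B X mB mX `]0, 1[ g (fun b => ((1 + lam `^ al * b)^-1)%:E)) => //.
- by apply/measurable_EFinP; rewrite /g; measurability.
- by move=> z; rewrite lee_fin normr_ge0.
- by apply/measurable_EFinP; measurability.
- move=> b; rewrite /= in_itv/= => /andP[b0 _].
  have lb : 0 < lam * b `^ al^-1 by rewrite mulr_gt0// powR_gt0.
  have -> : lam `^ al * b = (lam * b `^ al^-1) `^ al.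
    by rewrite powRM ?powR_ge0 ?(ltW l0)// -powRrM mulVf ?gt_eqF// powRr1// ltW.
  rewrite -(HX _ lb); apply: (integral_ae_full (A := X @^-1` `[0, +oo[)) => //.
  - exact: measurable_preimage.
  - by apply/measurable_EFinP; rewrite /g/=; measurability.
  - by apply/measurable_EFinP; measurability.
  - move=> w; rewrite /= in_itv/= andbT => x0; rewrite /g/= mulrA ger0_norm//.
    by rewrite invr_ge0 addr_ge0// mulr_ge0// ltW.
Qed.
End transforms.

(** * Densities of the scaled ratio and of its fractions *)

Section stable_law.
Context (R : realType) (al : R).
Hypothesis al01 : 0 < al < 1.

(** sin(acot z) = (1 + z^2)^(-1/2), and here 1 + z^2 is the quadratic denominator over sin(pi al)^2;
    the two square roots combine to the full denominator of [varrho]. *)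
Lemma stable_ratio_density1 (x : R) : 0 < x -> stable_ratio_density al 1 x = varrho al x.
Proof.
move=> x0; have D0 := stable_denom_gt0 al01 x0; have /andP[a0 a1] := al01.
have p0 := pi_gt0 R.
have s0 : 0 < sin (pi * al) by rewrite sin_gt0_pi// mulr_gt0//= gtr_pMr.
rewrite /stable_ratio_density /varrho !mulr1 !mul1r /Calpha /acot.
rewrite -[pi / 2 - _]opprB sinN sinBpihalf opprK cos_atan powR12_sqrt ?(ltW D0)//.
set D := x `^ (2 * al) + _ + 1 in D0 *.
have -> : 1 + (cot (pi * al) + x `^ al / sin (pi * al)) ^+ 2 = D / sin (pi * al) ^+ 2.
  have -> : D = sin (pi * al) ^+ 2 + (cos (pi * al) + x `^ al) ^+ 2.
    have sE (u : R) : sin u ^+ 2 = 1 - cos u ^+ 2 by rewrite -(cos2Dsin2 u) addrC addKr.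
    have xx : x `^ (2 * al) = x `^ al ^+ 2 by rewrite mulrC powRrM -powR_mulrn ?powR_ge0.
    by rewrite /D sE xx; ring.
  by rewrite /cot; field; rewrite gt_eqF.
rewrite sqrtrM ?(ltW D0)// sqrtrV ?sqr_ge0// sqrtr_sqr gtr0_norm// invfM invrK.
have d0 : 0 < Num.sqrt D by rewrite sqrtr_gt0.
have dd : D = Num.sqrt D ^+ 2 by rewrite sqr_sqrtr// ltW.
rewrite [in RHS]dd; move: (Num.sqrt D) d0 => e e0.
move: (sin _) (_ `^ _) => u v.
have pi0 : pi != 0 :> R by rewrite gt_eqF.
rewrite -[(e ^+ 2)^-1]exprVn expr2; move: (pi^-1 : R) => w.
by ring.
Qed.

Context d (T : measurableType d) (P : probability T R).

Lemma stable_ratio_has_density (th : R) (Y : T -> R) (mY : measurable_fun setT Y) :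
  0 < th -> al * th < 1 -> P (Y @^-1` `[0, +oo[) = 1%E ->
  (forall lam : R, 0 < lam -> (\int[P]_w ((1 + lam * Y w)^-1)%:E = ((1 + lam `^ al) `^ (- th))%:E)%E) ->
  has_density P Y `]0, +oo[ (stable_ratio_density al th).
Proof.
move=> th0 alth Y0 HY; apply: (stieltjes_has_density mY Y0).
- exact: measurable_itv.
- by move=> x; rewrite /= !in_itv/= !andbT; exact: ltW.
- apply: continuous_measurable_fun_0y => x x0.
  have [b db] := stable_ratio_density_derive th al01 x0.
  exact: is_derive1_continuous db.
- by move=> x; rewrite /= in_itv/= andbT => x0; rewrite ltW// stable_ratio_density_gt0.
- by move=> s s0; rewrite expectationE HY// integral_stable_ratio_density.
Qed.

(** The case th = 1: [varrho] is proved to be the density of X rather than assumed, which links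
    Dirichlet means over [varrho_law] to logarithmic moments of X. *)
Lemma varrho_lawE (X : T -> R) (mX : measurable_fun setT X) (U : set R) :
  P (X @^-1` `[0, +oo[) = 1%E ->
  (forall lam : R, 0 < lam -> (\int[P]_w ((1 + lam * X w)^-1)%:E = ((1 + lam `^ al)^-1)%:E)%E) ->
  measurable U -> varrho_law al U = P (X @^-1` U).
Proof.
move=> X0 HX mU; have /andP[a0 a1] := al01.
have [||_ _ ->//] := @stable_ratio_has_density 1 X mX ltr01 _ X0.
- by rewrite mulr1.
- by move=> lam l0; rewrite HX// powR_inv1// addr_ge0// powR_ge0.
- apply: eq_integral => x; rewrite inE => -[]; rewrite /= in_itv/= andbT => x0 _.
  by rewrite stable_ratio_density1.
Qed.
End stable_law.

Section fraction_density.
Context d (T : measurableType d) (R : realType) (P : probability T R).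

Lemma eq_has_density (Y : T -> R) (D : set R) (f g : R -> R) : measurable D ->
  (forall x, D x -> f x = g x) -> has_density P Y D f -> has_density P Y D g.
Proof.
move=> mD fg [mf f0 fY]; split.
- by apply: eq_measurable_fun mf => x; rewrite inE; exact: fg.
- by move=> x Dx; rewrite -fg// f0.
- by move=> U mU; rewrite fY//; apply: eq_integral => x; rewrite inE => -[Dx _]; rewrite fg.
Qed.

Variables (al th k : R).
Hypotheses (al01 : 0 < al < 1) (th0 : 0 < th) (alth : al * th < 1) (k0 : 0 < k).

(** The image of [stable_ratio_density] under x / (x + k), whose inverse is k y / (1 - y) with
    derivative k / (1 - y)^2. *)
Definition frac_density (y : R) : R :=
  stable_ratio_density al th (k * y / (1 - y)) * (k / (1 - y) ^+ 2).

Lemma frac_density_ge0 (y : R) : 0 < y < 1 -> 0 <= frac_density y.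
Proof.
move=> /andP[y0 y1]; have y1' : 0 < 1 - y by rewrite subr_gt0.
rewrite mulr_ge0//; last by rewrite divr_ge0 ?exprn_ge0// ltW.
by rewrite ltW// stable_ratio_density_gt0// divr_gt0// mulr_gt0.
Qed.

Lemma frac_density_derive (y : R) : 0 < y < 1 -> exists b, is_derive y 1 frac_density b.
Proof.
move=> /andP[y0 y1]; have y1' : 0 < 1 - y by rewrite subr_gt0.
have x0 : 0 < k * y / (1 - y) by rewrite divr_gt0// mulr_gt0.
have [b1 db1] := stable_ratio_density_derive th al01 x0.
have n1 : 1 - y != 0 by rewrite gt_eqF.
have n2 : (1 - y) ^+ 2 != 0 by rewrite expf_neq0.
have [b2 db2] : exists b, is_derive y 1 (fun y : R => k * y / (1 - y)) b.
  by eexists; repeat is_derive_step.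
have [b3 db3] : exists b, is_derive y 1 (fun y : R => k / (1 - y) ^+ 2) b.
  by eexists; repeat is_derive_step.
have db4 : is_derive y 1 (fun y : R => stable_ratio_density al th (k * y / (1 - y))) (b1 * b2).
  exact: (@is_derive1_comp _ (stable_ratio_density al th) (fun y : R => k * y / (1 - y))).
by exists (b1 * b2 * (k / (1 - y) ^+ 2) + stable_ratio_density al th (k * y / (1 - y)) * b3); exact: is_derive1_mul.
Qed.

Let frac_kE (x : R) : 0 < x -> 1 - x / (x + k) = k / (x + k).
Proof. by move=> x0; field; rewrite gt_eqF// addr_gt0. Qed.

Lemma frac_density_subst (x : R) : 0 < x ->
  frac_density (x / (x + k)) * (k / (x + k) ^+ 2) = stable_ratio_density al th x.
Proof.
move=> x0; have xk : 0 < x + k by rewrite addr_gt0.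
rewrite /frac_density frac_kE//.
have -> : k * (x / (x + k)) / (k / (x + k)) = x.
  by move: (x + k) xk => v v0; field; rewrite !gt_eqF.
by move: (x + k) xk => v v0; field; rewrite !gt_eqF.
Qed.

Lemma integral_frac_density (G : R -> R) :
  (forall y : R, 0 < y < 1 -> {for y, continuous G}) -> (forall y : R, 0 < y < 1 -> 0 <= G y) ->
  (\int[lebesgue_measure]_(y in `]0%R, 1%R[) (G y * frac_density y)%:E =
   \int[lebesgue_measure]_(x in `]0%R, +oo[) (G (x / (x + k)) * stable_ratio_density al th x)%:E)%E.
Proof.
move=> cG G0; rewrite (@integral_frac_itv01 R k (fun y => G y * frac_density y) k0).
- by apply: eq_integral => x; rewrite inE/= in_itv/= andbT => x0; rewrite -mulrA frac_density_subst.
- move=> y y01; have [b db] := frac_density_derive y01.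
  apply: (@continuousM _ _ G frac_density); first exact: cG.
  exact: is_derive1_continuous db.
- by move=> y y01; rewrite mulr_ge0 ?G0// frac_density_ge0.
Qed.

Let cont_kernel (s : R) : 0 < s -> forall y : R, 0 < y < 1 -> {for y, continuous (fun y : R => (1 + s * y)^-1)}.
Proof.
move=> s0 y /andP[y0 _]; have e0 : 1 + s * y != 0 by rewrite gt_eqF// addr_gt0// mulr_gt0.
have [b db] : exists b, is_derive y 1 (fun y : R => (1 + s * y)^-1) b.
  by eexists; repeat is_derive_step.
exact: is_derive1_continuous db.
Qed.

Let pos_kernel (s : R) : 0 < s -> forall y : R, 0 < y < 1 -> 0 <= (1 + s * y)^-1.
Proof. by move=> s0 y /andP[y0 _]; rewrite invr_ge0 addr_ge0// mulr_ge0// ltW. Qed.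

Lemma frac_has_density (Y : T -> R) (mY : measurable_fun setT Y) :
  P (Y @^-1` `[0, +oo[) = 1%E ->
  (forall lam : R, 0 < lam -> (\int[P]_w ((1 + lam * Y w)^-1)%:E = ((1 + lam `^ al) `^ (- th))%:E)%E) ->
  has_density P (fun w => Y w / (Y w + k)) `]0, 1[ frac_density.
Proof.
move=> Y0 HY; have mV : measurable_fun setT (fun w => Y w / (Y w + k)) by measurability.
apply: (stieltjes_has_density mV).
- apply: probability_sub1 Y0 _; [exact: measurable_preimage|exact: measurable_preimage|].
  move=> w; rewrite /= !in_itv/= !andbT => y0; rewrite divr_ge0// addr_ge0//.
  exact: ltW.
- exact: measurable_itv.
- by move=> x; rewrite /= !in_itv/= andbT => /andP[/ltW].
- apply: continuous_measurable_fun_01 => y y01; have [b db] := frac_density_derive y01.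
  exact: is_derive1_continuous db.
- by move=> y; rewrite /= in_itv/=; exact: frac_density_ge0.
- move=> s s0; rewrite expectationE.
  rewrite (@integral_frac_density (fun y => (1 + s * y)^-1) (cont_kernel s0) (pos_kernel s0)).
  have Yh := stable_ratio_has_density al01 mY th0 alth Y0 HY.
  rewrite (has_density_expectation mY Yh (measurable_itv _) (g := fun x => (1 + s * (x / (x + k)))^-1))//.
    by measurability.
  move=> x; rewrite /= in_itv/= andbT => x0.
  by rewrite invr_ge0 addr_ge0// mulr_ge0 ?(ltW s0)// divr_ge0 ?addr_ge0// ltW.
Qed.

(** With y = x / (x + k), (1 - y) / (1 + s y) = (1 + ((1 + s) / k) x)^-1. So the weight 1 - y shifts
    the argument of the transform from s / k to (1 + s) / k, which is the source of the factor in
    [g_density]. *)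
Lemma tilted_frac_has_density (Q : R) (V : T -> R) (mV : measurable_fun setT V) : 0 < Q ->
  P (V @^-1` `[0, +oo[) = 1%E ->
  (forall s : R, 0 < s -> (\int[P]_w ((1 + s * V w)^-1)%:E = (Q^-1 * (1 + ((1 + s) / k) `^ al) `^ (- th))%:E)%E) ->
  has_density P V `]0, 1[ (fun y => (1 - y) / Q * frac_density y).
Proof.
move=> Q0 V0 HV; apply: (stieltjes_has_density mV V0).
- exact: measurable_itv.
- by move=> x; rewrite /= !in_itv/= andbT => /andP[/ltW].
- apply: continuous_measurable_fun_01 => y y01; have [b db] := frac_density_derive y01.
  have [b2 db2] : exists b, is_derive y 1 (fun y => (1 - y) / Q * frac_density y) b.
    by eexists; repeat is_derive_step; rewrite gt_eqF.
  exact: is_derive1_continuous db2.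
- move=> y; rewrite /= in_itv/= => y01; have /andP[y0 y1] := y01.
  by rewrite mulr_ge0 ?frac_density_ge0// divr_ge0 ?(ltW Q0)// subr_ge0 ltW.
- move=> s s0; rewrite expectationE HV//.
  pose G (y : R) := (1 + s * y)^-1 * ((1 - y) / Q).
  transitivity (\int[lebesgue_measure]_(y in `]0%R, 1%R[) (G y * frac_density y)%:E)%E; last first.
    by apply: eq_integral => y _; rewrite /G -mulrA.
  rewrite (@integral_frac_density G).
  + have l0 : 0 < (1 + s) / k by rewrite divr_gt0// addr_gt0.
    rewrite EFinM -(integral_stable_ratio_density al01 th0 alth l0) -ge0_integralZl//.
    * apply: eq_integral => x; rewrite inE/= in_itv/= andbT => x0.
      have xk : 0 < x + k by rewrite addr_gt0.
      have e1 : 0 < x + k + s * x by rewrite addr_gt0// mulr_gt0.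
      rewrite -EFinM mulrA /G frac_kE//; congr (_ * _)%:E.
      have -> : 1 + s * (x / (x + k)) = (x + k + s * x) / (x + k) by field; rewrite gt_eqF.
      have -> : 1 + (1 + s) / k * x = (x + k + s * x) / k by field; rewrite gt_eqF.
      rewrite !invf_div; move: (x + k) xk e1 => v v0 e1.
      by field; rewrite !gt_eqF.
    * apply/measurable_EFinP; apply: continuous_measurable_fun_0y => x x0.
      have [b db] := stable_ratio_density_derive th al01 x0.
      have e1 : 1 + (1 + s) / k * x != 0 by rewrite gt_eqF// addr_gt0// mulr_gt0.
      have [b2 db2] : exists b, is_derive x 1 (fun x => (1 + (1 + s) / k * x)^-1 * stable_ratio_density al th x) b.
        by eexists; repeat is_derive_step.
      exact: is_derive1_continuous db2.
    * move=> x; rewrite /= in_itv/= andbT => x0; rewrite lee_fin mulr_ge0//.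
        by rewrite invr_ge0 addr_ge0// mulr_ge0// ltW.
      by rewrite ltW// stable_ratio_density_gt0.
    * by rewrite lee_fin invr_ge0 ltW.
  + move=> y y01; have /andP[y0 _] := y01.
    have e1 : 1 + s * y != 0 by rewrite gt_eqF// addr_gt0// mulr_gt0.
    have [b db] : exists b, is_derive y 1 G b.
      by eexists; rewrite /G; repeat is_derive_step; rewrite gt_eqF.
    exact: is_derive1_continuous db.
  + move=> y y01; have /andP[_ y1] := y01; rewrite /G mulr_ge0 ?pos_kernel//.
    by rewrite divr_ge0 ?(ltW Q0)// subr_ge0 ltW.
Qed.
End fraction_density.

Section density_formulas.
Context (R : realType) (al p th : R).
Hypotheses (al01 : 0 < al < 1) (p01 : 0 < p < 1).

Let c : R := (p / (1 - p)) `^ al^-1.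

Lemma f_densityE (y : R) : 0 < y < 1 ->
  frac_density al th c^-1 y = f_density al p th y.
Proof.
move=> /andP[y0 y1]; have /andP[p0 p1] := p01; have /andP[a0 a1] := al01.
have q0 : 0 < 1 - p by rewrite subr_gt0.
have z0 : 0 < 1 - y by rewrite subr_gt0.
have pi0 := pi_gt0 R.
rewrite /frac_density /f_density /sinC /denom.
have cE : c^-1 = (1 - p) `^ al^-1 / p `^ al^-1.
  by rewrite /c powRM ?invr_ge0 ?ltW// invfM mulrC -(powR_inv1 (ltW q0)) -powRrM mulN1r powRN invrK.
have xE : (1 - p) `^ al^-1 * y / (p `^ al^-1 * (1 - y)) = c^-1 * y / (1 - y).
  have pa : 0 < p `^ al^-1 by rewrite powR_gt0.
  by rewrite cE; field; rewrite !gt_eqF.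
rewrite xE; set x := c^-1 * y / (1 - y).
have x0 : 0 < x by rewrite /x cE !(mulr_gt0, divr_gt0, powR_gt0, invr_gt0).
rewrite /stable_ratio_density; set s := sin _.
set q := 1 - p in q0 cE xE *; set z := 1 - y in z0 xE x x0 s *.
(* [lc] and [lx] are the logarithms of c^-1 and of x; every power becomes an exponential, and the
   two denominators differ by the factor p^2 z^(2 al). *)
pose lc : R := (ln q - ln p) / al.
pose lx : R := lc + ln y - ln z.
have lnc : c^-1 = expR lc.
  rewrite cE (powR_expR _ q0) (powR_expR _ p0) -expRN -expRD; congr expR.
  by rewrite /lc; field; rewrite gt_eqF.
have zi : z^-1 = expR (- ln z) by rewrite expRN lnK ?posrE.
have xl : x = expR lx by rewrite /x lnc zi -{1}[y]lnK ?posrE// -!expRD.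
have px r : x `^ r = expR (r * lx) by rewrite (powR_expR _ x0) xl expRK.
have D0 := stable_denom_gt0 al01 x0.
set D := _ + 1 in D0 *.
set D' := y `^ (2 * al) * q ^+ 2 + _ + _.
have sq (u : R) : 0 < u -> u ^+ 2 = expR (2 * ln u).
  by move=> u0; rewrite mulr_natl mulr2n expRD lnK ?posrE// expr2.
have DE : D' = expR (2 * ln p + 2 * al * ln z) * D.
  have e1 : expR (2 * ln p + 2 * al * ln z) * x `^ (2 * al) = y `^ (2 * al) * q ^+ 2.
    rewrite px (sq _ q0) (powR_expR _ y0) -!expRD; congr expR.
    by rewrite /lx /lc; field; rewrite gt_eqF.
  have e2 : expR (2 * ln p + 2 * al * ln z) * x `^ al = q * p * (y `^ al * z `^ al).
    have -> : q * p = expR (ln q + ln p) by rewrite expRD !lnK ?posrE.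
    rewrite px (powR_expR _ y0) (powR_expR _ z0) -!expRD; congr expR.
    by rewrite /lx /lc; field; rewrite gt_eqF.
  have e3 : expR (2 * ln p + 2 * al * ln z) = z `^ (2 * al) * p ^+ 2.
    by rewrite (sq _ p0) (powR_expR _ z0) -!expRD addrC.
  have e4 : expR (2 * ln p + 2 * al * ln z) * (2 * x `^ al * cos (pi * al)) =
      2 * q * p * y `^ al * z `^ al * cos (al * pi).
    transitivity (2 * cos (pi * al) * (expR (2 * ln p + 2 * al * ln z) * x `^ al)); first by ring.
    by rewrite e2 (mulrC al pi); ring.
  rewrite /D' -e1 -e3 -e4 /D; move: (expR (2 * ln p + _)) => e; by ring.
have D'0 : 0 < D' by rewrite DE mulr_gt0// expR_gt0.
rewrite (powR_expR _ D0) (powR_expR _ D'0) DE lnM ?posrE ?expR_gt0// expRK px lnc.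
rewrite (powR_expR _ q0) (powR_expR _ y0) -[(z ^+ 2)^-1]exprVn expr2 zi -!expRN.
transitivity (pi^-1 * s * (expR ((al * th - 1) * lx) * expR (- (th / 2 * ln D)) *
  expR lc * expR (- ln z) * expR (- ln z))); first by ring.
transitivity (pi^-1 * s * (expR (th * ln q) * expR ((al * th - 1) * ln y) * expR (- ln z) *
  expR (- (th / 2 * (2 * ln p + 2 * al * ln z + ln D))))); last by ring.
rewrite -!expRD; congr (_ * expR _); rewrite /lx /lc; field.
by rewrite gt_eqF.
Qed.

Lemma g_densityE (y : R) : 0 < y < 1 ->
  g_density al p th y =
  pi^-1 * (y `^ (al * th - 1) * sinC al p th y / denom al p th y).
Proof.
move=> /andP[y0 y1]; have /andP[p0 p1] := p01.
have q0 : 0 < (1 - p) `^ th by rewrite powR_gt0// subr_gt0.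
rewrite /g_density /f_density; move: (sinC _ _ _ _) (denom _ _ _ _) => s D.
move: (_ `^ th) (y `^ _) q0 => u v u0; have z0 : 1 - y != 0 by rewrite subr_eq0 gt_eqF.
rewrite -[v / (1 - y)]/(v * (1 - y)^-1); move: (D^-1) (pi^-1 : R) => e w.
by field; rewrite z0 gt_eqF.
Qed.
End density_formulas.

(** * Equalities in law and the common transforms *)

Section law_equalities.
Context d (T : measurableType d) (R : realType) (P : probability T R).

Lemma eq_law_has_density (Y Z : T -> R) (D : set R) (f : R -> R) :
  eq_law P Y Z -> has_density P Z D f -> has_density P Y D f.
Proof. by move=> YZ [mf f0 fZ]; split => // U mU; rewrite YZ// fZ. Qed.

Lemma indep_comp (Y Z : T -> R) (h : R -> R) : measurable_fun setT h ->
  indep P Y Z -> indep P (fun w => h (Y w)) Z.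
Proof. by move=> mh YZ U V mU mV; apply: (YZ (h @^-1` U) V) => //; exact: measurable_preimage. Qed.

(** Integrating Z out first leaves the same function of Y and of Y', whose laws agree. *)
Lemma eq_law_pair (Y Y' Z : T -> R) (mY : measurable_fun setT Y) (mY' : measurable_fun setT Y')
    (mZ : measurable_fun setT Z) (phi : measurableTypeR R * measurableTypeR R -> R) :
  measurable_fun setT phi -> eq_law P Y Y' -> indep P Y Z -> indep P Y' Z ->
  eq_law P (fun w => phi (Y w, Z w)) (fun w => phi (Y' w, Z w)).
Proof.
move=> mphi YY' YZ Y'Z U mU.
pose g z : \bar R := (\1_U (phi z))%:E.
have mg : measurable_fun setT g.
  by apply/measurable_EFinP; apply: measurableT_comp mphi; exact: measurable_indic.
have g0 z : (0 <= g z)%E by rewrite lee_fin.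
have E (V : T -> R) : measurable_fun setT V ->
    P ((fun w => phi (V w, Z w)) @^-1` U) = (\int[P]_w g (V w, Z w))%E.
  move=> mV; have mVZ : measurable_fun setT (fun w => phi (V w, Z w)).
    by apply: (measurableT_comp mphi); exact: measurable_fun_pair.
  set V' := (fun w => phi (V w, Z w)) in mVZ *.
  transitivity (\int[P]_w (\1_U (V' w))%:E)%E; last by [].
  by rewrite -(setIT (V' @^-1` U)) -integral_indic//; exact: measurable_preimage.
have mF : measurable_fun setT (fun y => \int[law P mZ]_z g (y, z))%E.
  exact: (@measurable_fun_fubini_tonelli_F _ _ _ _ R (law P mZ) g mg g0).
have F0 (y : R) : (0 <= \int[law P mZ]_z g (y, z))%E by exact: integral_ge0.
rewrite !E// (indep_integral mY mZ)// (indep_integral mY' mZ)//.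
rewrite (ge0_integral_law P mY mF F0) (ge0_integral_law P mY' mF F0).
exact: (eq_law_integral mY mY' YY' mF F0).
Qed.

Lemma beta_gamma_law (th : R) (B G G' : T -> R) (mB : measurable_fun setT B)
    (mG : measurable_fun setT G) (mG' : measurable_fun setT G') : 0 < th < 1 ->
  is_beta P th (1 - th) B -> is_gamma P th G -> is_gamma P (1 - th) G' -> indep P G G' ->
  eq_law P B (fun w => G w / (G w + G' w)).
Proof.
move=> th01 HB HG HG' GG'.
have mQ : measurable_fun setT (fun w => G w / (G w + G' w)) by measurability.
have B1 := has_density_preimage mB HB (measurable_itv _).
have pG := has_density_preimage mG HG (measurable_itv _).
have pG' := has_density_preimage mG' HG' (measurable_itv _).
apply: (stieltjes_eq_law mB mQ).
- apply: probability_sub1 B1 _; [exact: measurable_preimage|exact: measurable_preimage|].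
  by move=> w; rewrite /= !in_itv/= andbT => /andP[/ltW].
- apply: probability_sub1 (probability_setI1 _ _ pG pG') _.
  + by apply: measurableI; exact: measurable_preimage.
  + exact: measurable_preimage.
  + exact: measurable_preimage.
  + exact: measurable_preimage.
  + by move=> w [/=]; rewrite !in_itv/= !andbT => g0 g'0; rewrite divr_ge0 ?addr_ge0// ltW.
- move=> s s0; rewrite !expectationE (beta_stieltjes th01 (ltW s0) mB HB).
  by rewrite (gamma_ratio_stieltjes mG mG' HG HG' GG' (ltW s0)).
Qed.
End law_equalities.

Section occupation_laws.
Context d (T : measurableType d) (R : realType) (P : probability T R) (al p th : R) (X : T -> R).
Hypotheses (al01 : 0 < al < 1) (p01 : 0 < p < 1) (th0 : 0 < th) (alth : al * th < 1).
Hypotheses (mX : measurable_fun setT X) (X0 : P (X @^-1` `[0, +oo[) = 1%E).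
Hypothesis HX : forall lam : R, 0 < lam ->
  (\int[P]_w ((1 + lam * X w)^-1)%:E = ((1 + lam `^ al)^-1)%:E)%E.

Let c : R := (p / (1 - p)) `^ al^-1.
Let lamX : T -> R := fun w => c * X w / (1 + c * X w).
Let Lambda : set R -> \bar R := pushforward P lamX.

Let al0 : 0 < al. Proof. by case/andP: al01. Qed.
Let p0 : 0 < p. Proof. by case/andP: p01. Qed.
Let q0 : 0 < 1 - p. Proof. by rewrite subr_gt0; case/andP: p01. Qed.
Let c0 : 0 < c. Proof. by rewrite powR_gt0// divr_gt0. Qed.
Let calE : c `^ al = p / (1 - p).
Proof. by rewrite -powRrM mulVf ?gt_eqF// powRr1// divr_ge0 ?ltW. Qed.
Let alth01 : 0 <= al * th <= 1. Proof. by rewrite (ltW alth) mulr_ge0// ltW. Qed.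
Let mlamX : measurable_fun setT lamX. Proof. by rewrite /lamX; measurability. Qed.

Let lamX0 : P (lamX @^-1` `[0, +oo[) = 1%E.
Proof.
apply: probability_sub1 X0 _; [exact: measurable_preimage|exact: measurable_preimage|].
move=> w; rewrite /= !in_itv/= !andbT => x0.
have cx : 0 <= c * X w by rewrite mulr_ge0// ltW.
by rewrite /lamX divr_ge0// addr_ge0.
Qed.

(** The mixing weight al th cancels the factor al^-1 of the logarithmic moment and leaves the
    exponent th. *)
Lemma varrho_mean_stieltjes (M : T -> R) (mM : measurable_fun setT M) (lam : R) :
  is_dirichlet_mean P 1 (mix0 (al * th) (varrho_law al)) M -> 0 < lam ->
  (\int[P]_w ((1 + lam * M w)^-1)%:E = ((1 + lam `^ al) `^ (- th))%:E)%E.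
Proof.
move=> HM l0; have e0 : 0 < 1 + lam `^ al by rewrite ltr_wpDr// powR_ge0.
rewrite (@dirichlet_mean1_stieltjes _ _ _ P _ M mM lam (al * th * (al^-1 * ln (1 + lam `^ al))) HM l0).
  by rewrite (powR_expR _ e0); congr (expR _)%:E; field; rewrite gt_eqF.
rewrite (@integral_mix0_ln _ _ _ P _ _ X mX lam alth01)//.
  by rewrite (log_moment al0 mX X0 HX l0).
by move=> U mU; exact: varrho_lawE.
Qed.

(** 1 + s c X / (1 + c X) = (1 + c (1 + s) X) / (1 + c X), so this is a difference of two instances
    of [log_moment], simplified by c^al = p / (1 - p). It is stated as a sum first because the
    integrands are nonnegative. *)
Let log_lamX (s : R) : 0 < s ->
  (\int[P]_w (ln (1 + s * lamX w))%:E = (al^-1 * ln (1 - p + p * (1 + s) `^ al))%:E)%E.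
Proof.
move=> s0; have s1 : 0 < 1 + s by rewrite addr_gt0.
have mB : measurable (X @^-1` `[0, +oo[) by exact: measurable_preimage.
have Bp w : (X @^-1` `[0, +oo[) w -> 0 <= X w by rewrite /= in_itv/= andbT.
have ln0 (u v : R) : 0 <= u -> 0 <= v -> (0 <= (ln (1 + u * v))%:E)%E.
  by move=> u0 v0; rewrite lee_fin ln_ge0// lerDl mulr_ge0.
have H : (\int[P]_w (ln (1 + s * lamX w))%:E + (al^-1 * ln (1 + c `^ al))%:E =
    (al^-1 * ln (1 + (c * (1 + s)) `^ al))%:E)%E.
  rewrite -(log_moment al0 mX X0 HX c0) -(log_moment al0 mX X0 HX (mulr_gt0 c0 s1)).
  rewrite -!(integral_full mB X0); try by apply/measurable_EFinP; measurability.
  rewrite -ge0_integralD//.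
  - apply: eq_integral => w; rewrite inE => /Bp x0.
    have cx : 0 <= c * X w by rewrite mulr_ge0// ltW.
    have e1 : 0 < 1 + c * X w by rewrite ltr_pwDl.
    have e2 : 0 < 1 + s * lamX w by rewrite ltr_pwDl// mulr_ge0 ?(ltW s0)// divr_ge0// ltW.
    rewrite -EFinD -lnM ?posrE//; congr (ln _)%:E; rewrite /lamX.
    by field; rewrite gt_eqF.
  - move=> w /Bp x0; apply: ln0; first exact: ltW.
    have cx : 0 <= c * X w by rewrite mulr_ge0// ltW.
    by rewrite divr_ge0// addr_ge0.
  - by apply: measurable_funTS; apply/measurable_EFinP; measurability.
  - by move=> w /Bp x0; apply: ln0 => //; exact: ltW.
  - by apply: measurable_funTS; apply/measurable_EFinP; measurability.
have -> : (\int[P]_w (ln (1 + s * lamX w))%:E =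
    (al^-1 * ln (1 + (c * (1 + s)) `^ al))%:E - (al^-1 * ln (1 + c `^ al))%:E)%E.
  by rewrite -H addeK.
rewrite -EFinB; congr EFin; rewrite powRM ?(ltW c0) ?(ltW s1)// calE.
have v0 := powR_gt0 al s1; move: (_ `^ al) v0 => v v0.
have e0 : 0 < p / (1 - p) by rewrite divr_gt0.
rewrite -mulrBr -ln_div ?posrE; last 2 first.
- by rewrite addr_gt0// mulr_gt0.
- by rewrite addr_gt0.
congr (_ * ln _); field; rewrite (gt_eqF q0) /=.
by rewrite subrK oner_neq0.
Qed.

Let PD_transform (s : R) : 0 < s ->
  expR (- (al * th * (al^-1 * ln (1 - p + p * (1 + s) `^ al)))) =
  (1 - p + p * (1 + s) `^ al) `^ (- th).
Proof.
move=> s0; have e0 : 0 < 1 - p + p * (1 + s) `^ al by rewrite addr_gt0// mulr_gt0// powR_gt0// addr_gt0.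
by rewrite (powR_expR _ e0); congr expR; field; rewrite gt_eqF.
Qed.

Lemma Lambda_mean1_stieltjes (M : T -> R) (mM : measurable_fun setT M) (s : R) :
  is_dirichlet_mean P 1 (mix0 (al * th) Lambda) M -> 0 < s ->
  (\int[P]_w ((1 + s * M w)^-1)%:E = ((1 - p + p * (1 + s) `^ al) `^ (- th))%:E)%E.
Proof.
move=> HM s0.
rewrite (@dirichlet_mean1_stieltjes _ _ _ P _ M mM s
  (al * th * (al^-1 * ln (1 - p + p * (1 + s) `^ al))) HM s0) ?PD_transform//.
by rewrite (@integral_mix0_ln _ _ _ P _ _ lamX mlamX s alth01)// log_lamX.
Qed.

Lemma beta_mul_PD_stieltjes (B V : T -> R) (mB : measurable_fun setT B) (mV : measurable_fun setT V) (s : R) :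
  is_beta P (al * th) (1 - al * th) B -> is_PD_mass P al th p V -> indep P B V -> 0 < s ->
  (\int[P]_w ((1 + s * (B w * V w))^-1)%:E = ((1 - p + p * (1 + s) `^ al) `^ (- th))%:E)%E.
Proof.
move=> HB [V1 HV] BV s0; rewrite (beta_mul_stieltjes mB mV _ (ltW s0) HB BV).
- by rewrite -expectationE HV.
- by rewrite mulr_gt0.
- apply: probability_sub1 V1 _; [exact: measurable_preimage|exact: measurable_preimage|].
  by move=> w; rewrite /= !in_itv/= andbT => /andP[].
Qed.

Lemma beta_mul_mean_stieltjes (B V : T -> R) (mB : measurable_fun setT B) (mV : measurable_fun setT V) (s : R) :
  is_beta P (al * th) (1 - al * th) B -> is_dirichlet_mean P (al * th) Lambda V -> indep P B V -> 0 < s ->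
  (\int[P]_w ((1 + s * (B w * V w))^-1)%:E = ((1 - p + p * (1 + s) `^ al) `^ (- th))%:E)%E.
Proof.
move=> HB HV BV s0; rewrite (beta_mul_stieltjes mB mV _ (ltW s0) HB BV).
- rewrite (@dirichlet_mean_transform _ _ _ P _ _ V s (al^-1 * ln (1 - p + p * (1 + s) `^ al)) HV s0).
    by rewrite PD_transform.
  by rewrite (@integral_law_ln _ _ _ P _ lamX mlamX s)// log_lamX.
- by rewrite mulr_gt0.
- by case: HV.
Qed.

(** c Y / (c Y + 1) = Y / (Y + c^-1), a fraction with k = c^-1. *)
Lemma f_has_density (Y : T -> R) (mY : measurable_fun setT Y) :
  P (Y @^-1` `[0, +oo[) = 1%E ->
  (forall lam : R, 0 < lam -> (\int[P]_w ((1 + lam * Y w)^-1)%:E = ((1 + lam `^ al) `^ (- th))%:E)%E) ->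
  has_density P (fun w => c * Y w / (c * Y w + 1)) `]0, 1[ (f_density al p th).
Proof.
move=> Y0 HY; have -> : (fun w => c * Y w / (c * Y w + 1)) = (fun w => Y w / (Y w + c^-1)).
  apply/funext => w; have -> : Y w + c^-1 = (c * Y w + 1) / c by field; rewrite gt_eqF.
  by rewrite invf_div mulrCA mulrA.
have ci : 0 < c^-1 by rewrite invr_gt0.
apply: eq_has_density (frac_has_density al01 th0 alth ci mY Y0 HY); first exact: measurable_itv.
by move=> y; rewrite /= in_itv/=; exact: f_densityE.
Qed.

(** Taking 1 - p out of the bracket leaves 1 + (c (1 + s))^al and produces the constant Q = (1 -
    p)^th of the tilted density. *)
Lemma g_has_density (Y : T -> R) (mY : measurable_fun setT Y) :
  P (Y @^-1` `[0, +oo[) = 1%E ->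
  (forall s : R, 0 < s -> (\int[P]_w ((1 + s * Y w)^-1)%:E = ((1 - p + p * (1 + s) `^ al) `^ (- th))%:E)%E) ->
  has_density P Y `]0, 1[ (g_density al p th).
Proof.
move=> Y0 HY; have ci : 0 < c^-1 by rewrite invr_gt0.
have Q0 : 0 < (1 - p) `^ th by rewrite powR_gt0.
apply: eq_has_density (tilted_frac_has_density al01 th0 alth ci mY Q0 Y0 _).
- exact: measurable_itv.
- by move=> y; rewrite /= in_itv/= => y01; rewrite /g_density -f_densityE.
- move=> s s0; have s1 : 0 < 1 + s by rewrite addr_gt0.
  rewrite HY// invrK powRM ?(ltW s1) ?(ltW c0)// calE.
  have v0 := powR_gt0 al s1; move: (_ `^ al) v0 => v v0; congr EFin.
  have -> : 1 - p + p * v = (1 - p) * (1 + v * (p / (1 - p))) by field; rewrite gt_eqF.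
  rewrite powRM ?(ltW q0)//; first by rewrite powRN.
  by rewrite addr_ge0// mulr_ge0 ?divr_ge0// ltW.
Qed.

Section randomly_skewed.
Hypothesis th1 : th < 1.
Let th01 : 0 < th < 1. Proof. by rewrite th0. Qed.
Variable B : T -> R.
Hypotheses (mB : measurable_fun setT B) (HB : is_beta P th (1 - th) B) (BX : indep P B X).

Let W : T -> R := fun w => B w `^ al^-1 * X w.
Let mW : measurable_fun setT W. Proof. by rewrite /W; measurability. Qed.

Let W0 : P (W @^-1` `[0, +oo[) = 1%E.
Proof.
apply: probability_sub1 X0 _; [exact: measurable_preimage|exact: measurable_preimage|].
by move=> w; rewrite /= !in_itv/= !andbT => x0; rewrite /W mulr_ge0// powR_ge0.
Qed.

Let HW (lam : R) : 0 < lam ->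
  (\int[P]_w ((1 + lam * W w)^-1)%:E = ((1 + lam `^ al) `^ (- th))%:E)%E.
Proof. by move=> l0; exact: beta_powR_mul_stieltjes. Qed.

Lemma skewed_scaled_density :
  has_density P (fun w => c * B w `^ al^-1 * X w / (c * B w `^ al^-1 * X w + 1)) `]0, 1[ (f_density al p th).
Proof.
rewrite (_ : (fun w => _) = (fun w => c * W w / (c * W w + 1))); first exact: f_has_density.
by apply/funext => w; rewrite /W mulrA.
Qed.

Lemma skewed_scaled_mean (M : T -> R) (mM : measurable_fun setT M) :
  is_dirichlet_mean P 1 (mix0 (al * th) (varrho_law al)) M ->
  eq_law P (fun w => c * B w `^ al^-1 * X w / (c * B w `^ al^-1 * X w + 1))
           (fun w => c * M w / (c * M w + 1)).
Proof.
move=> HM; rewrite (_ : (fun w => c * B w `^ _ * _ / _) = (fun w => c * W w / (c * W w + 1))); last first.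
  by apply/funext => w; rewrite /W mulrA.
apply: (@eq_law_comp _ _ _ P W M (fun x => c * x / (c * x + 1))); first by measurability.
apply: (stieltjes_eq_law mW mM) => //; first by case: HM.
by move=> s s0; rewrite !expectationE HW// varrho_mean_stieltjes.
Qed.

(** For xi = p B / (q + p B) the odds xi / (1 - xi) are (p / q) B, whose power 1 / al is c B^(1/al).
    Since xi has this form only in law, [eq_law_pair] replaces it first, by independence from X. *)
Lemma skewed_eq_scaled (xi : T -> R) (mxi : measurable_fun setT xi) :
  eq_law P xi (fun w => p * B w / (1 - p + p * B w)) -> indep P xi X ->
  eq_law P (fun w => xi w `^ al^-1 * X w / (xi w `^ al^-1 * X w + (1 - xi w) `^ al^-1))
           (fun w => c * B w `^ al^-1 * X w / (c * B w `^ al^-1 * X w + 1)).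
Proof.
move=> xiB xiX; have B1 := has_density_preimage mB HB (measurable_itv _).
pose h (b : R) : R := p * b / (1 - p + p * b).
have mh : measurable_fun setT h by rewrite /h; measurability.
have mhB : measurable_fun setT (fun w => h (B w)) by exact: (measurableT_comp mh mB).
pose phi (z : measurableTypeR R * measurableTypeR R) : R :=
  z.1 `^ al^-1 * z.2 / (z.1 `^ al^-1 * z.2 + (1 - z.1) `^ al^-1).
have mphi : measurable_fun setT phi by rewrite /phi; measurability.
apply: (eq_law_trans (eq_law_pair mxi mhB mX mphi xiB xiX (indep_comp mh BX))).
apply: (eq_law_ae (A := B @^-1` `]0, 1[)) => //.
- exact: measurable_preimage.
- by rewrite /phi/=; measurability.
- by measurability.
- move=> w; rewrite /= in_itv/= => /andP[b0 b1]; rewrite /phi/= /h.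
  set b := B w in b0 b1 *; have u0 : 0 < 1 - p + p * b by rewrite addr_gt0// mulr_gt0.
  have -> : 1 - p * b / (1 - p + p * b) = (1 - p) / (1 - p + p * b) by field; rewrite gt_eqF.
  rewrite /c !powRM ?invr_ge0 ?(ltW u0) ?(ltW q0) ?(ltW p0) ?(ltW b0) ?mulr_ge0 ?(ltW p0) ?(ltW b0)//.
  set u := _^-1 `^ al^-1; set v := (1 - p)^-1 `^ al^-1.
  have u1 : 0 < u by rewrite powR_gt0// invr_gt0.
  have qv : (1 - p) `^ al^-1 = v^-1.
    by rewrite /v -(powR_inv1 (ltW q0)) -powRrM mulN1r powRN invrK.
  have v1 : 0 < v by rewrite powR_gt0// invr_gt0.
  rewrite qv; set x := X w; set a := p `^ _; set e := b `^ _.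
  have -> : a * e * u * x = (v^-1 * u) * (a * v * e * x) by field; rewrite gt_eqF.
  have -> : v^-1 * u * (a * v * e * x) + v^-1 * u = v^-1 * u * (a * v * e * x + 1).
    by rewrite mulrDr mulr1.
  rewrite -mulf_div divff ?mul1r//.
  by rewrite gt_eqF// mulr_gt0// invr_gt0.
Qed.
End randomly_skewed.
End occupation_laws.

Theorem proposition4p6 (R : realType) (d : measure_display)
    (T : measurableType d) (P : probability T R) (alpha p : R)
    (S S' X : {RV P >-> R}) :
  0 < alpha < 1 -> 0 < p < 1 ->
  is_pos_stable P alpha S -> is_pos_stable P alpha S' -> indep P S S' ->
  eq_law P X (fun w => S w / S' w) ->
  let q : R := 1 - p in
  let c : R := (p / q) `^ alpha^-1 in
  let Lambda := pushforward P (fun w => c * X w / (1 + c * X w)) in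
  (forall theta : R, 0 < theta < 1 ->
    [/\ (* the two representations of xi*_theta *)
        forall B G G' : {RV P >-> R},
          is_beta P theta (1 - theta) B ->
          is_gamma P theta G -> is_gamma P (1 - theta) G' -> indep P G G' ->
          eq_law P (fun w => p * B w / (q + p * B w))
                   (fun w => p * G w / (G w + q * G' w)),
        (* A_{alpha, xi*_theta} *)
        forall xi B : {RV P >-> R},
          is_beta P theta (1 - theta) B -> indep P B X ->
          eq_law P xi (fun w => p * B w / (q + p * B w)) -> indep P xi X ->
          let A := fun w =>
            xi w `^ alpha^-1 * X w /
            (xi w `^ alpha^-1 * X w + (1 - xi w) `^ alpha^-1) in
          [/\ eq_law P A (fun w => c * B w `^ alpha^-1 * X w /
                                   (c * B w `^ alpha^-1 * X w + 1)),
              forall M : {RV P >-> R},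
                is_dirichlet_mean P 1
                  (mix0 (alpha * theta) (varrho_law alpha)) M ->
                eq_law P A (fun w => c * M w / (c * M w + 1)) &
              has_density P A `]0, 1[ (f_density alpha p theta)]
      & (* B_{alpha theta, 1 - alpha theta} P_{alpha, alpha theta}(C) *)
        (forall B PC : {RV P >-> R},
          is_beta P (alpha * theta) (1 - alpha * theta) B ->
          is_PD_mass P alpha theta p PC -> indep P B PC ->
          [/\ forall Abr : {RV P >-> R},
                is_PD_mass P alpha theta p Abr -> indep P B Abr ->
                eq_law P (fun w => B w * PC w) (fun w => B w * Abr w),
              forall M : {RV P >-> R},
                is_dirichlet_mean P (alpha * theta) Lambda M ->
                indep P B M ->
                eq_law P (fun w => B w * PC w) (fun w => B w * M w),
              forall M1 : {RV P >-> R},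
                is_dirichlet_mean P 1 (mix0 (alpha * theta) Lambda) M1 ->
                eq_law P (fun w => B w * PC w) M1 &
              has_density P (fun w => B w * PC w) `]0, 1[
                (g_density alpha p theta)]) /\
        (forall y : R, 0 < y < 1 ->
          g_density alpha p theta y =
          pi^-1 * (y `^ (alpha * theta - 1) * sinC alpha p theta y /
                   denom alpha p theta y))])
  /\
  (forall theta : R, 0 < theta -> 0 < theta * alpha < 1 ->
    (forall M : {RV P >-> R},
      is_dirichlet_mean P 1 (mix0 (alpha * theta) (varrho_law alpha)) M ->
      has_density P (fun w => c * M w / (c * M w + 1)) `]0, 1[
        (f_density alpha p theta)) /\
    (forall M1 : {RV P >-> R},
      is_dirichlet_mean P 1 (mix0 (alpha * theta) Lambda) M1 ->
      has_density P M1 `]0, 1[ (g_density alpha p theta))).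
Proof.
move=> al01 p01 HS HS' SS' XE q c Lambda.
have mS : measurable_fun setT S by exact: measurable_funP.
have mS' : measurable_fun setT S' by exact: measurable_funP.
have mX : measurable_fun setT X by exact: measurable_funP.
have HX (lam : R) (l0 : 0 < lam) := stable_ratio_stieltjes al01 mS mS' mX HS HS' SS' XE l0.
have X0 : P (X @^-1` `[0, +oo[) = 1%E.
  apply: probability_sub1 (stable_ratio_gt0 mS mS' HS HS' XE) _.
  - exact: measurable_preimage.
  - exact: measurable_preimage.
  - by move=> w; rewrite /= !in_itv/= !andbT; exact: ltW.
have /andP[al0 al1] := al01; have /andP[p0 p1] := p01.
have q0 : 0 < q by rewrite subr_gt0.
have mRV (Y : {RV P >-> R}) : measurable_fun setT Y by exact: measurable_funP.
split => theta.
  move=> /andP[th0 th1]; have th01 : 0 < theta < 1 by rewrite th0.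
  have alth : alpha * theta < 1 by rewrite mulr_ilt1// ltW.
  split.
  - move=> B G G' HB HG HG' GG'.
    pose h (b : R) : R := p * b / (q + p * b).
    have mh : measurable_fun setT h by rewrite /h; measurability.
    have BG := beta_gamma_law (mRV B) (mRV G) (mRV G') th01 HB HG HG' GG'.
    apply: (eq_law_trans (eq_law_comp mh BG)).
    have pG := has_density_preimage (mRV G) HG (measurable_itv _).
    have pG' := has_density_preimage (mRV G') HG' (measurable_itv _).
    have mG := mRV G; have mG' := mRV G'.
    apply: (eq_law_ae (A := G @^-1` `]0, +oo[ `&` G' @^-1` `]0, +oo[)).
    + by apply: measurableI; exact: measurable_preimage.
    + by apply: probability_setI1 => //; exact: measurable_preimage.
    + by rewrite /h; measurability.
    + by measurability.
    + move=> w [/=]; rewrite !in_itv/= !andbT => g0 g'0; rewrite /h.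
      have s0 : 0 < G w + G' w by rewrite addr_gt0.
      have e0 : 0 < G w + q * G' w by rewrite addr_gt0// mulr_gt0.
      have -> : q + p * (G w / (G w + G' w)) = (G w + q * G' w) / (G w + G' w).
        by rewrite /q; field; rewrite gt_eqF.
      by rewrite invf_div mulrA mulrA mulfVK ?gt_eqF.
  - move=> xi B HB BX xiB xiX A.
    have AE := skewed_eq_scaled alpha p01 mX (mRV B) HB BX (mRV xi) xiB xiX.
    split => //.
    + move=> M HM; apply: (eq_law_trans AE).
      exact: (skewed_scaled_mean p al01 th0 alth mX X0 HX th1 (mRV B) HB BX (mRV M) HM).
    + apply: (eq_law_has_density AE).
      exact: (skewed_scaled_density al01 p01 th0 alth mX X0 HX th1 (mRV B) HB BX).
  - split; last by move=> y; exact: g_densityE.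
    move=> B PC HB HPC BPC.
    (* The transform to which every other representation of the product is compared. *)
    have T1 (s : R) (s0 : 0 < s) :=
      beta_mul_PD_stieltjes al01 th0 alth (mRV B) (mRV PC) HB HPC BPC s0.
    have B1 := has_density_preimage (mRV B) HB (measurable_itv _).
    have mB := mRV B; have mPC := mRV PC.
    have nonneg (V : {RV P >-> R}) : P (V @^-1` `[0, +oo[) = 1%E ->
        P ((fun w => B w * V w) @^-1` `[0, +oo[) = 1%E.
      move=> V0; have mV := mRV V.
      have mBV : measurable_fun setT (fun w => B w * V w) by measurability.
      apply: probability_sub1 (probability_setI1 _ _ B1 V0) _.
      - by apply: measurableI; exact: measurable_preimage.
      - exact: measurable_preimage.
      - exact: measurable_preimage.
      - exact: measurable_preimage.
      - move=> w [/=]; rewrite !in_itv/= !andbT => /andP[b0 _] v0.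
        by rewrite mulr_ge0// ltW.
    have PD0 (V : {RV P >-> R}) : is_PD_mass P alpha theta p V -> P (V @^-1` `[0, +oo[) = 1%E.
      move=> [V1 _]; apply: probability_sub1 V1 _; [exact: measurable_preimage|exact: measurable_preimage|].
      by move=> w; rewrite /= !in_itv/= andbT => /andP[].
    have mBPC : measurable_fun setT (fun w => B w * PC w) by measurability.
    split.
    + move=> Abr HA BA; have mA := mRV Abr.
      apply: stieltjes_eq_law; [by measurability|by measurability|exact/nonneg/PD0|exact/nonneg/PD0|].
      move=> s s0; rewrite !expectationE T1//.
      by rewrite (beta_mul_PD_stieltjes al01 th0 alth mB mA HB HA BA s0).
    + move=> M HM BM; have mM := mRV M.
      apply: stieltjes_eq_law; [by measurability|by measurability|exact/nonneg/PD0| |].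
        by apply: nonneg; case: HM.
      move=> s s0; rewrite !expectationE T1//.
      by rewrite (beta_mul_mean_stieltjes al01 p01 th0 alth mX X0 HX mB mM HB HM BM s0).
    + move=> M1 HM1; have mM1 := mRV M1.
      apply: (stieltjes_eq_law mBPC mM1); [exact/nonneg/PD0|by case: HM1|].
      move=> s s0; rewrite !expectationE T1//.
      by rewrite (Lambda_mean1_stieltjes al01 p01 th0 alth mX X0 HX mM1 HM1 s0).
    + by apply: (g_has_density al01 p01 th0 alth mBPC) => //; exact/nonneg/PD0.
(* For theta >= 1 there is no beta representation of the first kind, but the means still have the
   two transforms, from which the densities were derived under alpha theta < 1. *)
move=> th0; rewrite mulrC => /andP[_ alth]; split => M HM.
  apply: (f_has_density al01 p01 th0 alth (mRV M)); first by case: HM.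
  by move=> lam l0; exact: (varrho_mean_stieltjes al01 th0 alth mX X0 HX (mRV M) HM l0).
apply: (g_has_density al01 p01 th0 alth (mRV M)); first by case: HM.
by move=> s s0; exact: (Lambda_mean1_stieltjes al01 p01 th0 alth mX X0 HX (mRV M) HM s0).
Qed.
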